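(* Let $r=\min(r_1,\dots,r_m)\in(0,\tfrac12]$ and $0<\gamma\le 1$. Assume the regularity, capacity and noise assumptions described in the context, and let the local sample sizes be $n_j=\lfloor \tfrac nm\rfloor$ for $j=1,\dots,m$. Choose $$\lambda_n\simeq \Big(\frac1n\Big)^{\frac{1}{2r+1+\gamma}}$$ and let the number $m=m_n$ of sets of the partition satisfy $$m\lesssim n^{\alpha},\qquad \alpha\le \frac{2r}{2r+1+\gamma}.$$ Then the partitioned kernel regularized least squares estimator $\hat f_{\mathcal D}^{\lambda_n}$ satisfies $$\mathbb E\big[\mathcal E(\hat f_{\mathcal D}^{\lambda_n})-\mathcal E(f_\rho)\big]\;\lesssim\; R^2\Big(\frac1n\Big)^{\frac{2r+1}{2r+1+\gamma}} .$$
   Context: Notation. For positive sequences, $a_n\lesssim b_n$ means $a_n\le C b_n$ for a constant $C<\infty$ not depending on $n$ or $m$ (it may depend on the fixed model parameters: $r,\gamma$, kernel bound $\kappa$, $\sigma,M,R$ and the constants in the assumptions); $a_n\simeq b_n$ means $a_n\lesssim b_n$ and $b_n\lesssim a_n$. For $f$ in a Hilbert space, $f\otimes f$ is the operator $h\mapsto\langle h,f\rangle f$. Learning setting. $\mathcal X$ is a standard Borel space, $\rho$ a probability measure on $\mathcal X\times\mathbb R$ with marginal $\nu$ on $\mathcal X$ and conditional distributions $\rho(\cdot|x)$. Put $\mathcal E(f)=\int (f(x)-y)^2\,d\rho(x,y)$ and $f_\rho(x)=\int y\,d\rho(y|x)$. Partition and kernels. $\{\mathcal X_1,\dots,\mathcal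 X_m\}$ is a partition of $\mathcal X$ into nonempty disjoint measurable sets with $p_j=\nu(\mathcal X_j)>0$, and $\nu_j(A)=p_j^{-1}\nu(A\cap\mathcal X_j)$. The partition, and so $m=m_n$, may depend on $n$; the constants $r,\gamma,R,\sigma,M,\kappa$ do not. For each $j$, $\mathcal H_j$ is a separable RKHS on $\mathcal X_j$ with measurable positive semi-definite kernel $K_j$ with $\sup_x K_j(x,x)\le\kappa_j^2$, $\kappa_j\le\kappa<\infty$. Functions in $\mathcal H_j$ are extended by zero to $\mathcal X$, giving the RKHS $\hat{\mathcal H}_j$ (same norm) with kernel $\hat K_j$ equal to $K_j$ on $\mathcal X_j\times\mathcal X_j$ and zero elsewhere. The direct sum $\mathcal H=\bigoplus_{j=1}^m\hat{\mathcal H}_j$ with norm $\|f_1+\dots+f_m\|_{\mathcal H}^2=\sum_j p_j\|f_j\|_{\hat{\mathcal H}_j}^2$ is an RKHS with kernel $K(x,x')=\sum_j p_j^{-1}\hat K_j(x,x')$. Covariance operators: $T=\mathbb E_{X\sim\nu}[K_X\otimes K_X]$ on $\mathcal H$, with $K_x=K(x,\cdot)$, and $T_j=\mathbb E_{X\sim\nu_j}[\hat K_j(X,\cdot)\otimes\hat K_j(X,\cdot)]$ on $\hat{\mathcal H}_j$. Effective dimension: $\mathcal N(A,\lambda)=\mathrm{Trace}[(A+\lambda)^{-1}A]$. Regularity assumption. $f_\rho\in\mathcal H$, so $f_\rho=f_1+\dots+f_m$ uniquely with $f_j\in\hat{\mathcal H}_j$; and for every $j$, $\|T_j^{-r_j}f_j\|_{\hat{\mathcal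 H}_j}\le R$ with $0<r_j\le\frac12$, $R<\infty$ (i.e. $f_j=T_j^{r_j}h_j$ with $\|h_j\|_{\hat{\mathcal H}_j}\le R$). Capacity assumption. (1) $m\sum_{j=1}^m p_j\,\mathcal N(T_j,\lambda)=O(\mathcal N(T,m\lambda))$; (2) $\mathcal N(T,\lambda)\lesssim\lambda^{-\gamma}$ for some $0<\gamma\le1$ (constants uniform in $\lambda>0$ and $n$). Noise assumption (Bernstein). For some $\sigma,M>0$ and every integer $k\ge2$: $\mathbb E[|Y-f_\rho(X)|^k\,|\,X]\le\frac12 k!\,\sigma^2M^{k-2}$ $\nu$-a.s. Data and estimator. The data $\mathcal D=\{(x_i,y_i)\}_{i=1}^n$ are i.i.d. from $\rho$ and split into $\mathcal D_j=\{(x_i,y_i):i\in I_j\}$, $I_j=\{i:x_i\in\mathcal X_j\}$, $n_j=|I_j|$. The local sizes $n_j$ are taken as fixed, so $\mathcal D_j$ consists of $n_j$ i.i.d. draws from $\rho$ conditioned on $x\in\mathcal X_j$ (inputs distributed as $\nu_j$), independent over $j$. For $\lambda>0$, $\hat f_{\mathcal D_j}^\lambda=\sum_{i\in I_j}\alpha_j^{(i)}\hat K_j(x_i,\cdot)$ with $\alpha_j=(\mathbf K_j+n_j\lambda I)^{-1}\mathbf y_j$, where $\mathbf K_j=(K_j(x_i,x_k))_{i,k\in I_j}$, $\mathbf y_j=(y_i)_{i\in I_j}$; and $\hat f_{\mathcal D}^\lambda=\sum_{j=1}^m\hat f_{\mathcal D_j}^\lambda$. *)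

(* Defs.v *)
From HB Require Import structures.
From mathcomp Require Import all_boot all_order all_algebra.
From mathcomp Require Import all_classical all_reals all_analysis.

Set Implicit Arguments.
Unset Strict Implicit.
Unset Printing Implicit Defensive.

Import Order.TTheory GRing.Theory Num.Theory.
Import numFieldNormedType.Exports.
Local Open Scope classical_set_scope.
Local Open Scope ring_scope.

(* Borel isomorphic to a Polish space [Y]; a Hausdorff complete pseudometric
   space is a complete metric space, and for these separability is second
   countability. *)
Definition standard_borel (R : realType) d (X : measurableType d) : Prop :=
  exists (Y : completePseudoMetricType R) (f : Y -> X),
    [/\ hausdorff_space Y, @second_countable Y, bijective f &
        forall A : set X, measurable A <-> <<s @open Y >> (f @^-1` A)].

Section FunctionSpaces.
Variables (R : realType) (Y : Type).

(* The inner product is only meaningful on [fcar]. *)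
Record funspace := FunSpace {
  fcar : set (Y -> R);
  fip : (Y -> R) -> (Y -> R) -> R }.

Implicit Types (H : funspace) (f g h e : Y -> R) (K : Y -> Y -> R)
  (A B : (Y -> R) -> Y -> R).

Definition fnorm H f : R := Num.sqrt (fip H f f).

Definition is_hilbert H : Prop :=
  [/\ fcar H (fun=> 0) /\
      (forall (a : R) f g, fcar H f -> fcar H g ->
        fcar H (fun y => a * f y + g y)),
      forall (a : R) f g h, fcar H f -> fcar H g -> fcar H h ->
        fip H (fun y => a * f y + g y) h = a * fip H f h + fip H g h,
      forall f g, fcar H f -> fcar H g -> fip H f g = fip H g f,
      forall f, fcar H f ->
        0 <= fip H f f /\ (fip H f f = 0 -> f = (fun=> 0)) &
      forall u : nat -> Y -> R, (forall i, fcar H (u i)) ->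
        (forall eps : R, 0 < eps -> exists N : nat, forall i k : nat,
          (N <= i)%N -> (N <= k)%N -> fnorm H (u i \- u k) < eps) ->
        exists2 f, fcar H f & (fun i => fnorm H (u i \- f)) @ \oo --> (0 : R)].

Definition is_separable H : Prop :=
  exists2 u : nat -> Y -> R, (forall i, fcar H (u i)) &
    forall f (eps : R), fcar H f -> 0 < eps ->
      exists i, fnorm H (f \- u i) < eps.

Definition is_rkhs H K : Prop :=
  is_hilbert H /\
  forall x, fcar H (K x) /\ (forall f, fcar H f -> fip H f (K x) = f x).

Definition psd_kernel K : Prop :=
  (forall x y, K x y = K y x) /\
  (forall n (x : 'I_n -> Y) (c : 'I_n -> R),
    0 <= \sum_(i < n) \sum_(k < n) c i * c k * K (x i) (x k)).

(* f (x) f *)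
Definition rank_one H f : (Y -> R) -> Y -> R := fun h y => fip H h f * f y.

Definition orthonormal_basis H (E : set (Y -> R)) : Prop :=
  [/\ E `<=` fcar H,
      forall e, E e -> fip H e e = 1,
      forall e e', E e -> E e' -> e <> e' -> fip H e e' = 0 &
      forall f, fcar H f -> (forall e, E e -> fip H f e = 0) -> f = (fun=> 0)].

(* Only used for positive operators, for which the sum of nonnegative terms
   does not depend on the chosen basis. *)
Definition trace H B : \bar R :=
  \esum_(e in xget set0 (orthonormal_basis H)) (fip H (B e) e)%:E.

(* (A + lam)^-1 *)
Definition resolvent H A (lam : R) : (Y -> R) -> Y -> R := fun h =>
  xget (fun=> 0) [set g | fcar H g /\ (fun y => A g y + lam * g y) = h].

Definition effdim H A (lam : R) : \bar R :=
  trace H (fun f => resolvent H A lam (A f)).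

(* Fractional power A^s of a positive self-adjoint operator that has an
   orthonormal basis of eigenvectors (every compact one does):
   A^s f = sum_(e in E) mu(e)^s <f, e> e. *)
Definition oppow H A (s : R) : (Y -> R) -> Y -> R := fun f =>
  xget (fun=> 0) [set g | fcar H g /\
    exists (E : set (Y -> R)) (mu : (Y -> R) -> R),
      [/\ orthonormal_basis H E,
          forall e, E e -> 0 <= mu e /\ A e = (fun y => mu e * e y) &
          forall e, E e -> fip H g e = mu e `^ s * fip H f e]].

End FunctionSpaces.

Arguments funspace : clear implicits.

(* E_(X ~ mu)[K_X (x) K_X], the expectation of the operator-valued variable
   being understood weakly:
   <T f, g> = E <(K_X (x) K_X) f, g> for all g in H. *)
Definition covop (R : realType) d (X : measurableType d) (H : funspace R X)
    (K : X -> X -> R) (mu : {measure set X -> \bar R}) :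
    (X -> R) -> X -> R := fun f =>
  xget (fun=> 0) [set h | fcar H h /\ forall g, fcar H g ->
    fip H h g = \int[mu]_x fip H (rank_one H (K x) f) g].

Section ConditionalMeasure.
Variables (R : realType) (d : measure_display) (X : measurableType d).
Variables (mu : {measure set X -> \bar R}) (A : set X) (mA : measurable A).

Lemma condm_factor_ge0 : 0 <= (fine (mu A))^-1.
Proof. by rewrite invr_ge0 fine_ge0. Qed.

(* mu (. | A) *)
Definition condm : {measure set X -> \bar R} :=
  mscale (NngNum condm_factor_ge0) (mrestr mu mA).

End ConditionalMeasure.

(* Functions on a subset [A], extended by zero. *)
Definition ext_space (R : realType) (X : Type) (A : set X)
    (H : funspace R A) : funspace R X :=
  FunSpace [set 'valL_ (0 : R) g | g in fcar H]
           (fun f g => fip H (sigL A f) (sigL A g)).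

Definition ext_kernel (R : realType) (X : Type) (A : set X)
    (K : A -> A -> R) : X -> X -> R := fun x x' =>
  'valL_ (0 : R) (fun u : A => 'valL_ (0 : R) (K u) x') x.

Record local_model (R : realType) d (X : measurableType d) := LocalModel {
  ncell : nat;
  cell : 'I_ncell -> set X;
  mcell : forall j, measurable (cell j);
  lspace : forall j, funspace R (cell j);
  lkernel : forall j, cell j -> cell j -> R }.

Arguments ncell {R d X}.
Arguments cell {R d X}.
Arguments mcell {R d X}.
Arguments lspace {R d X}.
Arguments lkernel {R d X}.

Section Model.
Variables (R : realType) (d : measure_display) (X : measurableType d).
Variables (nu : {measure set X -> \bar R}) (S : local_model R X).

Local Notation m := (ncell S).

Definition weight (j : 'I_m) : R := fine (nu (cell S j)).

Definition hspace (j : 'I_m) : funspace R X := ext_space (lspace S j).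
Definition hkernel (j : 'I_m) : X -> X -> R := ext_kernel (lkernel S j).

Definition restr (j : 'I_m) (f : X -> R) : X -> R :=
  patch (fun=> 0) (cell S j) f.

Definition dspace : funspace R X :=
  FunSpace
    [set f | exists2 g : 'I_m -> X -> R, (forall j, fcar (hspace j) (g j)) &
       f = (fun x => \sum_(j < m) g j x)]
    (fun f g =>
       \sum_(j < m) weight j * fip (hspace j) (restr j f) (restr j g)).

Definition dkernel : X -> X -> R := fun x x' =>
  \sum_(j < m) (weight j)^-1 * hkernel j x x'.

Definition gcov : (X -> R) -> X -> R := covop dspace dkernel nu.

Definition lcov (j : 'I_m) : (X -> R) -> X -> R :=
  covop (hspace j) (hkernel j) (condm nu (mcell S j)).

Definition local_setting (kappa : R) : Prop :=
  partition [set: 'I_m] (cell S) [set: X] /\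
  forall j : 'I_m,
    [/\ (0 < nu (cell S j))%E,
        is_rkhs (lspace S j) (lkernel S j) /\ is_separable (lspace S j),
        psd_kernel (lkernel S j),
        measurable_fun setT (fun u : X * X => hkernel j u.1 u.2) &
        exists kappaj : R, [/\ 0 <= kappaj, kappaj <= kappa &
          forall x : cell S j, lkernel S j x x <= kappaj ^+ 2]].

(* The component of f in the j-th summand is restr j f. *)
Definition regularity (f : X -> R) (rs : 'I_m -> R) (Rad : R) : Prop :=
  fcar dspace f /\
  forall j : 'I_m, 0 < rs j <= 2^-1 /\
    exists h : X -> R, [/\ fcar (hspace j) h, fnorm (hspace j) h <= Rad &
      restr j f = oppow (hspace j) (lcov j) (rs j) h].

Definition capacity (gamma C1 C2 : R) : Prop :=
  forall lam : R, 0 < lam ->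
    (m%:R%:E * \sum_(j < m) ((weight j)%:E * effdim (hspace j) (lcov j) lam)
       <= C1%:E * effdim dspace gcov (m%:R * lam))%E /\
    (effdim dspace gcov lam <= (C2 * lam `^ (- gamma))%:E)%E.

End Model.

Arguments hspace {R d X}.
Arguments hkernel {R d X}.

Section Learning.
Variables (R : realType) (d : measure_display) (X : measurableType d).

Local Notation RR := (measurableTypeR R).

Definition marginal (rho : {measure set (X * RR)%type -> \bar R})
    (nu : {measure set X -> \bar R}) : Prop :=
  forall A, measurable A -> nu A = rho (A `*` setT).

Definition disintegration (rho : {measure set (X * RR)%type -> \bar R})
    (nu : {measure set X -> \bar R})
    (rhoc : X -> {measure set RR -> \bar R}) : Prop :=
  forall A B, measurable A -> measurable B ->
    rho (A `*` B) = (\int[nu]_(x in A) rhoc x B)%E.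

Definition risk (rho : {measure set (X * RR)%type -> \bar R})
    (f : X -> R) : \bar R :=
  (\int[rho]_z ((f z.1 - z.2) ^+ 2)%:E)%E.

Definition regression (rhoc : X -> {measure set RR -> \bar R}) : X -> R :=
  fun x => \int[rhoc x]_y (y : R).

Definition bernstein (nu : {measure set X -> \bar R})
    (rhoc : X -> {measure set RR -> \bar R}) (sigma M : R) : Prop :=
  forall k : nat, (2 <= k)%N -> {ae nu, forall x,
    (\int[rhoc x]_y (`|(y : R) - regression rhoc x| ^+ k)%:E
      <= (2^-1 * k`!%:R * sigma ^+ 2 * M ^+ (k - 2))%:E)%E}.

Definition krls (K : X -> X -> R) n (z : 'I_n -> X * RR) (lam : R) : X -> R :=
  let G : 'M[R]_n := \matrix_(i < n, k < n) K (z i).1 (z k).1 in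
  let y : 'cV[R]_n := \col_(i < n) ((z i).2 : R) in
  let a : 'cV[R]_n := invmx (G + (n%:R * lam)%:M) *m y in
  fun x => \sum_(i < n) a i 0 * K (z i).1 x.

Definition partitioned_krls (S : local_model R X) (N : 'I_(ncell S) -> nat)
    (z : {j : 'I_(ncell S) & 'I_(N j)} -> X * RR) (lam : R) : X -> R :=
  fun x => \sum_(j < ncell S)
    krls (hkernel S j)
         (fun i : 'I_(N j) => z (Tagged (fun j => 'I_(N j)) i)) lam x.

End Learning.

Definition mutually_independent (R : realType) d d' (Omega : measurableType d)
    (P : {measure set Omega -> \bar R}) (T : measurableType d') (I : finType)
    (Z : I -> Omega -> T) : Prop :=
  forall (J : {set I}) (B : I -> set T), (forall i, measurable (B i)) ->
    P (\bigcap_(i in [set i | i \in J]) Z i @^-1` B i) =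
    (\prod_(i in J) P (Z i @^-1` B i))%E.

(* The pairs with index (j, i) are distributed as rho given x in cell j. The
   estimator uses the zero-extended kernel, which agrees with K_j on them
   almost surely. *)
Definition local_samples (R : realType) d d' (Omega : measurableType d)
    (P : {measure set Omega -> \bar R}) (X : measurableType d')
    (rho : {measure set (X * measurableTypeR R)%type -> \bar R})
    (S : local_model R X) (N : 'I_(ncell S) -> nat)
    (Z : {j : 'I_(ncell S) & 'I_(N j)} -> Omega -> X * measurableTypeR R) :
    Prop :=
  [/\ forall i, measurable_fun setT (Z i),
      forall i B, measurable B ->
        P (Z i @^-1` B) =
          condm rho (measurableX (mcell S (tag i)) measurableT) B &
      mutually_independent P Z].

(* Main.v *)
Require Import Defs.
From HB Require Import structures.
From mathcomp Require Import all_boot all_order all_algebra.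
From mathcomp Require Import all_classical all_reals all_analysis.
From mathcomp Require Import perm measurable_realfun.
From mathcomp Require Import ring lra.

Set Implicit Arguments.
Unset Strict Implicit.
Unset Printing Implicit Defensive.

Import Order.TTheory GRing.Theory Num.Theory.
Import numFieldNormedType.Exports.
Local Open Scope classical_set_scope.
Local Open Scope ring_scope.

(* On a fixed cell the estimator trained on N points has the bias and variance
   of kernel ridge regression, and both are bounded by exchangeability instead
   of operator concentration. Add a ghost observation to the N given ones and
   let C be the inverse of the regularized Gram matrix of the N + 1 points,
   with ridge mu = N lam. The prediction error at the ghost point is
   (C y)_(N+1) / C_(N+1, N+1), the diagonal entries of C lie between
   1 / (mu + kappa^2) and 1 / mu, and every observation may play the ghost, so
   that expected squared errors become expectations of full-sample quadratic
   forms. For the bias these are controlled by the energy identity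
   |C w|^2 + mu |g|^2 = <w, g> for g = (sum_i K_(x_i) (x) K_(x_i) + mu)^-1 w,
   together with the source condition in the form w = (T + lam) k; for the
   noise, by the expected leverage scores, whose sum is the trace of a finite
   rank operator that is compared basis vector by basis vector with
   N(T, lam). Moreover (N lam + kappa^2) / (N lam) is bounded because
   m <~ n^(2r / (2r+1+gamma)). The excess risk is the weighted sum of the
   local errors and the capacity assumption bounds the weighted sum of the
   local effective dimensions. When n < m there is no data, but then n is
   bounded and f_rho is bounded in terms of kappa and R. *)

(** * Hilbert spaces of functions *)

(** Two obstacles shape the argument: sample quantities have to be compared with [T] in mean at
    every sample size, and the labels are unbounded. The ridge stays [N lam] for [N] and for [N + 1]
    points, so that removing the ghost is an exact algebraic identity; its only cost is the factor
    [c = 1 + kappa^2 / (N lam)], the ratio of the two bounds on the diagonal of C. The bias estimate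
    is self-referential: the mean of [<w, g>] is bounded by the source terms plus half of itself,
    and the half is absorbed once this mean is known to be finite. For the noise, nonnegativity of
    the squared norm of the fit bounds the leave-one-out predictions by the noise energy weighted
    with leverage scores, up to a cross term between the noise at a point and the prediction there
    from the other points; this term has mean zero. Means are extended integrals of nonnegative
    functions, and centering is expressed by equal means of the positive and negative parts. *)

Section Hilbert.
Variables (R : realType) (Y : Type) (H : funspace R Y).
Hypothesis hH : is_hilbert H.
Implicit Types (f g h : Y -> R).

Local Notation ip := (fip H).

Lemma fcar0 : fcar H (fun=> 0).
Proof. by case: hH => -[h0 _] _ _ _ _; exact: h0. Qed.

Lemma fcarZD a f g : fcar H f -> fcar H g -> fcar H (fun y => a * f y + g y).
Proof. by case: hH => -[_ h] _ _ _ _; exact: h. Qed.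

Lemma fcarD f g : fcar H f -> fcar H g -> fcar H (f \+ g).
Proof.
move=> hf hg; rewrite (_ : f \+ g = fun y => 1 * f y + g y); first exact: fcarZD.
by apply/funext => y /=; rewrite mul1r.
Qed.

Lemma fcarZ a f : fcar H f -> fcar H (a \*o f).
Proof.
move=> hf; rewrite (_ : a \*o f = fun y => a * f y + (fun=> 0) y).
  by apply: fcarZD => //; exact: fcar0.
by apply/funext => y /=; rewrite addr0.
Qed.

Lemma fcarB f g : fcar H f -> fcar H g -> fcar H (f \- g).
Proof.
move=> hf hg; rewrite (_ : f \- g = fun y => -1 * g y + f y); first exact: fcarZD.
by apply/funext => y /=; rewrite mulN1r addrC.
Qed.

Lemma fcar_sum I (s : seq I) (P : pred I) (F : I -> Y -> R) :
  (forall i, P i -> fcar H (F i)) -> fcar H (fun y => \sum_(i <- s | P i) F i y).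
Proof.
move=> hF; elim: s => [|i s ih].
  by rewrite (_ : (fun y => _) = fun=> 0);
    [exact: fcar0 | apply/funext => y; rewrite big_nil].
have [Pi|/negbTE nPi] := boolP (P i); last first.
  by move: ih; congr fcar; apply/funext => y; rewrite big_cons nPi.
rewrite (_ : (fun y => _) = F i \+ (fun y => \sum_(j <- s | P j) F j y)).
  by apply: fcarD => //; exact: hF.
by apply/funext => y; rewrite big_cons Pi.
Qed.

Lemma ipC f g : fcar H f -> fcar H g -> ip f g = ip g f.
Proof. by case: hH => _ _ H3 _ _; exact: H3. Qed.

Lemma ipZDl a f g h : fcar H f -> fcar H g -> fcar H h ->
  ip (fun y => a * f y + g y) h = a * ip f h + ip g h.
Proof. by case: hH => _ H2 _ _ _; exact: H2. Qed.

Lemma ip0l h : fcar H h -> ip (fun=> 0) h = 0.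
Proof.
move=> hh; have := ipZDl 1 fcar0 fcar0 hh.
rewrite (_ : (fun y => _) = (fun=> 0 : R)).
  by rewrite mul1r => /eqP; rewrite -subr_eq0 opprD addNKr oppr_eq0 => /eqP.
by apply/funext => y; rewrite mul1r addr0.
Qed.

Lemma ipDl f g h : fcar H f -> fcar H g -> fcar H h ->
  ip (f \+ g) h = ip f h + ip g h.
Proof.
move=> hf hg hh; rewrite -[ip f h]mul1r -ipZDl//; congr (ip _ h).
by apply/funext => y /=; rewrite mul1r.
Qed.

Lemma ipZl a f h : fcar H f -> fcar H h -> ip (a \*o f) h = a * ip f h.
Proof.
move=> hf hh; rewrite -[RHS]addr0 -(ip0l hh) -ipZDl//; last exact: fcar0.
by congr (ip _ h); apply/funext => y /=; rewrite addr0.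
Qed.

Lemma ipBl f g h : fcar H f -> fcar H g -> fcar H h ->
  ip (f \- g) h = ip f h - ip g h.
Proof.
move=> hf hg hh; rewrite addrC -mulN1r -ipZDl//; congr (ip _ h).
by apply/funext => y /=; rewrite mulN1r addrC.
Qed.

Lemma ip_suml I (s : seq I) (P : pred I) (F : I -> Y -> R) h :
  (forall i, P i -> fcar H (F i)) -> fcar H h ->
  ip (fun y => \sum_(i <- s | P i) F i y) h = \sum_(i <- s | P i) ip (F i) h.
Proof.
move=> hF hh; elim: s => [|i s ih].
  rewrite big_nil (_ : (fun y => _) = fun=> 0) ?ip0l//.
  by apply/funext => y; rewrite big_nil.
rewrite big_cons; have [Pi|/negbTE nPi] := boolP (P i); last first.
  by rewrite -ih; congr (ip _ h); apply/funext => y; rewrite big_cons nPi.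
rewrite (_ : (fun y => _) = F i \+ (fun y => \sum_(j <- s | P j) F j y)).
  by rewrite -ih -ipDl//; [exact: hF | exact: fcar_sum].
by apply/funext => y; rewrite big_cons Pi.
Qed.

Lemma ip0r h : fcar H h -> ip h (fun=> 0) = 0.
Proof. by move=> hh; rewrite ipC ?ip0l//; exact: fcar0. Qed.

Lemma ipDr f g h : fcar H f -> fcar H g -> fcar H h ->
  ip h (f \+ g) = ip h f + ip h g.
Proof.
by move=> hf hg hh; rewrite ipC ?ipDl ?(ipC hh)//; exact: fcarD.
Qed.

Lemma ipZr a f h : fcar H f -> fcar H h -> ip h (a \*o f) = a * ip h f.
Proof. by move=> hf hh; rewrite ipC ?ipZl ?(ipC hh)//; exact: fcarZ. Qed.

Lemma ipBr f g h : fcar H f -> fcar H g -> fcar H h ->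
  ip h (f \- g) = ip h f - ip h g.
Proof.
by move=> hf hg hh; rewrite ipC ?ipBl ?(ipC hh)//; exact: fcarB.
Qed.

Lemma ip_sumr I (s : seq I) (P : pred I) (F : I -> Y -> R) h :
  (forall i, P i -> fcar H (F i)) -> fcar H h ->
  ip h (fun y => \sum_(i <- s | P i) F i y) = \sum_(i <- s | P i) ip h (F i).
Proof.
move=> hF hh; rewrite ipC ?ip_suml//; last exact: fcar_sum.
by apply: eq_bigr => i Pi; apply: ipC => //; exact: hF.
Qed.

Lemma ip_ge0 f : fcar H f -> 0 <= ip f f.
Proof. by move=> hf; case: hH => _ _ _ /(_ _ hf)[? ?] _. Qed.

Lemma ip_eq0 f : fcar H f -> ip f f = 0 -> f = (fun=> 0).
Proof. by move=> hf; case: hH => _ _ _ /(_ _ hf)[? ?] _. Qed.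

Lemma ipZDZD a f g : fcar H f -> fcar H g ->
  ip (fun y => a * f y + g y) (fun y => a * f y + g y) =
  a ^+ 2 * ip f f + a * ip f g *+ 2 + ip g g.
Proof.
move=> hf hg; have hk := fcarZD a hf hg.
rewrite ipZDl// (ipC hf)// (ipC hg)// !ipZDl// (ipC hg)//; ring.
Qed.

Lemma ip_BB f g : fcar H f -> fcar H g ->
  ip (f \- g) (f \- g) = ip f f - ip f g *+ 2 + ip g g.
Proof.
move=> hf hg; have hk := fcarB hf hg.
rewrite ipBl// !ipBr// (ipC hg hf); ring.
Qed.

Lemma cauchy_schwarz f g : fcar H f -> fcar H g ->
  ip f g ^+ 2 <= ip f f * ip g g.
Proof.
move=> hf hg.
have [f0|f0] := eqVneq (ip f f) 0.
  by rewrite (ip_eq0 hf f0) !ip0l// ?mul0r ?expr0n//; exact: fcar0.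
have fgt0 : 0 < ip f f by rewrite lt_neqAle eq_sym f0 ip_ge0.
have := ip_ge0 (fcarZD (- (ip f g / ip f f)) hf hg).
rewrite ipZDZD// -(pmulr_rge0 _ fgt0).
rewrite (_ : ip f f * (_ + _) = ip f f * ip g g - ip f g ^+ 2).
  by rewrite subr_ge0.
by field.
Qed.

Lemma fnorm_ge0 f : 0 <= fnorm H f.
Proof. exact: sqrtr_ge0. Qed.

Lemma sqr_fnorm f : fcar H f -> fnorm H f ^+ 2 = ip f f.
Proof. by move=> hf; rewrite sqr_sqrtr// ip_ge0. Qed.

Lemma ip_le_fnorm f g : fcar H f -> fcar H g ->
  `|ip f g| <= fnorm H f * fnorm H g.
Proof.
move=> hf hg; rewrite -(@ler_pXn2r _ 2)// ?nnegrE ?mulr_ge0 ?fnorm_ge0//.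
by rewrite real_normK ?num_real// exprMn !sqr_fnorm// cauchy_schwarz.
Qed.

Lemma fnorm_le f (c : R) : fcar H f -> 0 <= c -> (fnorm H f <= c) = (ip f f <= c ^+ 2).
Proof.
move=> hf c0.
by rewrite -sqr_fnorm// ler_pXn2r// nnegrE fnorm_ge0.
Qed.

Lemma fnorm_lt f (c : R) : fcar H f -> 0 < c -> (fnorm H f < c) = (ip f f < c ^+ 2).
Proof.
move=> hf c0.
by rewrite -sqr_fnorm// ltr_pXn2r// nnegrE ?fnorm_ge0// ltW.
Qed.

(** Norm convergence is weakened to convergence of inner products, which is all that the Riesz and
    Parseval arguments use, and the Cauchy condition is put on squared norms to avoid square
    roots. *)
Lemma hilbert_complete (u : nat -> Y -> R) : (forall i, fcar H (u i)) ->
  (forall eps : R, 0 < eps -> exists N : nat, forall i k : nat,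
     (N <= i)%N -> (N <= k)%N -> ip (u i \- u k) (u i \- u k) < eps) ->
  exists2 f, fcar H f & forall h, fcar H h -> (fun i => ip (u i) h) @ \oo --> ip f h.
Proof.
move=> hu cu; case: hH => _ _ _ _ /(_ u hu)[|f hf uf].
  move=> eps e0; have [|N hN] := cu (eps ^+ 2); first by rewrite exprn_gt0.
  by exists N => i k Ni Nk; rewrite fnorm_lt//; [exact: hN | exact: fcarB].
exists f => // h hh.
apply/cvgrPdist_le => /= e e0.
have e'0 : 0 < e / (1 + fnorm H h).
  by rewrite divr_gt0// ltr_wpDr// fnorm_ge0.
move/cvgrPdist_le : uf => /(_ _ e'0) [N _ hN]; exists N => // i /hN /=.
rewrite sub0r normrN ger0_norm ?fnorm_ge0// ler_pdivlMr ?ltr_wpDr ?fnorm_ge0//.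
apply: le_trans; rewrite distrC -ipBl//.
apply: le_trans (ip_le_fnorm _ hh) _; first exact: fcarB.
by rewrite mulrDr mulr1 lerDr fnorm_ge0.
Qed.

End Hilbert.

(** * Riesz representation *)

Section Riesz.
Variables (R : realType) (Y : Type) (H : funspace R Y).
Hypothesis hH : is_hilbert H.
Local Notation ip := (fip H).

(** Evaluate at the minimizer [t = - b / a]; when [a = 0] the polynomial is affine in [t], which
    forces [b = 0]. *)
Lemma quadratic_ge (a b e : R) : 0 <= a -> (forall t, - e <= t * b *+ 2 + t ^+ 2 * a) ->
  b ^+ 2 <= e * a.
Proof.
move=> a0 h; have [a00|an0] := eqVneq a 0.
  rewrite a00 mulr0; have [->|b0] := eqVneq b 0; first by rewrite expr0n.
  have := h (- (e + 1) / (b *+ 2)).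
  rewrite a00 mulr0 addr0 (_ : _ *+ 2 = - (e + 1)); last by field.
  lra.
have := h (- b / a); rewrite -(@ler_pM2r _ a) ?lt_neqAle 1?eq_sym ?an0//.
rewrite (_ : (_ + _) * a = - b ^+ 2); last by field.
by rewrite mulNr lerN2.
Qed.

(* The minimizing sequence of [<g, g> - 2 l g] is Cauchy by the parallelogram
   law, and its limit is a critical point. *)
Lemma riesz (l : (Y -> R) -> R) (L : R) : 0 <= L ->
  (forall a f g, fcar H f -> fcar H g -> l (fun y => a * f y + g y) = a * l f + l g) ->
  (forall f, fcar H f -> l f ^+ 2 <= L * ip f f) ->
  exists2 g, fcar H g & forall f, fcar H f -> ip g f = l f.
Proof.
move=> L0 ll lb.
pose J g := ip g g - l g *+ 2.
have Jlb g : fcar H g -> - L <= J g.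
  move=> hg; rewrite /J.
  have := lb g hg; have := ip_ge0 hH hg.
  set x := ip g g; set y := l g => x0 yx.
  have : y *+ 2 <= x + L.
    apply: le_trans (ler_norm _) _; rewrite -(@ler_pXn2r _ 2) ?nnegrE ?addr_ge0//.
    rewrite real_normK ?num_real//; have := sqr_ge0 (x - L); nra.
  lra.
pose S := [set J g | g in fcar H].
have hS : has_inf S.
  split; first by exists (J (fun=> 0)); exists (fun=> 0) => //; exact: fcar0.
  by exists (- L) => _ [g hg <-]; exact: Jlb.
have Ile g : fcar H g -> inf S <= J g.
  by move=> hg; apply: ge_inf; [case: hS | exists g].
have ex n : exists g, fcar H g /\ J g < inf S + n.+1%:R^-1.
  have [||_ [g hg <-] Jg] := @inf_adherent _ S n.+1%:R^-1 => //.
  by exists g.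
have {ex} [u hu] := choice ex.
have JD a f g : fcar H f -> fcar H g ->
    J (fun y => a * f y + g y) = J g + a * (ip g f - l f) *+ 2 + a ^+ 2 * ip f f.
  by move=> hf hg; rewrite /J ipZDZD// ll// (ipC hH hg hf); ring.
(* [u n] minimizes [J] up to [1 / (n+1)], so [J (u n + t f) - J (u n)] is at least [- 1 / (n+1)] for
   all [t]: the first variation at [u n] nearly vanishes. *)
have crit n f : fcar H f -> (ip (u n) f - l f) ^+ 2 <= n.+1%:R^-1 * ip f f.
  move=> hf; have [hun Jun] := hu n.
  apply: quadratic_ge => [|t]; first exact: ip_ge0.
  have := Ile _ (fcarZD hH t hf hun); rewrite JD// => h1.
  by move: Jun h1; move: (n.+1%:R^-1) => e; lra.
have par n m : ip (u n \- u m) (u n \- u m) <= (n.+1%:R^-1 + m.+1%:R^-1) *+ 2.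
  have [hn Jn] := hu n; have [hm Jm] := hu m.
  have hnm := fcarB hH hn hm.
  have := Ile _ (fcarZD hH (2^-1) hnm hm); rewrite JD//.
  have E : J (u n) = J (u m) + 1 * (ip (u m) (u n \- u m) - l (u n \- u m)) *+ 2
      + 1 ^+ 2 * ip (u n \- u m) (u n \- u m).
    rewrite -JD//; congr J; apply/funext => y /=; ring.
  move: E Jn Jm; move: (n.+1%:R^-1) (m.+1%:R^-1) => e1 e2.
  move: (ip (u m) (u n \- u m) - l (u n \- u m)) (ip (u n \- u m) (u n \- u m)).
  by move=> b a; lra.
have [||g hg ug] := hilbert_complete hH (u := u).
- by move=> n; case: (hu n).
- move=> e e0; have e4 : 0 < e / 4 by rewrite divr_gt0.
  have [N _ hN] := near_infty_natSinv_lt (PosNum e4).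
  exists N => i k /hN /= hi /hN /= hk.
  apply: le_lt_trans (par _ _) _.
  by move: hi hk; move: (i.+1%:R^-1) (k.+1%:R^-1) => e1 e2; lra.
exists g => // f hf; apply/eqP; rewrite -subr_eq0 -sqrf_eq0 eq_le sqr_ge0 andbT.
have c1 : (fun n => (ip (u n) f - l f) ^+ 2) @ \oo --> (ip g f - l f) ^+ 2.
  have h : (fun n => ip (u n) f - l f) @ \oo --> ip g f - l f.
    by apply: cvgB; [exact: ug | exact: cvg_cst].
  rewrite expr2 (_ : (fun n => _) = fun n => (ip (u n) f - l f) * (ip (u n) f - l f)).
    exact: (cvgM h h).
  by apply/funext => n; rewrite expr2.
have c2 : (fun n => n.+1%:R^-1 * ip f f) @ \oo --> 0 * ip f f.
  by apply: cvgMr_tmp; exact: cvg_harmonic.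
rewrite mul0r in c2; apply: (ler_cvg_to c1 c2).
by apply: nearW => n; exact: crit.
Qed.

End Riesz.

(** * Orthonormal bases, Bessel and Parseval *)

Section OrthonormalBasis.
Variables (R : realType) (Y : Type) (H : funspace R Y).
Hypothesis hH : is_hilbert H.
Local Notation ip := (fip H).

(** Zorn's lemma: a nonzero vector orthogonal to a maximal orthonormal family could be normalized
    and adjoined. *)
Lemma exists_orthonormal_basis : exists E, orthonormal_basis H E.
Proof.
pose P (E : set (Y -> R)) := [/\ E `<=` fcar H, forall e, E e -> ip e e = 1 &
  forall e e', E e -> E e' -> e <> e' -> ip e e' = 0].
have [F FP Ftot|E [[E1 E2 E3] Emax]] := @Zorn_bigcup _ P.
  split.
  - by move=> f [X /FP[h _ _]]; exact: h.
  - by move=> e [X /FP[_ h _]]; exact: h.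
  - move=> e e' [X FX Xe] [X' FX' Xe'].
    have [XX|XX] := Ftot _ _ FX FX'.
      by have [_ _ h] := FP _ FX'; apply: h => //; exact: XX.
    by have [_ _ h] := FP _ FX; apply: h => //; exact: XX.
exists E; split => // f hf fE; apply: contrapT => f0.
have nf : ip f f != 0 by apply/eqP => /(ip_eq0 hH hf).
have f_gt0 : 0 < ip f f by rewrite lt_neqAle eq_sym nf ip_ge0.
pose c := (Num.sqrt (ip f f))^-1; pose g := c \*o f.
have c0 : c != 0 by rewrite invr_eq0 gt_eqF// sqrtr_gt0.
have hg : fcar H g by exact: fcarZ.
have gE e : E e -> ip g e = 0.
  by move=> Ee; rewrite ipZl// ?fE ?mulr0//; exact: E1.
have gg : ip g g = 1.
  rewrite ipZl// ipZr// mulrA -expr2 exprVn sqr_sqrtr ?mulVf//; exact: ip_ge0.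
apply: (Emax (E `|` [set g])).
  split; first exact: subsetUl.
  move=> /(_ g) /(_ (or_intror erefl)) /gE.
  by rewrite gg => /eqP; rewrite oner_eq0.
split.
- by move=> e [/E1//|->].
- by move=> e [/E2//|->].
- move=> e e' [Ee|->] [Ee'|->] ne //; last exact: gE.
    exact: E3.
  by rewrite ipC ?gE//; exact: E1.
Qed.

(** Distinct basis vectors are at distance [sqrt 2], so no term of the dense sequence lies within
    [1/2] of two of them. *)
Lemma orthonormal_countable E : is_separable H -> orthonormal_basis H E ->
  countable E.
Proof.
move=> [u hu du] [E1 E2 E3 _]; apply/countable_injP.
have /choice [k hk] : forall f, exists i, E f -> fnorm H (f \- u i) < 2^-1.
  move=> f; have [Ef|nEf] := pselect (E f); last by exists 0%N.
  by have [||i hi] := du f 2^-1 => //; [exact: E1 | exists i].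
exists k => e e' /set_mem Ee /set_mem Ee' kk; apply: contrapT => ne.
have := hk _ Ee; have := hk _ Ee'; rewrite -kk.
have he := E1 _ Ee; have he' := E1 _ Ee'.
have hv := hu (k e).
rewrite !fnorm_lt//; [|exact: fcarB..].
have hee' := fcarB hH he he'.
have := ip_ge0 hH (fcarD hH (fcarB hH he hv) (fcarB hH he' hv)).
rewrite (_ : ip (_ \+ _) _ = 
    (ip (e \- u (k e)) (e \- u (k e)) + ip (e' \- u (k e)) (e' \- u (k e))) *+ 2 -
    ip (e \- e') (e \- e')).
  have -> : ip (e \- e') (e \- e') = 2.
    by rewrite ip_BB// (E2 _ Ee) (E2 _ Ee') E3//; ring.
  move: (ip (e \- _) _) (ip (e' \- _) _) => a b; lra.
have -> : (e \- u (k e)) \+ (e' \- u (k e)) = (fun y => 1 * (e \- u (k e)) y + (e' \- u (k e)) y).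
  by apply/funext => y /=; ring.
have -> : e \- e' = (fun y => -1 * (e' \- u (k e)) y + (e \- u (k e)) y).
  by apply/funext => y /=; ring.
have hev := fcarB hH he hv; have he'v := fcarB hH he' hv.
rewrite !ipZDZD// (ipC hH he'v hev); ring.
Qed.

(* The zero function pads the enumeration of a finite basis. *)
Record onb_enum (E : set (Y -> R)) (e : nat -> Y -> R) : Prop := OnbEnum {
  onb_enum_in : forall i, E (e i) \/ e i = (fun=> 0);
  onb_enum_inj : forall i k, E (e i) -> e i = e k -> i = k;
  onb_enum_onto : forall f, E f -> exists i, e i = f }.

Lemma exists_onb_enum E : is_separable H -> orthonormal_basis H E ->
  exists e, onb_enum E e.
Proof.
move=> sH onb; have /countable_injP [k kinj] := orthonormal_countable sH onb.
have E0 : ~ E (fun=> 0).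
  case: onb => E1 E2 _ _ E0; have := E2 _ E0.
  by rewrite ip0l ?E1//; [move/eqP; rewrite eq_sym oner_eq0 | exact: E1].
pose e i := xget (fun=> 0) [set f | E f /\ k f = i].
have eP f : E f -> e (k f) = f.
  move=> Ef; rewrite /e; case: xgetP => [g _ [Eg kg]|/(_ f)[]//].
  by apply: kinj => //; exact/mem_set.
exists e; split.
- by move=> i; rewrite /e; case: xgetP => [g _ []|]; [left|right].
- move=> i j Ei eij.
  have eE l : E (e l) -> k (e l) = l.
    by rewrite /e; case: xgetP => [g _ [_ ->]|_ /E0].
  by rewrite -(eE _ Ei) eij eE// -eij.
- by move=> f Ef; exists (k f); exact: eP.
Qed.

Section Parseval.
Variables (E : set (Y -> R)) (e : nat -> Y -> R).
Hypotheses (onb : orthonormal_basis H E) (eE : onb_enum E e).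

Lemma onb_enum_fcar i : fcar H (e i).
Proof.
case: onb => E1 _ _ _; case: (onb_enum_in eE i) => [/E1//|->]; exact: fcar0.
Qed.

Lemma onb_enum_orth i k : i != k -> ip (e i) (e k) = 0.
Proof.
move=> ik; case: onb => E1 E2 E3 _.
have [Ei|->] := onb_enum_in eE i; last by rewrite ip0l//; exact: onb_enum_fcar.
have [Ek|->] := onb_enum_in eE k; last by rewrite ip0r//; exact: onb_enum_fcar.
by apply: E3 => // /(onb_enum_inj eE Ei) /eqP; rewrite (negbTE ik).
Qed.

Lemma onb_enum_coefM f i : fcar H f -> ip f (e i) * ip (e i) (e i) = ip f (e i).
Proof.
move=> hf; case: onb => _ E2 _ _.
have [/E2 ->|->] := onb_enum_in eE i; first by rewrite mulr1.
by rewrite ip0r// mul0r.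
Qed.

Definition proj_onb m n f : Y -> R := fun y => \sum_(m <= i < n) ip f (e i) * e i y.

Lemma proj_onb_fcar m n f : fcar H (proj_onb m n f).
Proof.
apply: fcar_sum => // i _; have := fcarZ hH (ip f (e i)) (onb_enum_fcar i).
by [].
Qed.

Lemma ip_proj_onb m n f h : fcar H h ->
  ip (proj_onb m n f) h = \sum_(m <= i < n) ip f (e i) * ip h (e i).
Proof.
move=> hh; rewrite ip_suml//; last first.
  by move=> i _; exact: (fcarZ hH (ip f (e i)) (onb_enum_fcar i)).
apply: eq_bigr => i _; have hi := onb_enum_fcar i.
by rewrite (ipC hH hh)//; exact: ipZl.
Qed.

Lemma ip_proj_onb_coef m n f k : fcar H f ->
  ip (proj_onb m n f) (e k) = if (m <= k < n)%N then ip f (e k) else 0.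
Proof.
move=> hf; have hk := onb_enum_fcar k; rewrite ip_proj_onb//.
have [kmn|kmn] := boolP (m <= k < n)%N.
  rewrite (bigD1_seq k) ?mem_index_iota ?iota_uniq//= onb_enum_coefM// big1 ?addr0//.
  by move=> i ik; rewrite onb_enum_orth ?mulr0// eq_sym.
rewrite big_seq big1// => i; rewrite mem_index_iota => imn.
rewrite onb_enum_orth ?mulr0//; apply: contraNneq kmn => ->.
by [].
Qed.

Lemma ip_proj_onb2 m n f : fcar H f ->
  ip (proj_onb m n f) (proj_onb m n f) = \sum_(m <= i < n) ip f (e i) ^+ 2.
Proof.
move=> hf; rewrite ip_proj_onb; last exact: proj_onb_fcar.
rewrite big_seq [RHS]big_seq; apply: eq_bigr => i.
by rewrite mem_index_iota => imn; rewrite ip_proj_onb_coef// imn expr2.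
Qed.

Lemma bessel n f : fcar H f -> \sum_(0 <= i < n) ip f (e i) ^+ 2 <= ip f f.
Proof.
move=> hf; have hp := proj_onb_fcar 0 n f.
have := ip_ge0 hH (fcarB hH hf hp).
rewrite ip_BB// (ipC hH hf hp) ip_proj_onb// ip_proj_onb2//.
under eq_bigr do rewrite -expr2.
by rewrite mulr2n opprD addrA addrNK subr_ge0.
Qed.

Lemma proj_onb_cauchy f : fcar H f -> forall eps : R, 0 < eps ->
  exists N : nat, forall i k : nat, (N <= i)%N -> (N <= k)%N ->
    ip (proj_onb 0 i f \- proj_onb 0 k f) (proj_onb 0 i f \- proj_onb 0 k f) < eps.
Proof.
move=> hf eps e0; pose s n := \sum_(0 <= i < n) ip f (e i) ^+ 2.
have nds : nondecreasing_seq s.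
  move=> n m nm; rewrite /s [leRHS](big_cat_nat _ nm)//= lerDl.
  by apply: sumr_ge0 => i _; exact: sqr_ge0.
have cs : cvgn s.
  apply: nondecreasing_is_cvgn => //; exists (ip f f) => _ [n _ <-].
  exact: bessel.
have /cvgrPdist_lt /(_ _ e0) [N _ hN] := cs.
exists N.
have key i k : (N <= k <= i)%N ->
    ip (proj_onb 0 i f \- proj_onb 0 k f) (proj_onb 0 i f \- proj_onb 0 k f) < eps.
  move=> /andP[Nk ki].
  have -> : proj_onb 0 i f \- proj_onb 0 k f = proj_onb k i f.
    apply/funext => y /=; rewrite /proj_onb (big_cat_nat _ ki)//=.
    by rewrite addrAC subrr add0r.
  rewrite ip_proj_onb2//.
  have -> : \sum_(k <= j < i) ip f (e j) ^+ 2 = s i - s k.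
    by rewrite /s [X in X - _](big_cat_nat _ ki)//= addrAC subrr add0r.
  have /= := hN _ Nk; rewrite ger0_norm; last first.
    by rewrite subr_ge0; exact: nondecreasing_cvgn_le.
  by apply: le_lt_trans; rewrite lerD2r; exact: nondecreasing_cvgn_le.
move=> i k Ni Nk; have [ki|ik] := leqP k i; first by apply: key; rewrite Nk.
have hi := proj_onb_fcar 0 i f; have hk := proj_onb_fcar 0 k f.
have : (N <= i <= k)%N by rewrite Ni ltnW.
by move/key; rewrite !ip_BB// (ipC hH hi hk); lra.
Qed.

(** The partial sums of [f] converge to some [f'] with the same coefficients; [f - f'] is orthogonal
    to the whole basis and vanishes. *)
Lemma parseval f g : fcar H f -> fcar H g ->
  (fun n => \sum_(0 <= i < n) ip f (e i) * ip g (e i)) @ \oo --> ip f g.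
Proof.
move=> hf hg.
have [||f' hf' cf'] := hilbert_complete hH (u := fun n => proj_onb 0 n f).
- by move=> n; exact: proj_onb_fcar.
- exact: proj_onb_cauchy.
suff ff' : f = f'.
  move: (cf' g hg); rewrite -ff'.
  by under eq_fun do rewrite ip_proj_onb//.
have hff' := fcarB hH hf hf'.
have : f \- f' = (fun=> 0).
  case: onb => E1 _ _; apply => // h Eh.
  have [k <-] := onb_enum_onto eE Eh.
  have hk := onb_enum_fcar k.
  rewrite ipBl//; apply/eqP; rewrite subr_eq0; apply/eqP.
  apply: (cvg_unique _ _ (cf' _ hk)) => //.
  apply: cvg_near_cst; exists k.+1 => // n /= kn.
  by rewrite ip_proj_onb_coef// kn.
move=> ff; apply/funext => y; apply/eqP; rewrite -subr_eq0; apply/eqP.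
exact: (congr1 (@^~ y) ff).
Qed.

Lemma ip_le_parseval f g (c : R) : fcar H f -> fcar H g ->
  (forall n, \sum_(0 <= i < n) ip f (e i) * ip g (e i) <= c) -> ip f g <= c.
Proof.
move=> hf hg le_c; have cv := parseval hf hg.
have cc : (fun _ : nat => c) @ \oo --> c by exact: cvg_cst.
by apply: (ler_cvg_to cv cc); exact: nearW.
Qed.

End Parseval.

End OrthonormalBasis.

(** * Reproducing kernels and covariance operators *)

Section ReproducingKernel.
Variables (R : realType) (Y : Type) (H : funspace R Y) (K : Y -> Y -> R).
Hypothesis hHK : is_rkhs H K.
Local Notation ip := (fip H).

Lemma rkhs_hilbert : is_hilbert H. Proof. by case: hHK. Qed.

Lemma rkhs_fcar x : fcar H (K x).
Proof. by case: hHK => _ /(_ x)[]. Qed.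

Lemma rkhs_repr f x : fcar H f -> ip f (K x) = f x.
Proof. by move=> hf; case: hHK => _ /(_ x)[_]; exact. Qed.

Lemma rkhs_sym x y : K x y = K y x.
Proof.
have hx := rkhs_fcar x; have hy := rkhs_fcar y.
by rewrite -(rkhs_repr y hx) -(rkhs_repr x hy) (ipC rkhs_hilbert).
Qed.

Lemma rkhs_eval_le f x (k : R) : 0 <= k -> K x x <= k ^+ 2 -> fcar H f ->
  `|f x| <= k * fnorm H f.
Proof.
move=> k0 Kk hf; rewrite -(rkhs_repr x hf) mulrC.
apply: le_trans (ip_le_fnorm rkhs_hilbert hf (rkhs_fcar x)) _.
rewrite ler_wpM2l ?fnorm_ge0// fnorm_le ?rkhs_repr//; try exact: rkhs_fcar.
exact: rkhs_hilbert.
Qed.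

Lemma rkhs_eq f g : fcar H f -> fcar H g ->
  (forall h, fcar H h -> ip f h = ip g h) -> f = g.
Proof.
move=> hf hg fg; apply/funext => x.
by rewrite -(rkhs_repr x hf) -(rkhs_repr x hg) fg//; exact: rkhs_fcar.
Qed.

End ReproducingKernel.

Section Measurable.
Variables (R : realType) (d : measure_display) (X : measurableType d).
Variables (H : funspace R X) (K : X -> X -> R).
Hypothesis hHK : is_rkhs H K.
Hypothesis mK : measurable_fun setT (fun u : X * X => K u.1 u.2).
Local Notation ip := (fip H).
Let hH := rkhs_hilbert hHK.

Lemma measurable_kernel_section x : measurable_fun setT (K x).
Proof. exact: (measurableT_comp mK (pair1_measurable x)). Qed.

(* The measurable functions in [H] form a closed subspace containing the
   kernel sections. *)
Lemma measurable_rkhs f : fcar H f -> measurable_fun setT f.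
Proof.
move=> hf; pose V := FunSpace (fcar H `&` [set g | measurable_fun setT g]) (fip H).
have hV : is_hilbert V.
  case: (hH) => -[H0 HZD] H1 H2 H3 H4; split.
  - split => [|a g h [hg mg] [hh mh]]; first by split => //; exact: measurable_cst.
    split; first exact: HZD.
    by apply: measurable_funD => //; exact: measurable_funM.
  - by move=> a g h k [hg _] [hh _] [hk _]; exact: H1.
  - by move=> g h [hg _] [hh _]; exact: H2.
  - by move=> g [hg _]; exact: H3.
  - move=> u hu cu; have [|g hg ug] := H4 u _ cu; first by move=> i; case: (hu i).
    exists g => //; split => //.
    apply: (@measurable_fun_cvg _ _ _ _ u) => [i|x _]; first by case: (hu i).
    apply/cvgrPdist_le => /= e e0.
    have e'0 : 0 < e / (1 + fnorm H (K x)).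
      by rewrite divr_gt0// ltr_wpDr// fnorm_ge0.
    move/cvgrPdist_le : ug => /(_ _ e'0) [N _ hN]; exists N => // i /hN /=.
    have [hui _] := hu i; have hx := rkhs_fcar hHK x.
    rewrite sub0r normrN ger0_norm ?fnorm_ge0// ler_pdivlMr ?ltr_wpDr ?fnorm_ge0//.
    apply: le_trans; rewrite distrC.
    have hug := fcarB hH hui hg.
    rewrite -[u i x - g x](rkhs_repr hHK x hug).
    apply: le_trans (ip_le_fnorm hH hug hx) _.
    by rewrite mulrDr mulr1 lerDr fnorm_ge0.
(* Riesz inside [V] produces the projection [v] of [f]; both have the same inner products with the
   kernel sections, hence the same values. *)
have [|a g h [hg _] [hh _]|g [hg _]|v [hv mv] vE] :=
    @riesz _ _ V hV (fun g => ip f g) (ip f f).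
- exact: ip_ge0.
- have hagh := fcarZD hH a hg hh.
  by rewrite (ipC hH hf)// ipZDl// (ipC hH hf hg) (ipC hH hf hh).
- exact: cauchy_schwarz.
suff -> : f = v by [].
apply/funext => x; have hx := rkhs_fcar hHK x.
rewrite -(rkhs_repr hHK x hf) -(rkhs_repr hHK x hv) -vE//.
by split => //; exact: measurable_kernel_section.
Qed.

End Measurable.

(** * The covariance operator and its resolvent *)

Section Covariance.
Variables (R : realType) (d : measure_display) (X : measurableType d).
Variables (nu : probability X R) (H : funspace R X) (K : X -> X -> R) (kappa : R).
Hypothesis hHK : is_rkhs H K.
Hypothesis mK : measurable_fun setT (fun u : X * X => K u.1 u.2).
Hypothesis kappa_ge0 : 0 <= kappa.
Hypothesis Kle : forall x, K x x <= kappa ^+ 2.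
Local Notation ip := (fip H).
Let hH := rkhs_hilbert hHK.

Definition l2 (f g : X -> R) : R := \int[nu]_x (f x * g x).

Lemma bounded_integrable (f : X -> R) (c : R) :
  measurable_fun setT f -> (forall x, `|f x| <= c) -> nu.-integrable setT (EFin \o f).
Proof.
move=> mf fc; apply: measurable_bounded_integrable => //.
  by rewrite [X in (X < _)%E]probability_setT ltry.
exists c; split; first exact: num_real.
by move=> M cM x _; exact: (le_trans (fc x) (ltW cM)).
Qed.

Lemma Rintegral_prob_cst (c : R) : \int[nu]_x c = c.
Proof.
rewrite Rintegral_cst// -[RHS]mulr1; congr (_ * _).
by rewrite -[RHS]/(fine 1%E); congr fine; exact: probability_setT.
Qed.

Lemma rkhs_integrable f g : fcar H f -> fcar H g ->
  nu.-integrable setT (EFin \o (fun x => f x * g x)).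
Proof.
move=> hf hg; apply: (@bounded_integrable _ (kappa * fnorm H f * (kappa * fnorm H g))).
  by apply: measurable_funM; exact: (measurable_rkhs hHK mK).
move=> x; rewrite normrM ler_pM//; exact: (rkhs_eval_le hHK).
Qed.

Lemma l2C f g : l2 f g = l2 g f.
Proof. by congr Rintegral; apply/funext => x; rewrite mulrC. Qed.

Lemma l2ZDl a f g h : fcar H f -> fcar H g -> fcar H h ->
  l2 (fun y => a * f y + g y) h = a * l2 f h + l2 g h.
Proof.
move=> hf hg hh; rewrite /l2 -RintegralZl//; last exact: rkhs_integrable.
rewrite -RintegralD//.
- by congr Rintegral; apply/funext => x; rewrite mulrDl mulrA.
- have := rkhs_integrable (fcarZ hH a hf) hh.
  by congr (_.-integrable _ _); apply/funext => x /=; rewrite mulrA.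
- exact: rkhs_integrable.
Qed.

Lemma l2_ge0 f : 0 <= l2 f f.
Proof. by apply: Rintegral_ge0 => x _; rewrite -expr2 sqr_ge0. Qed.

Lemma l2_le f : fcar H f -> l2 f f <= kappa ^+ 2 * ip f f.
Proof.
move=> hf; have c1 := Rintegral_prob_cst (kappa ^+ 2 * ip f f).
rewrite -c1; apply: le_Rintegral => //.
- exact: rkhs_integrable.
- by apply: (@bounded_integrable _ (`|kappa ^+ 2 * ip f f|)) => //; exact: measurable_cst.
move=> x _; rewrite -expr2 -(sqr_fnorm hH hf) -exprMn -[f x ^+ 2]real_normK ?num_real//.
rewrite lerXn2r ?nnegrE ?mulr_ge0 ?fnorm_ge0//; exact: (rkhs_eval_le hHK).
Qed.

Lemma l2_abs_le f g : fcar H f -> fcar H g ->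
  `|l2 f g| <= kappa * fnorm H f * (kappa * fnorm H g).
Proof.
move=> hf hg; apply: le_trans (le_normr_Rintegral _ _) _ => //.
  exact: rkhs_integrable.
set c := leRHS; have c1 := Rintegral_prob_cst c.
rewrite -c1; apply: le_Rintegral => //.
- have := integrable_norm (rkhs_integrable hf hg).
  by congr (_.-integrable _ _).
- by apply: (@bounded_integrable _ `|c|) => //; exact: measurable_cst.
by move=> x _; rewrite normrM ler_pM//; exact: (rkhs_eval_le hHK).
Qed.

Local Notation T := (covop H K nu).

(** [covop] is a choice by [xget]. Riesz, applied to the bounded functional [l2 f], shows that an
    admissible value exists, so the default is never taken. *)
Lemma covopP f : fcar H f ->
  fcar H (T f) /\ forall g, fcar H g -> ip (T f) g = l2 f g.
Proof.
move=> hf; rewrite /covop.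
have tE g : fcar H g -> \int[nu]_x ip (rank_one H (K x) f) g = l2 f g.
  move=> hg; rewrite /l2; congr Rintegral; apply/funext => x.
  by rewrite /rank_one ipZl ?rkhs_repr//; [rewrite ipC ?rkhs_repr//|]; exact: rkhs_fcar hHK x.
case: xgetP => [h _ [hh hE]|ex].
  by split => // g hg; rewrite hE// tE.
exfalso.
have [||g hg|h hh hE] := riesz hH (l := fun g => l2 f g) (L := (kappa ^+ 2 * fnorm H f) ^+ 2).
- exact: sqr_ge0.
- by move=> a g h hg hh; rewrite l2C l2ZDl// (l2C g) (l2C h).
- rewrite -(sqr_fnorm hH hg) -exprMn -[leLHS]real_normK ?num_real//.
  rewrite lerXn2r ?nnegrE ?mulr_ge0 ?sqr_ge0 ?fnorm_ge0//.
  by apply: le_trans (l2_abs_le hf hg) _; rewrite le_eqVlt; apply/orP; left; apply/eqP; ring.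
by apply: (ex h); split => // g hg; rewrite hE// tE.
Qed.

Lemma covop_fcar f : fcar H f -> fcar H (T f).
Proof. by move=> /covopP[]. Qed.

Lemma ip_covop f g : fcar H f -> fcar H g -> ip (T f) g = l2 f g.
Proof. by move=> /covopP[_]; exact. Qed.

Variables (lam : R) (lam_gt0 : 0 < lam).
Local Notation res := (resolvent H T lam).

(** The inner product is [<(T + lam) f, g>]. Its norm is equivalent to that of [H], so Riesz in this
    space inverts [T + lam] without spectral theory. *)
Let Hlam := FunSpace (fcar H) (fun f g => l2 f g + lam * ip f g).

Let hHlam : is_hilbert Hlam.
Proof.
have cmp f : fcar H f -> lam * ip f f <= fip Hlam f f <= (kappa ^+ 2 + lam) * ip f f.
  by move=> hf /=; rewrite lerDr l2_ge0 mulrDl lerD2r l2_le.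
have hge0 f : fcar H f -> 0 <= fip Hlam f f.
  by move=> hf; rewrite addr_ge0 ?l2_ge0// mulr_ge0 ?(ltW lam_gt0)// (ip_ge0 hH).
split.
- by split; [exact: (fcar0 hH) | exact: (fcarZD hH)].
- by move=> a f g h hf hg hh /=; rewrite l2ZDl// (ipZDl hH)//; ring.
- by move=> f g hf hg /=; rewrite l2C (ipC hH).
- move=> f hf; split; first exact: hge0.
  move=> f0; apply: (ip_eq0 hH hf); apply/eqP; rewrite eq_le (ip_ge0 hH)// andbT.
  by have /andP[] := cmp f hf; rewrite f0 pmulr_rle0.
move=> u hu cu; case: (hH) => _ _ _ _ /(_ u hu)[e e0|f hf uf].
  have se : 0 < Num.sqrt lam * e by rewrite mulr_gt0// sqrtr_gt0.
  have [N hN] := cu _ se; exists N => i k Ni Nk.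
  have := hN i k Ni Nk; have hik := fcarB hH (hu i) (hu k).
  have sl : 0 < Num.sqrt lam by rewrite sqrtr_gt0.
  rewrite -[fnorm H _ < e](ltr_pM2l sl); apply: le_lt_trans.
  by rewrite -sqrtrM ?(ltW lam_gt0)// ler_wsqrtr//; case/andP: (cmp _ hik).
exists f => //.
have c0 : (fun i => Num.sqrt (kappa ^+ 2 + lam) * fnorm H (u i \- f)) @ \oo --> (0 : R).
  by rewrite -[X in _ --> X](mulr0 (Num.sqrt (kappa ^+ 2 + lam))); exact: cvgMl_tmp.
apply: (squeeze_cvgr _ (cvg_cst 0) c0); apply: nearW => i.
have hif := fcarB hH (hu i) hf.
rewrite fnorm_ge0 /= /fnorm -sqrtrM ?addr_ge0 ?sqr_ge0 ?(ltW lam_gt0)//.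
by rewrite ler_wsqrtr//; case/andP: (cmp _ hif).
Qed.

Lemma covop_lam_inj f g : fcar H f -> fcar H g ->
  (fun y => T f y + lam * f y) = (fun y => T g y + lam * g y) -> f = g.
Proof.
move=> hf hg fg; apply: (rkhs_eq hHK hf hg) => h hh.
have hfg := fcarB hH hf hg.
suff /(ip_eq0 hH hfg) fg0 : ip (f \- g) (f \- g) = 0.
  by apply/eqP; rewrite -subr_eq0 -(ipBl hH)// fg0 (ip0l hH).
have E k : fcar H k -> ip (fun y => T k y + lam * k y) (f \- g) = fip Hlam k (f \- g).
  move=> hk /=; rewrite -(ip_covop hk hfg); have hTk := covop_fcar hk.
  by rewrite -(ipZl hH)// -(ipDl hH)//; exact: fcarZ.
have : fip Hlam (f \- g) (f \- g) = 0.
  by rewrite (ipBl hHlam hf hg hfg) -!E// fg subrr.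
have := l2_ge0 (f \- g); have := ip_ge0 hH hfg => /=.
move=> i0 l0 /eqP; rewrite addrC paddr_eq0 ?mulr_ge0 ?(ltW lam_gt0)//.
by rewrite mulf_eq0 gt_eqF//= => /andP[/eqP].
Qed.

Lemma resolventP h : fcar H h ->
  fcar H (res h) /\ (fun y => T (res h) y + lam * res h y) = h.
Proof.
move=> hh; rewrite /resolvent; case: xgetP => [g _ []//|ex]; exfalso.
have [||f hf|g hg gE] := riesz hHlam (l := fun g => ip h g) (L := lam^-1 * ip h h).
- by rewrite mulr_ge0 ?invr_ge0 ?(ltW lam_gt0)//; exact: ip_ge0.
- move=> a f g hf hg; have hafg := fcarZD hH a hf hg.
  by rewrite (ipC hH hh)// (ipZDl hH)// (ipC hH hf hh) (ipC hH hg hh).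
- apply: le_trans (cauchy_schwarz hH hh hf) _.
  rewrite [leRHS](_ : _ = lam^-1 * ip h h * l2 f f + ip h h * ip f f).
    by rewrite lerDr !mulr_ge0 ?l2_ge0 ?(ip_ge0 hH)// invr_ge0 ltW.
  by rewrite /=; field; rewrite gt_eqF.
apply: (ex g); split => //; have hTg := covop_fcar hg.
apply: (rkhs_eq hHK) => [|//|k hk].
  by apply: fcarD => //; exact: fcarZ.
rewrite -gE//= -ip_covop// -(ipZl hH)// -(ipDl hH)//; exact: fcarZ.
Qed.

Lemma resolvent_fcar h : fcar H h -> fcar H (res h).
Proof. by move=> /resolventP[]. Qed.

Lemma resolventE h : fcar H h -> T (res h) = h \- (lam \*o res h).
Proof.
by move=> /resolventP[_ hE]; rewrite -[X in X \- _]hE; apply/funext => y /=; ring.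
Qed.

Lemma covopZD a f g : fcar H f -> fcar H g ->
  T (fun y => a * f y + g y) = (fun y => a * T f y + T g y).
Proof.
move=> hf hg; have hfg := fcarZD hH a hf hg.
have hTf := covop_fcar hf; have hTg := covop_fcar hg.
apply: (rkhs_eq hHK) => [||h hh]; [exact: covop_fcar|exact: fcarZD|].
by rewrite ip_covop// l2ZDl// (ipZDl hH)// !ip_covop.
Qed.

Lemma resolvent_covop h : fcar H h -> res (T h) = T (res h).
Proof.
move=> hh; have hTh := covop_fcar hh; have [hr rE] := resolventP hh.
have [hrT rTE] := resolventP hTh.
apply: covop_lam_inj => //; first exact: covop_fcar.
have hE : h = (fun y => lam * res h y + T (res h) y).
  by rewrite -[LHS]rE; apply/funext => y; rewrite addrC.
rewrite rTE [in LHS]hE covopZD//; last exact: covop_fcar.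
by apply/funext => y; rewrite addrC.
Qed.

End Covariance.

Lemma le0_ger_powR (R : realType) (a b p : R) : 0 < a -> a <= b -> p <= 0 ->
  b `^ p <= a `^ p.
Proof.
move=> a0 ab p0; have b0 := lt_le_trans a0 ab.
have -> : p = - (- p) by rewrite opprK.
rewrite powRN [leRHS]powRN lef_pV2 ?posrE ?powR_gt0//.
by apply: ge0_ler_powR; rewrite ?nnegrE ?oppr_ge0// ltW.
Qed.

(** * Effective dimension and source condition *)

Section EffectiveDimension.
Variables (R : realType) (d : measure_display) (X : measurableType d).
Variables (nu : probability X R) (H : funspace R X) (K : X -> X -> R) (kappa : R).
Hypothesis hHK : is_rkhs H K.
Hypothesis mK : measurable_fun setT (fun u : X * X => K u.1 u.2).
Hypothesis kappa_ge0 : 0 <= kappa.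
Hypothesis Kle : forall x, K x x <= kappa ^+ 2.
Variables (lam : R) (lam_gt0 : 0 < lam).
Local Notation ip := (fip H).
Local Notation T := (covop H K nu).
Local Notation res := (resolvent H T lam).
Local Notation l2 := (l2 nu).
Let hH := rkhs_hilbert hHK.
Let covopfP := covop_fcar nu hHK mK kappa_ge0 Kle.
Let ipT := ip_covop nu hHK mK kappa_ge0 Kle.
Let resfP := resolvent_fcar nu hHK mK kappa_ge0 Kle lam_gt0.
Let resE := resolventE nu hHK mK kappa_ge0 Kle lam_gt0.

(** With [v = res h], a term of the trace splits into [|T v|^2] and [lam |v|_nu^2]. These are the
    two quantities that [gsol_quad_le] produces on a sample. *)
Lemma l2_resolvent h : fcar H h ->
  l2 (res h) h = ip (T (res h)) (T (res h)) + lam * l2 (res h) (res h).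
Proof.
move=> hh; have hr := resfP hh; have hT := covopfP hr.
have -> : l2 (res h) h = ip (T (res h)) h by rewrite ipT.
rewrite -(ipT hr hr) -(ipZr hH)// -(ipDr hH)//; last exact: (fcarZ hH).
by congr (ip _ _); rewrite resE//; apply/funext => y /=; ring.
Qed.

Lemma l2_resolvent_ge0 h : fcar H h -> 0 <= l2 (res h) h.
Proof.
move=> hh; rewrite l2_resolvent// addr_ge0 ?mulr_ge0 ?l2_ge0 ?(ltW lam_gt0)//.
exact: (ip_ge0 hH) (covopfP (resfP hh)).
Qed.

(** The basis is returned because the trace is taken in the one picked by [xget], and the leverage
    scores must later be expanded in that same basis. The padding of the enumeration contributes
    zero terms. *)
Lemma effdim_nneseries : is_separable H -> exists E (e : nat -> X -> R),
  [/\ orthonormal_basis H E, onb_enum E e &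
      effdim H T lam = (\sum_(0 <= i <oo) (l2 (res (e i)) (e i))%:E)%E].
Proof.
move=> sH; have [E0 onb0] := exists_orthonormal_basis hH.
set E := xget set0 (orthonormal_basis H).
have onb : orthonormal_basis H E by exact: (xgetPex set0 (ex_intro _ _ onb0)).
have [e eE] := exists_onb_enum hH sH onb.
have he := onb_enum_fcar hH onb eE.
exists E, e; split => //.
rewrite /effdim /trace -/E nneseries_esumT; last first.
  by move=> i; rewrite lee_fin l2_resolvent_ge0.
rewrite (@reindex_esum _ _ _ [set i | E (e i)] E e); last first.
  split => [i //|i k /set_mem Ei _|f Ef]; first exact: (onb_enum_inj eE).
  by have [i ei] := onb_enum_onto eE Ef; exists i => //=; rewrite ei.
rewrite esum_mkcond; apply: eq_esum => i _.
have -> : ip (res (T (e i))) (e i) = l2 (res (e i)) (e i).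
  by rewrite (resolvent_covop nu hHK mK kappa_ge0 Kle)// ipT//; exact: resfP.
case: ifPn => // /negP; have [Ei|->] := onb_enum_in eE i.
  by case; exact/mem_set.
move=> _; congr EFin; rewrite -ipT ?(ip0r hH)//; last 2 first.
- exact: resfP (fcar0 hH).
- exact: (fcar0 hH).
- exact: covopfP (resfP (fcar0 hH)).
Qed.

(** Take [k = (T + lam)^-1 T^s h]. In an eigenbasis its coefficients are those of [h] times
    [mu^s / (mu + lam)]; both bounds hold coefficient by coefficient and are summed by Bessel and
    Parseval. *)
Lemma oppow_source (s Rad : R) (h : X -> R) : is_separable H ->
  0 < s <= 2^-1 -> fcar H h -> fnorm H h <= Rad ->
  exists k, [/\ fcar H k,
    oppow H T s h = (fun x => T k x + lam * k x),
    l2 k k <= lam `^ (2 * s - 1) * Rad ^+ 2 &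
    ip k k <= lam `^ (2 * s - 2) * Rad ^+ 2].
Proof.
move=> sH /andP[s0 s2] hh hR; rewrite /oppow; case: xgetP => [g _|_]; last first.
  (* Default value: if no eigenbasis gives an admissible vector, [oppow] returns the zero function,
     which is represented by [k = 0]. *)
  have T0 : T (fun=> 0) = (fun=> 0).
    apply: (rkhs_eq hHK (covopfP (fcar0 hH)) (fcar0 hH)) => f hf.
    rewrite ipT ?(ip0l hH)//; last exact: (fcar0 hH).
    rewrite -[RHS](@Rintegral_prob_cst _ _ _ nu); congr Rintegral.
    by apply/funext => x; rewrite mul0r.
  exists (fun=> 0); rewrite T0 (ip0l hH); last exact: (fcar0 hH).
  split; [exact: (fcar0 hH)|by apply/funext => x; rewrite mulr0 addr0|
         |by rewrite mulr_ge0 ?powR_ge0 ?sqr_ge0].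
  rewrite (_ : l2 _ _ = 0); first by rewrite mulr_ge0 ?powR_ge0 ?sqr_ge0.
  rewrite -[RHS](@Rintegral_prob_cst _ _ _ nu); congr Rintegral.
  by apply/funext => x; rewrite mul0r.
move=> [hg [E [mu [onb muE gE]]]].
have [e eE] := exists_onb_enum hH sH onb.
have he := onb_enum_fcar hH onb eE.
have hk := resfP hg; set k := res g in hk *.
have kE : g = (fun x => T k x + lam * k x).
  by rewrite /k resE//; apply/funext => y /=; ring.
have coef f : E f -> (mu f + lam) * ip k f = mu f `^ s * ip h f.
  move=> Ef; have [mu0 Tf] := muE f Ef; have hf : fcar H f by case: onb => + _ _ _; exact.
  rewrite -gE// [in RHS]kE.
  rewrite (ipDl hH (covopfP hk) (fcarZ hH lam hk) hf) (ipZl hH)// ipT// l2C -ipT//.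
  by rewrite Tf (ipZl hH)// (ipC hH hk hf) mulrDl.
have coef2 f : E f -> ip k f ^+ 2 <= lam `^ (2 * s - 2) * ip h f ^+ 2 /\
    mu f * ip k f ^+ 2 <= lam `^ (2 * s - 1) * ip h f ^+ 2.
  move=> Ef; have [mu0 _] := muE f Ef.
  set A := mu f + lam; have A0 : 0 < A by rewrite ltr_wpDl.
  have lamA : lam <= A by rewrite lerDr.
  have -> : ip k f = mu f `^ s / A * ip h f.
    by rewrite mulrAC -coef// -/A mulrAC mulfV ?mul1r// gt_eqF.
  (* Here [s <= 1/2] matters: [2 s - 1] and [2 s - 2] are nonpositive, so powers of [A >= lam] are
     bounded by powers of [lam]. *)
  have pw p (p0 : p <= 0) : A `^ p <= lam `^ p by exact: le0_ger_powR.
  have musq : (mu f `^ s) ^+ 2 <= A `^ (2 * s).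
    rewrite mulrC powRrM powR_mulrn ?powR_ge0// lerXn2r ?nnegrE ?powR_ge0//.
    by apply: ge0_ler_powR; rewrite ?nnegrE ?(ltW s0) ?(ltW A0)// lerDl ltW.
  have A2 : A `^ (2 * s - 2) = A `^ (2 * s) / A ^+ 2.
    by rewrite powRB ?(gt_eqF A0) ?implybT// powR_mulrn// ltW.
  have A1 : A `^ (2 * s - 1) = A `^ (2 * s) / A.
    by rewrite powRB ?(gt_eqF A0) ?implybT// powRr1// ltW.
  rewrite exprMn; split.
    apply: ler_wpM2r; first exact: sqr_ge0.
    apply: le_trans (pw (2 * s - 2) _); last by lra.
    rewrite A2 exprMn exprVn; apply: ler_wpM2r => //.
    by rewrite invr_ge0 sqr_ge0.
  rewrite mulrA; apply: ler_wpM2r; first exact: sqr_ge0.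
  apply: le_trans (pw (2 * s - 1) _); last by lra.
  rewrite A1 (_ : mu f * _ = (mu f `^ s) ^+ 2 * (mu f / A) / A); last by field; rewrite gt_eqF.
  apply: ler_wpM2r; first by rewrite invr_ge0 ltW.
  apply: le_trans musq; rewrite ler_piMr ?sqr_ge0// ler_pdivrMr// mul1r.
  by rewrite lerDl ltW.
have bes c n : 0 <= c -> \sum_(0 <= i < n) c * ip h (e i) ^+ 2 <= c * Rad ^+ 2.
  move=> c0; rewrite -mulr_sumr ler_wpM2l//.
  apply: le_trans (bessel hH onb eE n hh) _; rewrite -(sqr_fnorm hH hh).
  by rewrite lerXn2r ?nnegrE ?fnorm_ge0// (le_trans (fnorm_ge0 _ _) hR).
exists k; split => //.
- rewrite -ipT//; apply: (ip_le_parseval hH onb eE (covopfP hk) hk) => n.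
  apply: le_trans (bes _ n (powR_ge0 _ _)); apply: ler_sum => i _.
  rewrite ipT// l2C -ipT//.
  have [Ei|->] := onb_enum_in eE i; last by rewrite !(ip0r hH)// mulr0 expr0n mulr0.
  have [_] := coef2 _ Ei; have [_ ->] := muE _ Ei.
  by rewrite (ipZl hH)// (ipC hH (he i) hk) -mulrA -expr2.
- apply: (ip_le_parseval hH onb eE hk hk) => n.
  apply: le_trans (bes _ n (powR_ge0 _ _)); apply: ler_sum => i _.
  rewrite -expr2; have [Ei|->] := onb_enum_in eE i; first by case: (coef2 _ Ei).
  by rewrite !(ip0r hH)// expr0n mulr0.
Qed.

End EffectiveDimension.

(** * Leave-one-out identities for the regularized Gram matrix *)

Section Gram.
Variables (R : realType) (Y : Type).

(** The ridge [mu] is independent of [n], so that samples of sizes [N] and [N + 1] can share the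
    ridge [N lam]. *)
Definition gram (K : Y -> Y -> R) n (x : 'I_n -> Y) (mu : R) : 'M[R]_n :=
  \matrix_(i < n, k < n) K (x i) (x k) + mu%:M.

Definition gsol (K : Y -> Y -> R) n (x : 'I_n -> Y) mu (y : 'I_n -> R) (i : 'I_n) : R :=
  (invmx (gram K x mu) *m \col_(k < n) y k) i 0.

Definition fit (K : Y -> Y -> R) n (x : 'I_n -> Y) mu (y : 'I_n -> R) (t : Y) : R :=
  \sum_(i < n) gsol K x mu y i * K (x i) t.

(* The i-th diagonal entry of the inverse of the regularized Gram matrix; its
   multiple by [mu] is one minus the i-th leverage score. *)
Definition ginv (K : Y -> Y -> R) n (x : 'I_n -> Y) mu (i : 'I_n) : R :=
  gsol K x mu (fun k => (k == i)%:R) i.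

Variables (H : funspace R Y) (K : Y -> Y -> R) (kappa : R).
Hypothesis hHK : is_rkhs H K.
Hypothesis kappa_ge0 : 0 <= kappa.
Hypothesis Kle : forall x, K x x <= kappa ^+ 2.
Variables (mu : R) (mu_gt0 : 0 < mu).
Local Notation ip := (fip H).
Let hH := rkhs_hilbert hHK.
Let hK := rkhs_fcar hHK.
Let Ksym := rkhs_sym hHK.

Section Sample.
Variables (n : nat) (x : 'I_n -> Y).
Local Notation gsol := (gsol K x mu).
Local Notation fit := (fit K x mu).
Local Notation ginv := (ginv K x mu).

Let comb (a : 'I_n -> R) : Y -> R := fun t => \sum_(i < n) a i * K (x i) t.

Let comb_fcar a : fcar H (comb a).
Proof.
by apply: (fcar_sum hH) => i _; exact: (fcarZ hH (a i) (hK (x i))).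
Qed.

Let ip_comb a f : fcar H f -> ip f (comb a) = \sum_(i < n) a i * f (x i).
Proof.
move=> hf; rewrite (ip_sumr hH)//; last first.
  by move=> i _; exact: (fcarZ hH (a i) (hK (x i))).
apply: eq_bigr => i _; rewrite -(rkhs_repr hHK (x i) hf) -(ipZr hH)//.
Qed.

(** For a row vector [v] in the kernel, [v G v^T = 0] is also the squared norm of
    [sum_i v_i K_(x_i)] plus [mu |v|^2]. *)
Lemma gram_unit : gram K x mu \in unitmx.
Proof.
rewrite -row_free_unit -kermx_eq0; apply/rowV0P => v /sub_kermxP vA0.
have E : (v *m gram K x mu *m v^T) 0 0 =
    ip (comb (v 0)) (comb (v 0)) + mu * \sum_i v 0 i ^+ 2.
  rewrite mulmxDr mulmxDl mxE; congr (_ + _).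
    rewrite ip_comb// mxE; apply: eq_bigr => i _; rewrite !mxE mulrC; congr (_ * _).
    by apply: eq_bigr => k _; rewrite mxE.
  rewrite mul_mx_scalar -scalemxAl mxE; congr (_ * _).
  by rewrite mxE; apply: eq_bigr => i _; rewrite mxE expr2.
move: E; rewrite vA0 mul0mx mxE => /esym/eqP.
have S0 : 0 <= \sum_i v 0 i ^+ 2 by apply: sumr_ge0 => i _; exact: sqr_ge0.
rewrite paddr_eq0 ?(ip_ge0 hH) ?mulr_ge0 ?(ltW mu_gt0)//.
rewrite mulf_eq0 (gt_eqF mu_gt0) => /andP[_].
rewrite orFb.
rewrite psumr_eq0 => [/allP v0|i _]; last exact: sqr_ge0.
apply/rowP => i; rewrite mxE; apply/eqP; rewrite -sqrf_eq0.
by apply: v0; rewrite mem_index_enum.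
Qed.

Lemma gsolE y i : \sum_(k < n) gsol y k * K (x k) (x i) + mu * gsol y i = y i.
Proof.
have /(congr1 (fun A : 'cV_n => A i 0)) := mulKVmx gram_unit (\col_k y k).
rewrite mxE; under eq_bigr do rewrite mxE mulrDl.
rewrite big_split/= => E; rewrite [RHS](_ : _ = (\col_k y k) i 0); last by rewrite mxE.
rewrite -E; congr (_ + _).
  by apply: eq_bigr => k _; rewrite mxE Ksym mulrC.
rewrite (bigD1 i)//= big1 ?addr0; first by rewrite [mu%:M i i]mxE eqxx.
by move=> k ki; rewrite [mu%:M i k]mxE eq_sym (negbTE ki) mul0r.
Qed.

Lemma fitE y i : fit y (x i) = y i - mu * gsol y i.
Proof. by rewrite -[in RHS](gsolE y i) addrK. Qed.

Lemma gsol_uniq y (a : 'I_n -> R) :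
  (forall i, \sum_(k < n) a k * K (x k) (x i) + mu * a i = y i) -> a =1 gsol y.
Proof.
move=> aE i; have E : gram K x mu *m (\col_k a k) = \col_k y k.
  apply/colP => k; rewrite !mxE -aE; under eq_bigr do rewrite !mxE mulrDl.
  rewrite big_split/=; congr (_ + _).
    by apply: eq_bigr => l _; rewrite Ksym mulrC.
  rewrite (bigD1 k)//= big1 ?addr0 ?eqxx//.
  by move=> l lk; rewrite eq_sym (negbTE lk) mul0r.
by rewrite /gsol -E mulKmx ?gram_unit// mxE.
Qed.

Lemma gsolZD c y z i : gsol (fun k => c * y k + z k) i = c * gsol y i + gsol z i.
Proof.
apply/esym; move: i; apply: gsol_uniq => i; rewrite -(gsolE y) -(gsolE z).
under eq_bigr do rewrite mulrDl -mulrA.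
by rewrite big_split/= -mulr_sumr; ring.
Qed.

Lemma fitD y z t : fit (fun k => y k + z k) t = fit y t + fit z t.
Proof.
rewrite -big_split/=; apply: eq_bigr => i _; rewrite -mulrDl; congr (_ * _).
rewrite -[gsol y i]mul1r -gsolZD; congr gsol; apply/funext => k.
by rewrite mul1r.
Qed.

Lemma gsol_sum y i : gsol y i = \sum_(k < n) y k * gsol (fun l => (l == k)%:R) i.
Proof.
rewrite /gsol mxE; apply: eq_bigr => k _.
rewrite !mxE mulrC; congr (_ * _).
rewrite (bigD1 k)//= big1 ?addr0 ?mxE ?eqxx ?mulr1//.
by move=> l lk; rewrite mxE (negbTE lk) mulr0.
Qed.

Lemma fit_fcar y : fcar H (fit y). Proof. exact: comb_fcar. Qed.

Lemma ip_fit y f : fcar H f -> ip f (fit y) = \sum_(i < n) gsol y i * f (x i).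
Proof. exact: ip_comb. Qed.

Lemma ip_fit_fit y :
  ip (fit y) (fit y) = \sum_(i < n) gsol y i * (y i - mu * gsol y i).
Proof.
rewrite ip_fit; last exact: fit_fcar.
by apply: eq_bigr => i _; rewrite fitE.
Qed.

Lemma ip_fit_energy y : ip (fit y) (fit y) + mu * \sum_(i < n) gsol y i ^+ 2 =
  \sum_(i < n) gsol y i * y i.
Proof.
rewrite ip_fit_fit mulr_sumr -big_split/=; apply: eq_bigr => i _; ring.
Qed.

(** A crude deterministic bound; it serves the integrability of the cross term in the noise
    estimate. *)
Lemma ip_fit_le y : ip (fit y) (fit y) <= mu^-1 * \sum_(i < n) y i ^+ 2.
Proof.
rewrite ip_fit_fit mulr_sumr; apply: ler_sum => i _.
rewrite -subr_ge0 (_ : _ - _ = mu^-1 * ((mu * gsol y i - y i / 2) ^+ 2 + 3 / 4 * y i ^+ 2)).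
  apply: mulr_ge0; first by rewrite invr_ge0 ltW.
  by apply: addr_ge0; rewrite ?sqr_ge0//; apply: mulr_ge0; rewrite ?sqr_ge0//; lra.
by field; rewrite gt_eqF.
Qed.

(** Fit the [i]-th unit vector and let [c = C_ii], [F] the squared norm of the fit. The energy
    identity gives [F <= c (1 - mu c)], hence the upper bound. The value of the fit at [x i] is
    [1 - mu c], so [(1 - mu c)^2 <= kappa^2 F]; dividing by [1 - mu c] gives the lower bound. *)
Lemma ginv_bounds i : (mu + kappa ^+ 2)^-1 <= ginv i <= mu^-1.
Proof.
set y : 'I_n -> R := fun k => (k == i)%:R.
have cE : \sum_k gsol y k * y k = ginv i.
  rewrite (bigD1 i)//= big1 ?addr0 /y ?eqxx ?mulr1// => k /negbTE ->.
  by rewrite mulr0.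
have en := ip_fit_energy y; rewrite cE in en.
have S1 : ginv i ^+ 2 <= \sum_k gsol y k ^+ 2.
  rewrite (bigD1 i)//= lerDl; apply: sumr_ge0 => k _; exact: sqr_ge0.
have F0 := ip_ge0 hH (fit_fcar y).
have hE : fit y (x i) = 1 - mu * ginv i by rewrite fitE /y eqxx.
have S2 := rkhs_eval_le hHK kappa_ge0 (Kle (x i)) (fit_fcar y).
have S3 : (1 - mu * ginv i) ^+ 2 <= kappa ^+ 2 * ip (fit y) (fit y).
  rewrite -hE -(sqr_fnorm hH (fit_fcar y)) -exprMn -[leLHS]real_normK ?num_real//.
  by rewrite lerXn2r// nnegrE mulr_ge0// fnorm_ge0.
move: en S1 F0 S3.
move: (ip _ _) (\sum_k gsol y k ^+ 2) (ginv i) => F S c en S1 F0 S3.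
have c0 : 0 <= c.
  by rewrite -en addr_ge0// mulr_ge0 ?(ltW mu_gt0)// (le_trans _ S1)// sqr_ge0.
have muc2 : mu * c ^+ 2 <= c.
  have : mu * c ^+ 2 <= mu * S by rewrite ler_pM2l.
  by move: (mu * S) (mu * c ^+ 2) en => u v; lra.
have muc : mu * c <= 1.
  have [c00|cn0] := eqVneq c 0; first by rewrite c00 mulr0.
  have cgt0 : 0 < c by rewrite lt_neqAle eq_sym cn0.
  by rewrite -(ler_pM2r cgt0) mul1r -mulrA -expr2.
have k2 : 0 <= kappa ^+ 2 by exact: sqr_ge0.
apply/andP; split; last by rewrite -[leRHS]mul1r ler_pdivlMr// mulrC.
rewrite -[leLHS]mul1r ler_pdivrMr; last by rewrite ltr_pwDl.
have FS : F <= c * (1 - mu * c).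
  have -> : F = c - mu * S by rewrite -en addrK.
  rewrite mulrBr mulr1 lerD2l lerN2 (_ : c * (mu * c) = mu * c ^+ 2); last by ring.
  by rewrite ler_pM2l.
have S4 : (1 - mu * c) ^+ 2 <= kappa ^+ 2 * c * (1 - mu * c).
  by apply: le_trans S3 _; rewrite -mulrA ler_wpM2l.
have [h0|hn0] := eqVneq (1 - mu * c) 0.
  have -> : 1 = mu * c by apply/eqP; rewrite -subr_eq0 h0.
  by rewrite mulrDr mulrC lerDl mulr_ge0.
have hgt0 : 0 < 1 - mu * c by rewrite lt_neqAle eq_sym hn0 subr_ge0.
move: S4; rewrite expr2 ler_pM2r// lerBlDr => /le_trans; apply.
by rewrite le_eqVlt; apply/orP; left; apply/eqP; ring.
Qed.

Lemma ginv_gt0 i : 0 < ginv i.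
Proof.
case/andP: (ginv_bounds i) => + _; apply: lt_le_trans.
by rewrite invr_gt0 ltr_pwDl// sqr_ge0.
Qed.

Section Representer.
Variables (w : Y -> R) (hw : fcar H w).
Local Notation a := (gsol (fun i => w (x i))).

(* (S + mu)^-1 w for S = sum_i K_(x i) (x) K_(x i) *)
Definition rsol : Y -> R := mu^-1 \*o (w \- fit (fun i => w (x i))).

Lemma rsol_fcar : fcar H rsol.
Proof. by apply: (fcarZ hH); apply: (fcarB hH) => //; exact: fit_fcar. Qed.

Lemma rsol_sample i : rsol (x i) = a i.
Proof. by rewrite /rsol /= fitE opprB addrC addrNK mulrA mulVf ?mul1r// gt_eqF. Qed.

Lemma rsol_spec f : fcar H f -> ip w f = mu * ip rsol f + \sum_(i < n) a i * f (x i).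
Proof.
move=> hf; have hF := fit_fcar (fun i => w (x i)).
rewrite (ipZl hH)//; last exact: (fcarB hH).
rewrite mulrA mulfV ?mul1r ?gt_eqF// (ipBl hH)// [in ip (fit _) f](ipC hH)//.
by rewrite ip_fit// subrK.
Qed.

Lemma rsol_energy : \sum_(i < n) a i ^+ 2 + mu * ip rsol rsol = ip w rsol.
Proof.
rewrite rsol_spec; last exact: rsol_fcar.
rewrite addrC; congr (_ + _).
by apply: eq_bigr => i _; rewrite rsol_sample expr2.
Qed.

Lemma rsol_energy_le : ip w rsol <= mu^-1 * ip w w.
Proof.
have hF := fit_fcar (fun i => w (x i)).
rewrite (ipZr hH)//; last exact: (fcarB hH).
rewrite ler_pM2l ?invr_gt0// (ipBr hH)// gerBl ip_fit// -ip_fit_energy.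
by rewrite addr_ge0 ?(ip_ge0 hH)// mulr_ge0 ?(ltW mu_gt0)// sumr_ge0// => i _; exact: sqr_ge0.
Qed.

Lemma ip_rsol : ip w rsol = mu^-1 * (ip w w - \sum_(i < n) a i * w (x i)).
Proof.
have hF := fit_fcar (fun i => w (x i)).
rewrite (ipZr hH)//; last exact: (fcarB hH).
by rewrite (ipBr hH)// ip_fit.
Qed.

(** With [y] the sample values of [w], the form [y^T C y] is the minimum over [q] of the ridge
    objective [|q|^2 + mu^-1 sum_i (y_i - q (x_i))^2]; any competitor [q] bounds it, and here the
    remainder is [t v]. *)
Lemma gsol_quad_le (q v : Y -> R) (t : R) : 0 < t -> fcar H q -> fcar H v ->
  (forall y, w y = q y + t * v y) ->
  \sum_(i < n) a i * w (x i) <= ip q q + t ^+ 2 / mu * \sum_(i < n) v (x i) ^+ 2.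
Proof.
move=> t0 hq hv wE; set y : 'I_n -> R := fun i => w (x i).
have hF := fit_fcar y; have en := ip_fit_energy y.
set S := \sum_(i < n) a i * w (x i).
have {}en : ip (fit y) (fit y) + mu * \sum_i gsol y i ^+ 2 = S by [].
have S1 : S = ip q (fit y) + \sum_(i < n) (t * v (x i)) * a i.
  by rewrite ip_fit// -big_split/=; apply: eq_bigr => i _; rewrite wE; ring.
have S2 : ip q (fit y) *+ 2 <= ip q q + ip (fit y) (fit y).
  by have := ip_ge0 hH (fcarB hH hq hF); rewrite (ip_BB hH)//; lra.
have S3 : (\sum_(i < n) (t * v (x i)) * a i) *+ 2 <=
    t ^+ 2 / mu * (\sum_(i < n) v (x i) ^+ 2) + mu * \sum_(i < n) a i ^+ 2.
  rewrite -sumrMnl !mulr_sumr -big_split/=; apply: ler_sum => i _.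
  rewrite -subr_ge0 (_ : _ - _ = mu * (t / mu * v (x i) - a i) ^+ 2).
    by rewrite mulr_ge0 ?sqr_ge0// ltW.
  by field; rewrite gt_eqF.
move: S2 S3 S1 en; rewrite -/y; lra.
Qed.

End Representer.

(** This is [mu |fit|^2 >= 0] rewritten. [h i] is the leverage score, [dl i] the prediction at [x i]
    from the other points, and [mu a_i = (1 - h_i) (y_i - dl_i)] for the coefficients [a_i]. The
    form matters because [dl i] does not involve [y i], so that the cross term has mean zero for
    centered noise. *)
Lemma loo_noise_ineq (y h dl : 'I_n -> R) :
  (forall i, h i = 1 - mu * ginv i) ->
  (forall i, dl i = y i - gsol y i / ginv i) ->
  \sum_(i < n) (1 - h i) ^+ 2 * dl i ^+ 2 <=
  \sum_(i < n) ((1 - h i) * h i * y i ^+ 2 + (1 - h i) * (1 - h i *+ 2) * (y i * dl i)).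
Proof.
move=> hE dlE; rewrite -subr_ge0 -sumrB.
have /(mulr_ge0 (ltW mu_gt0)) := ip_ge0 hH (fit_fcar y).
rewrite ip_fit_fit mulr_sumr => /le_trans; apply.
apply: ler_sum => i _.
have c0 : ginv i != 0 by rewrite gt_eqF// ginv_gt0.
by rewrite le_eqVlt; apply/orP; left; apply/eqP; rewrite hE dlE; field.
Qed.

(* The traces of a finite rank operator computed on the sample and on the
   basis agree. *)
Lemma leverage_sum_le E (e : nat -> Y -> R) (c : nat -> R) :
  orthonormal_basis H E -> onb_enum E e ->
  (forall j, \sum_(i < n) gsol (fun i => e j (x i)) i * e j (x i) <= c j) ->
  (forall j, 0 <= c j) ->
  ((\sum_(i < n) (1 - mu * ginv i))%:E <= \sum_(0 <= j <oo) (c j)%:E)%E.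
Proof.
move=> onb eE ec c0; have he := onb_enum_fcar hH onb eE.
pose G i k := gsol (fun l => (l == i)%:R) k.
have -> : \sum_(i < n) (1 - mu * ginv i) = \sum_(i < n) \sum_(k < n) G i k * K (x k) (x i).
  apply: eq_bigr => i _; have := gsolE (fun l => (l == i)%:R) i.
  by rewrite eqxx /= => sE; rewrite -[1 in LHS]sE addrK.
pose P J := \sum_(0 <= j < J) \sum_(i < n) gsol (fun i => e j (x i)) i * e j (x i).
(* Parseval for two kernel sections: [K (x k) (x i)] is the sum over [j] of
   [e j (x k) * e j (x i)]. *)
have cP : P @ \oo --> \sum_(i < n) \sum_(k < n) G i k * K (x k) (x i).
  rewrite (_ : P = fun J => \sum_(i < n) \sum_(k < n)
      G i k * \sum_(0 <= j < J) e j (x k) * e j (x i)).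
    apply: cvg_big => [|i _]; first exact: add_continuous.
    apply: cvg_big => [|k _]; first exact: add_continuous.
    apply: cvgMl_tmp.
    have := parseval hH onb eE (hK (x k)) (hK (x i)).
    rewrite (rkhs_repr hHK _ (hK _)); apply: cvg_trans; apply: near_eq_cvg.
    apply: nearW => J; apply: eq_bigr => j _.
    by rewrite !(ipC hH (hK _) (he j)) !(rkhs_repr hHK _ (he j)).
  apply/funext => J; rewrite /P.
  under [RHS]eq_bigr do under eq_bigr do rewrite mulr_sumr.
  under [RHS]eq_bigr do rewrite exchange_big/=.
  rewrite [RHS]exchange_big/=; apply: eq_bigr => j _.
  rewrite [RHS]exchange_big/=; apply: eq_bigr => k _.
  rewrite gsol_sum mulr_suml; apply: eq_bigr => i _; rewrite /G; ring.
have Pc J : ((P J)%:E <= \sum_(0 <= j <oo) (c j)%:E)%E.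
  apply: le_trans (nneseries_lim_ge J _) => [|j _ _]; last by rewrite lee_fin.
  by rewrite sumEFin lee_fin; apply: ler_sum => j _.
move: Pc; case: (\sum_(0 <= j <oo) _)%E => [r Pr|_|/(_ 0%N)//]; last by rewrite leey.
rewrite lee_fin; have cr : (fun _ : nat => r) @ \oo --> r by exact: cvg_cst.
by apply: (ler_cvg_to cP cr); apply: nearW => J; rewrite -lee_fin.
Qed.

End Sample.

Lemma gsol_perm n (x : 'I_n -> Y) y (s : 'S_n) i :
  gsol K (fun k => x (s k)) mu (fun k => y (s k)) i = gsol K x mu y (s i).
Proof.
apply/esym; move: i.
apply: (@gsol_uniq _ (fun k => x (s k)) (fun k => y (s k)) (fun i => gsol K x mu y (s i))) => i.
by rewrite -(gsolE x y (s i)) [in RHS](reindex_inj (@perm_inj _ s)).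
Qed.

Lemma ginv_perm n (x : 'I_n -> Y) (s : 'S_n) i :
  ginv K (fun k => x (s k)) mu i = ginv K x mu (s i).
Proof.
rewrite /ginv -gsol_perm; congr gsol; apply/funext => k.
by rewrite (inj_eq (@perm_inj _ s)).
Qed.

Section LeaveOneOut.
Variables (n : nat) (x : 'I_n.+1 -> Y).
Let x' : 'I_n -> Y := fun i => x (widen_ord (leqnSn n) i).

(** Replace the last label by the prediction from the other points. The smaller solution, padded
    with 0, then solves the larger system, so its last coefficient vanishes; by linearity this reads
    [0 = (C y)_max - rho C_(max, max)]. *)
Lemma loo_residual (y : 'I_n.+1 -> R) :
  y ord_max - fit K x' mu (fun i => y (widen_ord (leqnSn n) i)) (x ord_max) =
  gsol K x mu y ord_max / ginv K x mu ord_max.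
Proof.
set y' : 'I_n -> R := fun i => y _; set rho := LHS.
pose b (i : 'I_n.+1) : R := if unlift ord_max i is Some k then gsol K x' mu y' k else 0.
have bw i : b (widen_ord (leqnSn n) i) = gsol K x' mu y' i.
  have -> : widen_ord (leqnSn n) i = lift ord_max i.
    by apply/val_inj; rewrite [RHS]lift_max.
  by rewrite /b liftK.
have bm : b ord_max = 0 by rewrite /b unlift_none.
have := @gsol_uniq _ x (fun k => - rho * (k == ord_max)%:R + y k) b.
move=> /(_ _ ord_max); rewrite bm gsolZD => E.
apply/eqP; rewrite eq_sym -subr_eq0; apply/eqP.
have c0 : ginv K x mu ord_max != 0 by rewrite gt_eqF// ginv_gt0.
rewrite -[X in _ - X](mulfK c0) -mulrBl [X in X / _](_ : _ = 0) ?mul0r//.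
rewrite addrC -mulNr -E// => i.
rewrite big_ord_recr/= bm mul0r addr0; under eq_bigr do rewrite bw.
have [k ->|->] := unliftP ord_max i; last first.
  by rewrite bm mulr0 addr0 eqxx mulr1 opprB addrAC addrK /fit.
have <- : widen_ord (leqnSn n) k = lift ord_max k.
  by apply/val_inj; rewrite [RHS]lift_max.
have wm : (widen_ord (leqnSn n) k == ord_max) = false.
  by apply/negbTE; rewrite -val_eqE /= ltn_eqF.
by rewrite bw wm mulr0 add0r -/(y' k) -(gsolE x' y' k).
Qed.

(** An additional point increases the operator that is inverted. Pairing each solution with the
    equation of the other leaves the difference [a^2 / (mu C_(max, max))], where [a] is the
    coefficient at the new point, by [loo_residual]. *)
Lemma rsol_decr w : fcar H w -> ip w (rsol x w) <= ip w (rsol x' w).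
Proof.
move=> hw; have hg := rsol_fcar x hw; have hg' := rsol_fcar x' hw.
rewrite (rsol_spec x' hw hg) (rsol_spec x hw hg') (ipC hH hg')//.
rewrite lerD2l big_ord_recr/=.
rewrite (_ : \sum_(i < n) _ = \sum_(i < n)
    gsol K x mu (fun i => w (x i)) (widen_ord (leqnSn n) i) *
    rsol x' w (x (widen_ord (leqnSn n) i))); last first.
  by apply: eq_bigr => i _; rewrite -(rsol_sample x w) -(rsol_sample x' w) mulrC.
rewrite lerDl /(rsol x') /=.
have -> : w (x ord_max) - fit K x' mu (fun i => w (x' i)) (x ord_max) = _ :=
  loo_residual (fun i => w (x i)).
rewrite mulrCA; apply: mulr_ge0; first by rewrite invr_ge0 ltW.
by rewrite mulrA -expr2; apply: mulr_ge0; rewrite ?sqr_ge0// invr_ge0 ltW// ginv_gt0.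
Qed.

End LeaveOneOut.
End Gram.

(** * Measurability and exchangeability of samples *)

Section MeasurableFit.
Variables (R : realType) (d : measure_display) (T : measurableType d).

(** Inversion is written as [f * (f^2)^(-1)] with a measurable real power; where [f] vanishes both
    sides are 0 by convention. *)
Lemma measurable_funV (f : T -> R) : measurable_fun setT f ->
  measurable_fun setT (fun x => (f x)^-1).
Proof.
move=> mf; rewrite (_ : (fun x => _) = (fun x => f x * ((f x ^+ 2) `^ (-1)))).
  apply: measurable_funM => //.
  apply: (measurableT_comp (measurable_powR (R := R) (-1))).
  exact: measurable_funX.
apply/funext => x; rewrite powR_inv1 ?sqr_ge0//.
have [->|fx0] := eqVneq (f x) 0; first by rewrite invr0 mul0r.
by field.
Qed.

Lemma measurable_det n (A : T -> 'M[R]_n) :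
  (forall i k, measurable_fun setT (fun w => A w i k)) ->
  measurable_fun setT (fun w => \det (A w)).
Proof.
move=> mA; rewrite /determinant; apply: measurable_sum => s.
apply: measurable_funM; first exact: measurable_cst.
by apply: measurable_prod => i _.
Qed.

(** Cramer's rule: the entries are quotients of polynomials in the entries of [A]. *)
Lemma measurable_invmx n (A : T -> 'M[R]_n) i k :
  (forall w, A w \in unitmx) ->
  (forall i k, measurable_fun setT (fun w => A w i k)) ->
  measurable_fun setT (fun w => invmx (A w) i k).
Proof.
move=> uA mA; rewrite (_ : (fun w => _) = (fun w => (\det (A w))^-1 * \adj (A w) i k)).
  apply: measurable_funM; first exact: measurable_funV (measurable_det mA).
  rewrite (_ : (fun w => _) = (fun w => cofactor (A w) k i)).
    rewrite /cofactor; apply: measurable_funM; first exact: measurable_cst.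
    apply: measurable_det => a b.
    rewrite (_ : (fun w => _) = (fun w => A w (lift k a) (lift i b)))//.
    by apply/funext => w; rewrite !mxE.
  by apply/funext => w; rewrite mxE.
by apply/funext => w; rewrite /invmx uA mxE.
Qed.

Variables (d' : measure_display) (X : measurableType d') (K : X -> X -> R).
Hypothesis mK : measurable_fun setT (fun u : X * X => K u.1 u.2).

Lemma measurable_kernel2 (f g : T -> X) :
  measurable_fun setT f -> measurable_fun setT g ->
  measurable_fun setT (fun w => K (f w) (g w)).
Proof.
move=> mf mg; have m2 : measurable_fun setT (fun w => (f w, g w)).
  exact: measurable_fun_pair.
exact: (measurableT_comp mK m2).
Qed.

Variables (H : funspace R X) (hHK : is_rkhs H K) (mu : R) (mu_gt0 : 0 < mu).
Variables (n : nat) (x : 'I_n -> T -> X) (y : 'I_n -> T -> R).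
Hypothesis mx : forall i, measurable_fun setT (x i).
Hypothesis my : forall i, measurable_fun setT (y i).

Lemma measurable_gsol i :
  measurable_fun setT (fun w => gsol K (fun k => x k w) mu (fun k => y k w) i).
Proof.
rewrite (_ : (fun w => _) = (fun w => \sum_(k < n) invmx (gram K (x ^~ w) mu) i k * y k w)).
  apply: measurable_sum => k; apply: measurable_funM => //.
  apply: measurable_invmx => [w|a b]; first exact: (gram_unit hHK).
  rewrite (_ : (fun w => _) = (fun w => K (x a w) (x b w) + mu *+ (a == b))).
    apply: measurable_funD; last exact: measurable_cst.
    exact: measurable_kernel2.
  by apply/funext => w; rewrite !mxE.
by apply/funext => w; rewrite /gsol mxE; apply: eq_bigr => k _; rewrite mxE.
Qed.

Lemma measurable_fit (t : T -> X) : measurable_fun setT t ->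
  measurable_fun setT (fun w => fit K (fun k => x k w) mu (fun k => y k w) (t w)).
Proof.
move=> mt; apply: measurable_sum => k; apply: measurable_funM.
  exact: measurable_gsol.
exact: measurable_kernel2.
Qed.

End MeasurableFit.

(** * Independent samples, the ghost observation and exchangeability *)

Section IID.
Variables (R : realType) (d : measure_display) (T : measurableType d).
Variables (Q : {measure set T -> \bar R}).

(** Law and independence in a single condition on full rectangles, which already determines the
    joint law. *)
Definition iid d' (Omega : measurableType d') (P : {measure set Omega -> \bar R})
    n (W : 'I_n -> Omega -> T) : Prop :=
  (forall i, measurable_fun setT (W i)) /\
  forall B : 'I_n -> set T, (forall i, measurable (B i)) ->
    P (\bigcap_i (W i @^-1` B i)) = (\prod_(i < n) Q (B i))%E.

Lemma iid_perm d' (Omega : measurableType d') (P : {measure set Omega -> \bar R})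
    n (W : 'I_n -> Omega -> T) (s : 'S_n) :
  iid P W -> iid P (fun i => W (s i)).
Proof.
move=> [mW WQ]; split => // B mB.
rewrite (_ : \bigcap_i _ = \bigcap_i (W i @^-1` B ((s^-1)%g i))).
  rewrite WQ// (reindex_inj (@perm_inj _ s))/=.
  by apply: eq_bigr => i _; rewrite permK.
apply/seteqP; split => w hw i _ /=.
  by have /= := hw ((s^-1)%g i) I; rewrite permKV.
by have /= := hw (s i) I; rewrite permK.
Qed.

(** Rectangles form a pi-system generating the sigma-algebra of tuples, so the two joint laws
    coincide. The sample spaces may differ. *)
Lemma iid_law_unique d1 (O1 : measurableType d1) (P1 : probability O1 R)
    d2 (O2 : measurableType d2) (P2 : probability O2 R)
    n (W1 : 'I_n -> O1 -> T) (W2 : 'I_n -> O2 -> T) (F : n.-tuple T -> \bar R) :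
  iid P1 W1 -> iid P2 W2 -> measurable_fun setT F -> (forall t, (0 <= F t)%E) ->
  (\int[P1]_w F [tuple W1 i w | i < n] = \int[P2]_w F [tuple W2 i w | i < n])%E.
Proof.
move=> [mW1 h1] [mW2 h2] mF F0.
have mt d' (O : measurableType d') (W : 'I_n -> O -> T) :
    (forall i, measurable_fun setT (W i)) ->
    measurable_fun setT (fun w => [tuple W i w | i < n]).
  move=> mW; apply/measurable_fun_tnthP => i.
  rewrite (_ : _ \o _ = W i)//.
  by apply/funext => w /=; rewrite tnth_mktuple.
pose G := [set A : set (n.-tuple T) | exists2 B : 'I_n -> set T,
  (forall i, measurable (B i)) & A = [set t | forall i, B i (tnth t i)]].
have mG : measurable = <<s G >>.
  apply/seteqP; split.
    apply: smallest_sub; first exact: smallest_sigma_algebra.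
    move=> A; rewrite -bigcup_seq => -[i /= _ [B mB <-]].
    apply: sub_sigma_algebra.
    exists (fun k => if k == i then B else setT); first by move=> k; case: ifP.
    apply/seteqP; split => t /=; first by move=> [_ Bt] k; case: eqP => // ->.
    by move=> /(_ i); rewrite eqxx.
  apply: smallest_sub; first exact: sigma_algebra_measurable.
  move=> _ [B mB ->].
  rewrite (_ : [set t | _] = \bigcap_(i in [set` 'I_n]) ((@tnth n T)^~ i @^-1` B i)).
    apply: fin_bigcap_measurable => // i _.
    by rewrite -[X in measurable X]setTI; exact: measurable_tnth.
  by apply/seteqP; split => t /= tB i; [move=> _|]; exact: tB.
have -> : (\int[P1]_w F [tuple W1 i w | i < n] =
    \int[pushforward P1 (fun w => [tuple W1 i w | i < n])]_t F t)%E.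
  by rewrite ge0_integral_pushforward//; exact: mt.
have -> : (\int[P2]_w F [tuple W2 i w | i < n] =
    \int[pushforward P2 (fun w => [tuple W2 i w | i < n])]_t F t)%E.
  by rewrite ge0_integral_pushforward//; exact: mt.
apply: eq_measure_integral; [exact: mt | exact: mt | move=> m2 m1 A mA _].
apply: (measure_unique G (fun=> setT)) => //.
- move=> _ _ [B mB ->] [B' mB' ->]; exists (fun i => B i `&` B' i).
    by move=> i; exact: measurableI.
  by apply/seteqP; split => t /= => [[h h'] i|h]; split => // i; case: (h i).
- by move=> _; exists (fun=> setT) => //; apply/seteqP; split.
- by rewrite bigcup_const//; exists 0%N.
- move=> _ [B mB ->]; set D := [set t | _].
  change (P1 ((fun w => [tuple W1 i w | i < n]) @^-1` D) =
    P2 ((fun w => [tuple W2 i w | i < n]) @^-1` D)).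
  rewrite (_ : _ @^-1` _ = \bigcap_i (W1 i @^-1` B i)); last first.
    apply/seteqP; split => w /= h i; first by move=> _; have := h i; rewrite tnth_mktuple.
    by rewrite tnth_mktuple; exact: h.
  rewrite (_ : _ @^-1` _ = \bigcap_i (W2 i @^-1` B i)); last first.
    apply/seteqP; split => w /= h i; first by move=> _; have := h i; rewrite tnth_mktuple.
    by rewrite tnth_mktuple; exact: h.
  by rewrite h1// h2.
- by move=> _; change (P1 setT < +oo)%E; rewrite probability_setT ltry.
Qed.

End IID.

Section Snoc.
Variables (R : realType) (d : measure_display) (T : measurableType d).
Variables (d' : measure_display) (Omega : measurableType d').

(** The ghost observation is the second coordinate of the product space and receives the last
    index. *)
Definition snoc n (Z : 'I_n -> Omega -> T) (i : 'I_n.+1) (u : Omega * T) : T :=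
  if unlift ord_max i is Some k then Z k u.1 else u.2.

Lemma widen_ord_lift n (i : 'I_n) : widen_ord (leqnSn n) i = lift ord_max i.
Proof. by apply/val_inj; rewrite [RHS]lift_max. Qed.

Lemma snoc_widen n (Z : 'I_n -> Omega -> T) i u :
  snoc Z (widen_ord (leqnSn n) i) u = Z i u.1.
Proof. by rewrite widen_ord_lift /snoc liftK. Qed.

Lemma snoc_max n (Z : 'I_n -> Omega -> T) u : snoc Z ord_max u = u.2.
Proof. by rewrite /snoc unlift_none. Qed.

Lemma iid_snoc (P : probability Omega R) (Q : probability T R) n
    (Z : 'I_n -> Omega -> T) :
  iid Q P Z -> iid Q (P \x Q)%E (snoc Z).
Proof.
move=> [mZ ZQ]; split.
  move=> i; rewrite /snoc; case: unliftP => [k _|_].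
    exact: (measurableT_comp (mZ k) measurable_fst).
  exact: measurable_snd.
move=> B mB.
rewrite (_ : \bigcap_i _ =
    (\bigcap_i (Z i @^-1` B (widen_ord (leqnSn n) i))) `*` B ord_max).
  have mA : measurable (\bigcap_i (Z i @^-1` B (widen_ord (leqnSn n) i))).
    apply: fin_bigcap_measurable => // i _.
    by rewrite -[X in measurable X]setTI; exact: mZ.
  apply: (etrans (product_measure1E P Q mA (mB ord_max))).
  by rewrite big_ord_recr -ZQ.
apply/seteqP; split => -[w t] /= h.
  split=> [i _ /=|]; first by have := h (widen_ord (leqnSn n) i) I; rewrite /= snoc_widen.
  by have := h ord_max I; rewrite /= snoc_max.
move=> i _ /=; case: h => h1 h2; rewrite /snoc; case: unliftP => [k ->|->] //=.
by rewrite -widen_ord_lift; exact: h1.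
Qed.

End Snoc.

Section Exchangeable.
Variables (R : realType) (d : measure_display) (T : measurableType d).
Variables (Q : {measure set T -> \bar R}).
Variables (d' : measure_display) (Omega : measurableType d').
Variables (P : probability Omega R) (n : nat) (W : 'I_n -> Omega -> T).
Hypothesis hW : iid Q P W.

(** The transposition of [i] and [k] preserves the law of the sample and, by equivariance, turns
    [F i] into [F k]. *)
Lemma iid_exchange (F : 'I_n -> n.-tuple T -> \bar R) (i k : 'I_n) :
  (forall i, measurable_fun setT (F i)) -> (forall i t, (0 <= F i t)%E) ->
  (forall (s : 'S_n) i t, F i [tuple tnth t (s l) | l < n] = F (s i) t) ->
  (\int[P]_w F i [tuple W l w | l < n] = \int[P]_w F k [tuple W l w | l < n])%E.
Proof.
move=> mF F0 Fs; have hWs := iid_perm (tperm i k) hW.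
rewrite -(iid_law_unique hWs hW (mF i) (F0 i)); apply: eq_integral => w _.
rewrite -[in RHS](tpermL i k) -Fs; congr (F i _).
by apply: eq_from_tnth => l; rewrite !tnth_mktuple.
Qed.

End Exchangeable.

Section MeanNonneg.
Variables (R : realType) (d : measure_display) (T : measurableType d).
Variable (m : {measure set T -> \bar R}).

(** Extended-valued, so that nonnegative functions can be handled before they are known to be
    integrable. *)
Definition mean (f : T -> R) : \bar R := (\int[m]_x (f x)%:E)%E.

Lemma mean_ge0 (f : T -> R) : (forall x, 0 <= f x) -> (0 <= mean f)%E.
Proof. by move=> f0; apply: integral_ge0 => x _; rewrite lee_fin. Qed.

Lemma mean_le (f g : T -> R) : (forall x, 0 <= f x <= g x) ->
  measurable_fun setT f -> measurable_fun setT g -> (mean f <= mean g)%E.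
Proof.
move=> fg mf mg; apply: ge0_le_integral => //.
- by move=> x _; rewrite lee_fin; case/andP: (fg x).
- exact/measurable_EFinP.
- exact/measurable_EFinP.
- by move=> x _; rewrite lee_fin; case/andP: (fg x).
Qed.

Lemma meanD (f g : T -> R) : (forall x, 0 <= f x) -> (forall x, 0 <= g x) ->
  measurable_fun setT f -> measurable_fun setT g ->
  mean (fun x => f x + g x) = (mean f + mean g)%E.
Proof.
move=> f0 g0 mf mg; rewrite -ge0_integralD//; try exact/measurable_EFinP.
- by move=> x _; rewrite lee_fin.
- by move=> x _; rewrite lee_fin.
Qed.

Lemma meanZ (k : R) (f : T -> R) : 0 <= k -> (forall x, 0 <= f x) -> measurable_fun setT f ->
  mean (fun x => k * f x) = (k%:E * mean f)%E.
Proof.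
move=> k0 f0 mf; rewrite -ge0_integralZl_EFin//; try exact/measurable_EFinP.
by move=> x _; rewrite lee_fin.
Qed.

Lemma mean_sum n (f : 'I_n -> T -> R) : (forall i x, 0 <= f i x) ->
  (forall i, measurable_fun setT (f i)) ->
  mean (fun x => \sum_(i < n) f i x) = (\sum_(i < n) mean (f i))%E.
Proof.
move=> f0 mf; rewrite -ge0_integral_sum//.
- by apply: eq_integral => x _; rewrite sumEFin.
- by move=> i; exact/measurable_EFinP.
- by move=> i x _; rewrite lee_fin.
Qed.

End MeanNonneg.

Lemma mean_cst (R : realType) d (T : measurableType d) (m : probability T R) (k : R) :
  mean m (fun=> k) = k%:E.
Proof.
rewrite /mean -[LHS]/(\int[m]_x cst k%:E x)%E integral_cst//.
by rewrite -[RHS]mule1; congr (_ * _)%E; exact: probability_setT.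
Qed.

Lemma mean_fubini (R : realType) d (T : measurableType d) d' (Omega : measurableType d')
    (P : probability Omega R) (Q : probability T R) (f : Omega * T -> R) :
  (forall u, 0 <= f u) -> measurable_fun setT f ->
  mean (P \x Q)%E f = (\int[P]_w mean Q (fun z => f (w, z)))%E /\
  measurable_fun setT (fun w => mean Q (fun z => f (w, z))).
Proof.
move=> f0 mf; split.
  by rewrite /mean fubini_tonelli1//; exact/measurable_EFinP.
apply: (measurable_fun_fubini_tonelli_F (m2 := Q) (fun u => (f u)%:E)).
  exact/measurable_EFinP.
by move=> u; rewrite lee_fin.
Qed.

Section Sampling.
Variables (R : realType) (d : measure_display) (T : measurableType d).
Variables (d' : measure_display) (Omega : measurableType d').
Variables (P : probability Omega R) (Q : probability T R).
Variables (n : nat) (Z : 'I_n -> Omega -> T).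
Hypothesis hZ : iid Q P Z.

Definition extended_sample (u : Omega * T) : n.+1.-tuple T :=
  [tuple snoc Z i u | i < n.+1].

Lemma measurable_extended_sample : measurable_fun setT extended_sample.
Proof.
apply/measurable_fun_tnthP => i.
rewrite (_ : _ \o _ = snoc Z i); first by case: (iid_snoc hZ).
by apply/funext => u /=; rewrite tnth_mktuple.
Qed.

Lemma extended_sample_widen u i :
  tnth (extended_sample u) (widen_ord (leqnSn n) i) = Z i u.1.
Proof. by rewrite tnth_mktuple snoc_widen. Qed.

Lemma extended_sample_max u : tnth (extended_sample u) ord_max = u.2.
Proof. by rewrite tnth_mktuple snoc_max. Qed.

Lemma mean_exchange (F : 'I_n.+1 -> n.+1.-tuple T -> R) :
  (forall i, measurable_fun setT (F i)) -> (forall i t, 0 <= F i t) ->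
  (forall (s : 'S_n.+1) i t, F i [tuple tnth t (s l) | l < n.+1] = F (s i) t) ->
  mean (P \x Q)%E (fun u => \sum_(i < n.+1) F i (extended_sample u)) =
  (n.+1%:R%:E * mean (P \x Q)%E (fun u => F ord_max (extended_sample u)))%E.
Proof.
move=> mF F0 Fs; rewrite mean_sum//; last first.
  by move=> i; exact: (measurableT_comp (mF i) measurable_extended_sample).
rewrite (eq_bigr (fun=> mean (P \x Q)%E (fun u => F ord_max (extended_sample u)))).
  by rewrite sumr_const card_ord mule_natl.
move=> i _; apply: (iid_exchange (iid_snoc hZ) (F := fun i t => (F i t)%:E)).
- by move=> k; exact/measurable_EFinP.
- by move=> k t; rewrite lee_fin.
- by move=> s k t; rewrite Fs.
Qed.

End Sampling.

(** * The risk on one cell *)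

Section LocalRisk.
Variables (R : realType) (d : measure_display) (X : measurableType d).
Local Notation T := (X * measurableTypeR R)%type.
Variables (nu : probability X R) (Q : probability T R).
Hypothesis margQ : forall A, measurable A -> Q (A `*` setT) = nu A.
Variables (H : funspace R X) (K : X -> X -> R) (kappa : R).
Hypothesis hHK : is_rkhs H K.
Hypothesis mK : measurable_fun setT (fun u : X * X => K u.1 u.2).
Hypothesis kappa_ge0 : 0 <= kappa.
Hypothesis Kle : forall x, K x x <= kappa ^+ 2.
Variables (d' : measure_display) (Omega : measurableType d').
Variables (P : probability Omega R) (n : nat) (Z : 'I_n -> Omega -> T).
Hypotheses (hZ : iid Q P Z) (n_gt0 : (0 < n)%N).
Variables (lam : R) (lam_gt0 : 0 < lam).
Local Notation ip := (fip H).
Local Notation l2 := (l2 nu).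
Local Notation mu := (n%:R * lam).
Local Notation ext := (extended_sample Z).
Let hH := rkhs_hilbert hHK.

(** Ratio of the upper to the lower bound in [ginv_bounds]: the price of replacing [mu C_ii] by
    1. *)
Let c : R := (mu + kappa ^+ 2) / mu.

Let mu_gt0 : 0 < mu. Proof. by rewrite mulr_gt0// ltr0n. Qed.

Let c_ge1 : 1 <= c.
Proof. by rewrite ler_pdivlMr// mul1r lerDl sqr_ge0. Qed.

Lemma mean_marginal (f : X -> R) : (forall x, 0 <= f x) -> measurable_fun setT f ->
  mean Q (fun z => f z.1) = mean nu f.
Proof.
move=> f0 mf; rewrite /mean.
have mfE : measurable_fun setT (EFin \o f) by exact/measurable_EFinP.
rewrite -(@ge0_integral_pushforward _ _ T X R fst measurable_fst Q setT (EFin \o f))//;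
  last by move=> x _ /=; rewrite lee_fin.
apply: eq_measure_integral => A mA _.
apply: etrans (margQ mA); change (Q (fst @^-1` A) = Q (A `*` setT)); congr (Q _).
by apply/seteqP; split => -[x y] //= -[].
Qed.

Lemma l2_mean f : fcar H f -> (l2 f f)%:E = mean nu (fun x => f x ^+ 2).
Proof.
move=> hf; rewrite /mean /l2 /Rintegral fineK//.
exact: integrable_fin_num (rkhs_integrable nu hHK mK kappa_ge0 Kle hf hf).
Qed.

Local Notation pts t := (fun k => (tnth t k).1).
(** The labels are an arbitrary function [e] of the observation: the target at its input for the
    bias, the noise for the variance. The estimator is linear in them. *)
Let sol (e : T -> R) i (t : n.+1.-tuple T) : R :=
  gsol K (pts t) mu (fun k => e (tnth t k)) i.
Let inv i (t : n.+1.-tuple T) : R := ginv K (pts t) mu i.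
Let fitZ (e : T -> R) (w : Omega) : X -> R :=
  fit K (fun i => (Z i w).1) mu (fun i => e (Z i w)).

Let m_tnth (e : T -> R) i : measurable_fun setT e ->
  measurable_fun setT (fun t : n.+1.-tuple T => e (tnth t i)).
Proof. by move=> me; exact: (measurableT_comp me (measurable_tnth i)). Qed.

Let m_pts i : measurable_fun setT (fun t : n.+1.-tuple T => (tnth t i).1).
Proof. exact: (measurableT_comp measurable_fst (measurable_tnth i)). Qed.

Let m_sol e i : measurable_fun setT e -> measurable_fun setT (sol e i).
Proof.
move=> me; apply: (measurable_gsol mK hHK mu_gt0 (x := fun k t => (tnth t k).1)
  (y := fun k t => e (tnth t k))) => k; [exact: m_pts | exact: m_tnth].
Qed.

Let m_inv i : measurable_fun setT (inv i).
Proof.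
apply: (measurable_gsol mK hHK mu_gt0 (x := fun k t => (tnth t k).1)
  (y := fun k _ => (k == i)%:R)) => k; [exact: m_pts | exact: measurable_cst].
Qed.

Let pts_perm (t : n.+1.-tuple T) (s : 'S_n.+1) :
  (fun k => (tnth [tuple tnth t (s l) | l < n.+1] k).1) = (fun k => (tnth t (s k)).1).
Proof. by apply/funext => k; rewrite tnth_mktuple. Qed.

Let sol_perm e (s : 'S_n.+1) i t :
  sol e i [tuple tnth t (s l) | l < n.+1] = sol e (s i) t.
Proof.
rewrite /sol pts_perm -(gsol_perm hHK mu_gt0 (pts t) (fun k => e (tnth t k)) s i).
by congr gsol; apply/funext => k; rewrite tnth_mktuple.
Qed.

Let inv_perm (s : 'S_n.+1) i t : inv i [tuple tnth t (s l) | l < n.+1] = inv (s i) t.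
Proof. by rewrite /inv pts_perm -(ginv_perm hHK mu_gt0 (pts t) s i). Qed.

Let inv_bounds i t : c^-1 <= mu * inv i t <= 1.
Proof.
have /andP[h1 h2] := ginv_bounds hHK kappa_ge0 Kle mu_gt0 (pts t) i.
apply/andP; split.
  by rewrite /c invf_div ler_pM2l.
by rewrite mulrC -ler_pdivlMr// mul1r.
Qed.

Let ext_widen u : (fun i => (tnth (ext u) (widen_ord (leqnSn n) i)).1) =
  (fun i => (Z i u.1).1).
Proof. by apply/funext => i; rewrite extended_sample_widen. Qed.

Let fitZ_loo e u : e u.2 - fitZ e u.1 u.2.1 = sol e ord_max (ext u) / inv ord_max (ext u).
Proof.
have := loo_residual hHK kappa_ge0 Kle mu_gt0 (pts (ext u)) (fun k => e (tnth (ext u) k)).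
rewrite extended_sample_max ext_widen => <-; congr (_ - fit _ _ _ _ _).
by apply/funext => i; rewrite extended_sample_widen.
Qed.

Let m_fitZ e : measurable_fun setT e ->
  measurable_fun setT (fun u : Omega * T => fitZ e u.1 u.2.1).
Proof.
move=> me; case: hZ => mZ _.
apply: (measurable_fit mK hHK mu_gt0 (x := fun i (u : Omega * T) => (Z i u.1).1)
  (y := fun i (u : Omega * T) => e (Z i u.1)) _ _
  (measurableT_comp measurable_fst measurable_snd)) => i.
- exact: (measurableT_comp measurable_fst (measurableT_comp (mZ i) measurable_fst)).
- exact: (measurableT_comp me (measurableT_comp (mZ i) measurable_fst)).
Qed.

Let mext := measurable_extended_sample hZ.

(** Turns a population error of the fit into its error at the ghost point, to which exchangeability
    applies. *)
Let mean_ghost (f : Omega -> X -> R) : (forall w x, 0 <= f w x) ->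
  measurable_fun setT (fun u : Omega * T => f u.1 u.2.1) ->
  (forall w, measurable_fun setT (f w)) ->
  (\int[P]_w mean nu (f w))%E = mean (P \x Q)%E (fun u => f u.1 u.2.1) /\
  measurable_fun setT (fun w => mean nu (f w)).
Proof.
move=> f0 mf mfw.
have [-> m2] := mean_fubini P Q (f := fun u => f u.1 u.2.1) (fun u => f0 _ _) mf.
have E w : mean Q (fun z => f w z.1) = mean nu (f w) by exact: mean_marginal.
split; first by apply: eq_integral => w _; rewrite E.
by under eq_fun do rewrite -E.
Qed.

(** * Bias *)

Section Bias.
Variables (w k : X -> R) (A1 A2 : R).
Hypotheses (hw : fcar H w) (hk : fcar H k).
Hypothesis wE : w = (fun x => covop H K nu k x + lam * k x).
Hypotheses (hA1 : l2 k k <= A1) (hA2 : ip k k <= A2).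

(** Regularized inverse of the sample operator applied to [w]; [mu * g] is the residual of the
    noiseless fit, and the estimate closes on the mean of [q = <w, g>]. *)
Let g om := rsol K mu (fun i => (Z i om).1) w.
Let hg om : fcar H (g om) := rsol_fcar hHK mu (fun i => (Z i om).1) hw.
Let q om := ip w (g om).

Let q_ge0 om : 0 <= q om.
Proof.
rewrite /q -(rsol_energy hHK mu_gt0)//; apply: addr_ge0.
  by apply: sumr_ge0 => i _; exact: sqr_ge0.
by apply: mulr_ge0; [exact: ltW | exact: (ip_ge0 hH (hg om))].
Qed.

Let mw : measurable_fun setT w := measurable_rkhs hHK mK hw.
Let me : measurable_fun setT (fun z : T => w z.1).
Proof. exact: (measurableT_comp mw measurable_fst). Qed.

Let m_q : measurable_fun setT q.
Proof.
case: hZ => mZ _; rewrite /q (_ : (fun _ => _) = (fun om => mu^-1 * (ip w w -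
    \sum_(i < n) gsol K (fun i => (Z i om).1) mu (fun i => w (Z i om).1) i * w (Z i om).1))).
  have mZ1 i : measurable_fun setT (fun om => (Z i om).1).
    exact: (measurableT_comp measurable_fst (mZ i)).
  apply: measurable_funM; first exact: measurable_cst.
  apply: measurable_funB; first exact: measurable_cst.
  apply: measurable_sum => i; apply: measurable_funM; last exact: (measurableT_comp mw (mZ1 i)).
  apply: (measurable_gsol mK hHK mu_gt0 (x := fun i om => (Z i om).1)
    (y := fun i om => w (Z i om).1)) => // l; exact: (measurableT_comp mw (mZ1 l)).
by apply/funext => om; rewrite (ip_rsol hHK).
Qed.

Let gE om x : mu * g om x = w x - fitZ (fun z => w z.1) om x.
Proof. by rewrite /g /rsol /= mulrA mulfV ?mul1r// gt_eqF. Qed.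

Let g_max u : g u.1 u.2.1 = sol (fun z => w z.1) ord_max (ext u) / (mu * inv ord_max (ext u)).
Proof.
apply: (mulfI (lt0r_neq0 mu_gt0)); rewrite gE (fitZ_loo (fun z => w z.1)).
by rewrite invfM mulrCA (mulrA mu) mulfV ?mul1r// lt0r_neq0.
Qed.

Let mg : measurable_fun setT (fun u : Omega * T => g u.1 u.2.1).
Proof.
rewrite (_ : (fun u => _) = (fun u => mu^-1 * (w u.2.1 - fitZ (fun z => w z.1) u.1 u.2.1))).
  apply: measurable_funM; first exact: measurable_cst.
  apply: measurable_funB; last exact: m_fitZ.
  exact: (measurableT_comp me measurable_snd).
by apply/funext => u; rewrite -gE mulrA mulVf ?mul1r// gt_eqF.
Qed.

(** At the ghost [g = a / (mu C_(max, max))], with [a] the coefficient there, so [g^2 <= c^2 a^2].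
    By exchangeability [n+1] times the mean of [a^2] is the mean of the sum of all squared
    coefficients, which the energy identity bounds by [<w, g>] for [N + 1] points and [rsol_decr] by
    [q]. *)
Let mean_g2 : (n.+1%:R%:E * \int[P]_om mean nu (fun x => g om x ^+ 2)%R <=
  (c ^+ 2)%:E * mean P q)%E.
Proof.
have [-> _] := mean_ghost (f := fun om x => g om x ^+ 2) (fun _ _ => sqr_ge0 _)
  (measurable_funX 2 mg) (fun om => measurable_funX 2 (measurable_rkhs hHK mK (hg om))).
pose F i t := c ^+ 2 * sol (fun z => w z.1) i t ^+ 2.
have F0 i t : 0 <= F i t by rewrite mulr_ge0 ?sqr_ge0.
have mF i : measurable_fun setT (F i).
  by apply: measurable_funM; [exact: measurable_cst | apply: measurable_funX; exact: m_sol].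
apply: (@le_trans _ _ (n.+1%:R%:E * mean (P \x Q)%E (fun u => F ord_max (ext u)))%E).
  apply: lee_pmul => //; first exact: mean_ge0 (fun _ => sqr_ge0 _).
  apply: mean_le => [u||].
  - rewrite sqr_ge0/= g_max expr_div_n /F mulrC ler_wpM2r ?sqr_ge0//.
    have /andP[h1 _] := inv_bounds ord_max (ext u).
    have c0 : 0 < c by rewrite (lt_le_trans ltr01).
    rewrite -[leRHS]invrK lef_pV2 ?posrE ?exprn_gt0 ?invr_gt0 ?exprn_gt0//; last first.
      by rewrite (lt_le_trans _ h1)// invr_gt0.
    by rewrite -exprVn lerXn2r// nnegrE ?invr_ge0 ?(ltW c0)// (le_trans _ h1)// invr_ge0 ltW.
  - exact: measurable_funX.
  - exact: (measurableT_comp (mF ord_max) mext).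
rewrite -(mean_exchange hZ)//; last by move=> s i t; rewrite /F sol_perm.
rewrite -meanZ ?sqr_ge0//.
have mqu : measurable_fun setT (fun u : Omega * T => c ^+ 2 * q u.1).
  apply: measurable_funM; first exact: measurable_cst.
  exact: (measurableT_comp m_q measurable_fst).
have cq0 om : 0 <= c ^+ 2 * q om by rewrite mulr_ge0 ?sqr_ge0.
have -> : mean P (fun om => c ^+ 2 * q om) = mean (P \x Q)%E (fun u => c ^+ 2 * q u.1).
  have [-> _] := mean_fubini P Q (fun u => cq0 u.1) mqu.
  by apply: eq_integral => om _; exact: (esym (mean_cst Q (c ^+ 2 * q om))).
apply: mean_le => [u||//]; last first.
  by apply: measurable_sum => i; exact: (measurableT_comp (mF i) mext).
rewrite sumr_ge0//= -mulr_sumr ler_wpM2l ?sqr_ge0//.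
have hdec := rsol_decr hHK kappa_ge0 Kle mu_gt0 (pts (ext u)) hw.
rewrite ext_widen in hdec; apply: le_trans hdec.
rewrite -(rsol_energy hHK mu_gt0)// lerDl mulr_ge0 ?(ltW mu_gt0)//.
by apply: (ip_ge0 hH); exact: (rsol_fcar hHK).
Qed.

Let q_fin : mean P q \is a fin_num.
Proof.
have /andP[] : (0 <= mean P q <= (mu^-1 * ip w w)%:E)%E.
  rewrite mean_ge0//= -(mean_cst P); apply: mean_le => // om.
  by rewrite q_ge0/=; exact: (rsol_energy_le hHK mu_gt0).
by move=> h0 h1; rewrite ge0_fin_numE// (le_lt_trans h1)// ltry.
Qed.

(** The AM-GM weights behind [K0] leave the remainders [n / (4 c^2) |g|_nu^2] and [q / 4]; by
    [mean_g2] the mean of the first is also at most a quarter of the mean of [q]. *)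
Let K0 : R := c ^+ 2 / n%:R * A1 + lam / n%:R * A2.

Let K0_ge0 : 0 <= K0.
Proof.
have A10 : 0 <= A1 by exact: le_trans (l2_ge0 nu k) hA1.
have A20 : 0 <= A2 by exact: le_trans (ip_ge0 hH hk) hA2.
by apply: addr_ge0; apply: mulr_ge0 => //; apply: divr_ge0; rewrite ?sqr_ge0 ?ler0n ?(ltW lam_gt0).
Qed.

(* <w, g> = <k, g>_nu + lam <k, g>, and AM-GM on both products *)
Let q_le om : q om <= K0 + n%:R / (c ^+ 2 * 4) * l2 (g om) (g om) + 4^-1 * q om.
Proof.
have c0 : c != 0 by rewrite gt_eqF// (lt_le_trans ltr01).
have n0 : n%:R != 0 :> R by rewrite pnatr_eq0 -lt0n.
have n1 : 0 < n%:R :> R by rewrite ltr0n.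
have hgo := hg om.
have qE : q om = l2 k (g om) + lam * ip k (g om).
  have hTk := covop_fcar nu hHK mK kappa_ge0 Kle hk.
  rewrite /q [in LHS]wE -(ip_covop nu hHK mK kappa_ge0 Kle)// -(ipZl hH)// -(ipDl hH)//.
  exact: (fcarZ hH).
have e1 : l2 k (g om) <= c ^+ 2 / n%:R * l2 k k + n%:R / (c ^+ 2 * 4) * l2 (g om) (g om).
  have h := l2_ge0 nu (fun y => (- (c ^+ 2 / n%:R * 2)) * k y + g om y).
  have hkg := fcarZD hH (- (c ^+ 2 / n%:R * 2)) hk hgo.
  have l2ZD := l2ZDl nu hHK mK kappa_ge0 Kle.
  rewrite l2ZD// l2C l2ZD// [X in _ + X](l2C nu) l2ZD// (l2C nu (g om) k) in h.
  have t0 : 0 < n%:R / (c ^+ 2 * 4).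
    by rewrite divr_gt0// mulr_gt0// exprn_even_gt0.
  rewrite -subr_ge0; apply: le_trans (mulr_ge0 (ltW t0) h) _.
  by rewrite le_eqVlt; apply/orP; left; apply/eqP; field; rewrite n0 c0.
have e2 : ip k (g om) <= n%:R^-1 * ip k k + n%:R / 4 * ip (g om) (g om).
  have := ip_ge0 hH (fcarZD hH (- (2 / n%:R)) hk hgo).
  rewrite (ipZDZD hH)//.
  have t0 : 0 < n%:R / 4 :> R by rewrite divr_gt0.
  move/(mulr_ge0 (ltW t0)) => h; rewrite -subr_ge0; apply: le_trans h _.
  by rewrite le_eqVlt; apply/orP; left; apply/eqP; field.
have e3 : mu * ip (g om) (g om) <= q om.
  rewrite /q -(rsol_energy hHK mu_gt0)// lerDr.
  by apply: sumr_ge0 => i _; exact: sqr_ge0.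
have e4 : c ^+ 2 / n%:R * l2 k k <= c ^+ 2 / n%:R * A1.
  by apply: ler_wpM2l => //; apply: divr_ge0; rewrite ?sqr_ge0 ?ler0n.
have e5 : lam / n%:R * ip k k <= lam / n%:R * A2.
  by apply: ler_wpM2l => //; apply: divr_ge0; rewrite ?(ltW lam_gt0) ?ler0n.
have e6 : lam * ip k (g om) <= lam / n%:R * ip k k + 4^-1 * (mu * ip (g om) (g om)).
  have := ler_wpM2l (ltW lam_gt0) e2.
  by rewrite [leRHS](_ : _ = lam / n%:R * ip k k + 4^-1 * (mu * ip (g om) (g om)))//; field.
rewrite [leLHS]qE /K0; move: e1 e3 e4 e5 e6.
move: (c ^+ 2 / n%:R * l2 k k) (lam / n%:R * ip k k) (mu * ip (g om) (g om)) (lam * ip k (g om)).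
move: (c ^+ 2 / n%:R * A1) (lam / n%:R * A2) (n%:R / (c ^+ 2 * 4) * l2 (g om) (g om)) => *; lra.
Qed.

(** The mean squared bias is [mu^2 r], with [r] the mean of [|g|_nu^2]. [mean_g2] bounds [n r] by
    [c^2 s], with [s] the mean of [q], and the integrated [q_le] bounds [s] by [2 K0]. *)
Lemma bias_bound :
  (\int[P]_om mean nu (fun x => (fitZ (fun z => w z.1) om x - w x) ^+ 2)%R <=
   (2 * c ^+ 2 * lam ^+ 2 * (c ^+ 2 * A1 + lam * A2))%:E)%E.
Proof.
have c0 : 0 < c by rewrite (lt_le_trans ltr01).
have n1 : 0 < n%:R :> R by rewrite ltr0n.
have [I2E mI2] := mean_ghost (f := fun om x => g om x ^+ 2) (fun _ _ => sqr_ge0 _)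
  (measurable_funX 2 mg) (fun om => measurable_funX 2 (measurable_rkhs hHK mK (hg om))).
set I2 := (\int[P]_om mean nu (fun x => g om x ^+ 2)%R)%E in I2E.
have I20 : (0 <= I2)%E by apply: integral_ge0 => om _; exact: mean_ge0 (fun _ => sqr_ge0 _).
have I2l : I2 = mean P (fun om => l2 (g om) (g om)).
  by apply: eq_integral => om _; rewrite l2_mean.
have ml2 : measurable_fun setT (fun om => l2 (g om) (g om)).
  apply/measurable_EFinP; rewrite (_ : _ \o _ = (fun om => mean nu (fun x => g om x ^+ 2)))//.
  by apply/funext => om /=; rewrite l2_mean.
have sE := fineK q_fin; set s := fine (mean P q) in sE.
have hI2 := mean_g2; rewrite -/I2 -sE -EFinM in hI2.
have I2_fin : I2 \is a fin_num.
  rewrite ge0_fin_numE//; apply: le_lt_trans (_ : (c ^+ 2 * s)%:E < +oo)%E; last exact: ltry.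
  by apply: le_trans hI2; rewrite lee_pemull// lee_fin ler1n.
have rE := fineK I2_fin; set r := fine I2 in rE.
rewrite -rE -EFinM lee_fin in hI2.
have s_le : s <= K0 + n%:R / (c ^+ 2 * 4) * r + 4^-1 * s.
  have t0 : 0 <= n%:R / (c ^+ 2 * 4) by rewrite divr_ge0// mulr_ge0// sqr_ge0.
  have l20 om : 0 <= l2 (g om) (g om) by exact: l2_ge0.
  have f10 om : 0 <= n%:R / (c ^+ 2 * 4) * l2 (g om) (g om) by rewrite mulr_ge0.
  have f20 om : 0 <= 4^-1 * q om by rewrite mulr_ge0// q_ge0.
  have mf1 : measurable_fun setT (fun om => n%:R / (c ^+ 2 * 4) * l2 (g om) (g om)).
    by apply: measurable_funM => //; exact: measurable_cst.
  have mf2 : measurable_fun setT (fun om => 4^-1 * q om).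
    by apply: measurable_funM => //; exact: measurable_cst.
  have f120 om : 0 <= K0 + n%:R / (c ^+ 2 * 4) * l2 (g om) (g om) by rewrite addr_ge0.
  have mf12 : measurable_fun setT (fun om => K0 + n%:R / (c ^+ 2 * 4) * l2 (g om) (g om)).
    by apply: measurable_funD => //; exact: measurable_cst.
  have : (mean P q <= mean P (fun=> K0) + (n%:R / (c ^+ 2 * 4))%:E *
      mean P (fun om => l2 (g om) (g om)) + 4^-1%:E * mean P q)%E.
    rewrite -(meanZ P t0 l20 ml2) -(meanZ P _ q_ge0 m_q)// -(meanD P _ f10 _ mf1)//.
    rewrite -(meanD P f120 f20 mf12 mf2); apply: mean_le => // [om|].
      by rewrite q_ge0/=; exact: q_le.
    exact: measurable_funD.
  by rewrite mean_cst -I2l -rE -sE -!EFinM -!EFinD lee_fin.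
have -> : (\int[P]_om mean nu (fun x => (fitZ (fun z => w z.1) om x - w x) ^+ 2)%R)%E =
    (mu ^+ 2 * r)%:E.
  rewrite [RHS](EFinM (mu ^+ 2)) rE I2l.
  rewrite -(meanZ P (sqr_ge0 mu) (fun om => l2_ge0 nu (g om)) ml2).
  apply: eq_integral => om _; rewrite [RHS](EFinM (mu ^+ 2)) l2_mean//.
  rewrite -(meanZ nu (sqr_ge0 mu) (fun x => sqr_ge0 (g om x))); last first.
    by apply: measurable_funX; exact: (measurable_rkhs hHK mK (hg om)).
  by congr mean; apply/funext => x; rewrite -exprMn gE -sqrrN opprB.
rewrite lee_fin.
have r0 : 0 <= r by rewrite -lee_fin rE.
have h1 : n%:R * r <= c ^+ 2 * s.
  by apply: le_trans hI2; rewrite ler_wpM2r// ler_nat.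
have h2 : n%:R / (c ^+ 2 * 4) * r <= 4^-1 * s.
  rewrite mulrAC ler_pdivrMr; last by rewrite mulr_gt0// exprn_gt0.
  by apply: le_trans h1 _; rewrite le_eqVlt; apply/orP; left; apply/eqP; field.
(* Two quarters of [s] move to the left, where [s] is a real number thanks to [q_fin]. *)
have h3 : s <= 2 * K0 by lra.
have h4 : mu ^+ 2 * r <= n%:R * lam ^+ 2 * (c ^+ 2 * (2 * K0)).
  rewrite (_ : mu ^+ 2 * r = n%:R * lam ^+ 2 * (n%:R * r)); last by ring.
  apply: ler_wpM2l; first by rewrite mulr_ge0 ?sqr_ge0.
  by apply: le_trans h1 _; rewrite ler_wpM2l ?sqr_ge0.
apply: le_trans h4 _; rewrite le_eqVlt; apply/orP; left; apply/eqP.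
by rewrite /K0; field; rewrite gt_eqF.
Qed.

End Bias.

(** * Variance *)

Section Noise.
Variables (e : T -> R) (sigma : R).
Hypothesis me : measurable_fun setT e.
Hypothesis sepH : is_separable H.
(** Conditional centering given the input, tested against bounded [phi] and phrased with positive
    and negative parts so that only nonnegative functions are integrated. *)
Hypothesis noise_centered : forall (phi : X -> R) (b : R), measurable_fun setT phi ->
  (forall x, `|phi x| <= b) ->
  mean Q (fun z => Num.max (phi z.1 * e z) 0) =
  mean Q (fun z => Num.max (- (phi z.1 * e z)) 0).
Hypothesis noise_var : forall phi : X -> R, measurable_fun setT phi ->
  (forall x, 0 <= phi x) ->
  (mean Q (fun z => phi z.1 * e z ^+ 2)%R <= (sigma ^+ 2)%:E * mean nu phi)%E.

Let h i t := 1 - mu * inv i t.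
Let dl i (t : n.+1.-tuple T) := e (tnth t i) - sol e i t / inv i t.

Let h_bounds i t : 0 <= h i t <= 1.
Proof.
have /andP[h1 h2] := inv_bounds i t; rewrite /h subr_ge0 h2/= gerBl.
by apply: le_trans h1; rewrite invr_ge0 (le_trans _ c_ge1).
Qed.

Let m_h i : measurable_fun setT (h i).
Proof.
apply: measurable_funB; first exact: measurable_cst.
by apply: measurable_funM; [exact: measurable_cst | exact: m_inv].
Qed.

Let m_dl i : measurable_fun setT (dl i).
Proof.
apply: measurable_funB; first exact: m_tnth.
apply: measurable_funM; first exact: m_sol.
exact: measurable_funV (m_inv i).
Qed.

Let dl_max u : dl ord_max (ext u) = fitZ e u.1 u.2.1.
Proof. by rewrite /dl -fitZ_loo extended_sample_max opprB addrC addrNK. Qed.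

Let dl_perm (s : 'S_n.+1) i t : dl i [tuple tnth t (s l) | l < n.+1] = dl (s i) t.
Proof. by rewrite /dl sol_perm inv_perm tnth_mktuple. Qed.

Let h_perm (s : 'S_n.+1) i t : h i [tuple tnth t (s l) | l < n.+1] = h (s i) t.
Proof. by rewrite /h inv_perm. Qed.

(** Leverage scores see the inputs alone, so the ghost label may be replaced by a dummy 0; the score
    then is a function of the ghost input, as the noise hypotheses require. *)
Let h_ext om z : h ord_max (ext (om, z)) = h ord_max (ext (om, (z.1, 0))).
Proof.
have E : (fun k => (tnth (ext (om, z)) k).1) =
    (fun k => (tnth (ext (om, (z.1, 0))) k).1).
  by apply/funext => i; rewrite !tnth_mktuple /snoc; case: unlift.
by rewrite /h /inv E.
Qed.

Let m_embed om : measurable_fun setT (fun x : X => ext (om, (x, 0 : measurableTypeR R))).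
Proof.
apply: (measurableT_comp mext); apply: measurable_fun_pair; first exact: measurable_cst.
by apply: measurable_fun_pair => //; exact: measurable_cst.
Qed.

Let m_fitZ1 om : measurable_fun setT (fitZ e om).
Proof. exact: (measurable_rkhs hHK mK (fit_fcar hHK mu _ _)). Qed.

Let m_e2 i : measurable_fun setT (fun t : n.+1.-tuple T => e (tnth t i) ^+ 2).
Proof. by apply: measurable_funX; exact: m_tnth. Qed.

(** [Phi], [Psi] and [X1] are the three terms of [loo_noise_ineq]: left side, noise energy and cross
    term. *)
Let Phi i t := (1 - h i t) ^+ 2 * dl i t ^+ 2.
Let Psi i t := (1 - h i t) * h i t * e (tnth t i) ^+ 2.
Let X1 i t := (1 - h i t) * (1 - h i t *+ 2) * (e (tnth t i) * dl i t).

Let m_1h i : measurable_fun setT (fun t => 1 - h i t).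
Proof. by apply: measurable_funB; [exact: measurable_cst | exact: m_h]. Qed.

Let m_Phi i : measurable_fun setT (Phi i).
Proof. by apply: measurable_funM; apply: measurable_funX. Qed.

Let m_Psi i : measurable_fun setT (Psi i).
Proof. by apply: measurable_funM => //; apply: measurable_funM. Qed.

Let m_12h i : measurable_fun setT (fun t => (1 - h i t) * (1 - h i t *+ 2)).
Proof.
apply: measurable_funM => //; apply: measurable_funB; first exact: measurable_cst.
by rewrite (_ : (fun t => _) = (fun t => h i t + h i t)); [exact: measurable_funD|].
Qed.

Let m_X1 i : measurable_fun setT (X1 i).
Proof. by apply: measurable_funM => //; apply: measurable_funM => //; exact: m_tnth. Qed.

Let Phi_ge0 i t : 0 <= Phi i t. Proof. by rewrite mulr_ge0 ?sqr_ge0. Qed.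

Let Psi_ge0 i t : 0 <= Psi i t.
Proof.
have /andP[h0 h1] := h_bounds i t.
by rewrite /Psi (mulr_ge0 (mulr_ge0 _ h0) (sqr_ge0 _))// subr_ge0.
Qed.

Let abs_12h i t : `|(1 - h i t) * (1 - h i t *+ 2)| <= 1.
Proof.
have /andP[h0 h1] := h_bounds i t.
rewrite normrM mulr_ile1 ?normr_ge0// ler_norml; apply/andP; split; lra.
Qed.

Let mean_e2 : (mean (P \x Q)%E (fun u => e u.2 ^+ 2)%R <= (sigma ^+ 2)%:E)%E.
Proof.
have [->] := mean_fubini P Q (f := fun u => e u.2 ^+ 2) (fun u => sqr_ge0 _)
  (measurable_funX 2 (measurableT_comp me measurable_snd)).
move=> _; have : (mean Q (fun z => 1 * e z ^+ 2)%R <= (sigma ^+ 2)%:E * mean nu (fun=> 1%R))%E.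
  by apply: (noise_var (phi := fun=> 1)) => //; exact: measurable_cst.
rewrite mean_cst mule1; apply: le_trans.
rewrite (_ : (fun z => 1 * e z ^+ 2) = (fun z => e z ^+ 2)); last first.
  by apply/funext => z; rewrite mul1r.
rewrite [leLHS](_ : _ = mean Q (fun z => e z ^+ 2))//.
rewrite -[RHS]mule1 -(@probability_setT _ _ _ P).
exact: (integral_cst P measurableT (mean Q (fun z => e z ^+ 2))).
Qed.

(** Gives integrability of the cross term; the constant does not enter the final bound. *)
Let X1_le u : `|X1 ord_max (ext u)| <=
  (1 + kappa ^+ 2 / mu) * \sum_(i < n.+1) e (tnth (ext u) i) ^+ 2.
Proof.
rewrite /X1 normrM; apply: le_trans (ler_piMl _ (abs_12h _ _)) _; first exact: normr_ge0.
rewrite dl_max extended_sample_max.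
have F2 : fitZ e u.1 u.2.1 ^+ 2 <= kappa ^+ 2 / mu * \sum_(i < n) e (Z i u.1) ^+ 2.
  have hF := fit_fcar hHK mu (fun i => (Z i u.1).1) (fun i => e (Z i u.1)).
  have F1 := rkhs_eval_le hHK kappa_ge0 (Kle u.2.1) hF.
  have F3 := ip_fit_le hHK mu_gt0 (fun i => (Z i u.1).1) (fun i => e (Z i u.1)).
  rewrite -mulrA; apply: le_trans (ler_wpM2l (sqr_ge0 kappa) F3).
  rewrite -(sqr_fnorm hH hF) -exprMn -[leLHS]real_normK ?num_real//.
  by rewrite lerXn2r// nnegrE mulr_ge0// fnorm_ge0.
rewrite big_ord_recr/= extended_sample_max.
rewrite (eq_bigr (fun i => e (Z i u.1) ^+ 2)); last first.
  by move=> i _; rewrite extended_sample_widen.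
have S0 : 0 <= \sum_(i < n) e (Z i u.1) ^+ 2.
  by apply: sumr_ge0 => i _; exact: sqr_ge0.
have k0 : 0 <= kappa ^+ 2 / mu by rewrite divr_ge0 ?sqr_ge0// ltW.
apply: le_trans (_ : e u.2 ^+ 2 + fitZ e u.1 u.2.1 ^+ 2 <= _).
  have a0 := sqr_ge0 (`|e u.2| - `|fitZ e u.1 u.2.1|).
  have b0 : 0 <= `|e u.2| * `|fitZ e u.1 u.2.1| by rewrite mulr_ge0.
  rewrite normrM -[e u.2 ^+ 2]real_normK ?num_real//.
  rewrite -[fitZ _ _ _ ^+ 2]real_normK ?num_real//.
  move: a0 b0; move: `|e u.2| `|fitZ e u.1 u.2.1| => a b; nra.
move: F2 S0 (sqr_ge0 (e u.2)) k0.
move: (fitZ e u.1 u.2.1 ^+ 2) (e u.2 ^+ 2) (kappa ^+ 2 / mu) => a b k.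
move: (\sum_(i < n) _) => S aS S0 b0 k0.
have : 0 <= k * b by rewrite mulr_ge0.
nra.
Qed.

Let pos (x : R) : R := Num.max x 0.
Let pos_ge0 x : 0 <= pos x. Proof. by rewrite le_max lexx orbT. Qed.
Let pos_le x : pos x <= `|x|. Proof. by rewrite ge_max ler_norm normr_ge0. Qed.
Let posB x : x = pos x - pos (- x).
Proof. by rewrite /pos; case: (leP x 0); case: (leP (- x) 0); lra. Qed.

Let m_pos d0 (O : measurableType d0) (f : O -> R) : measurable_fun setT f ->
  measurable_fun setT (fun x => pos (f x)).
Proof. by move=> mf; apply: measurable_maxr => //; exact: measurable_cst. Qed.

(** With the sample fixed, the cross term at the ghost is the ghost noise times a bounded function
    of the ghost input, so centering applies for each [om]. *)
Let mean_X1 : mean (P \x Q)%E (fun u => pos (- X1 ord_max (ext u))) =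
  mean (P \x Q)%E (fun u => pos (X1 ord_max (ext u))).
Proof.
have mX1u : measurable_fun setT (fun u => X1 ord_max (ext u)).
  exact: (measurableT_comp (m_X1 ord_max) mext).
have [-> _] := mean_fubini P Q (fun u => pos_ge0 (- X1 ord_max (ext u)))
  (m_pos (measurable_funN mX1u)).
have [-> _] := mean_fubini P Q (fun u => pos_ge0 (X1 ord_max (ext u))) (m_pos mX1u).
apply: eq_integral => om _.
pose psi (x : X) := (1 - h ord_max (ext (om, (x, 0)))) * (1 - h ord_max (ext (om, (x, 0))) *+ 2).
pose phi x := psi x * fitZ e om x.
have X1E z : X1 ord_max (ext (om, z)) = phi z.1 * e z.
  by rewrite /X1 h_ext dl_max extended_sample_max /phi /psi/=; ring.
have hF := fit_fcar hHK mu (fun i => (Z i om).1) (fun i => e (Z i om)).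
have mphi : measurable_fun setT phi.
  apply: measurable_funM => //; exact: (measurableT_comp (m_12h ord_max) (m_embed om)).
have bphi x : `|phi x| <= kappa * fnorm H (fitZ e om).
  rewrite normrM; apply: le_trans (ler_piMl _ (abs_12h _ _)) _; first exact: normr_ge0.
  exact: (rkhs_eval_le hHK kappa_ge0 (Kle x) hF).
have E := noise_centered mphi bphi.
transitivity (mean Q (fun z => Num.max (- (phi z.1 * e z)) 0)).
  by apply: eq_integral => z _; rewrite X1E.
by rewrite -E; apply: eq_integral => z _; rewrite X1E.
Qed.

Let mean_X1_fin : mean (P \x Q)%E (fun u => pos (X1 ord_max (ext u))) \is a fin_num.
Proof.
pose C0 : R := 1 + kappa ^+ 2 / mu.
have C00 : 0 <= C0 by rewrite addr_ge0// divr_ge0 ?sqr_ge0// ltW.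
have S0 (t : n.+1.-tuple T) : 0 <= \sum_(i < n.+1) e (tnth t i) ^+ 2.
  by apply: sumr_ge0 => i _; exact: sqr_ge0.
have mS : measurable_fun setT (fun u => \sum_(i < n.+1) e (tnth (ext u) i) ^+ 2).
  by apply: measurable_sum => i; exact: (measurableT_comp (m_e2 i) mext).
rewrite ge0_fin_numE ?mean_ge0//.
apply: (@le_lt_trans _ _ (C0%:E * (n.+1%:R%:E * (sigma ^+ 2)%:E))%E); last first.
  by rewrite -!EFinM ltry.
apply: (@le_trans _ _ (mean (P \x Q)%E (fun u => C0 * \sum_(i < n.+1) e (tnth (ext u) i) ^+ 2))).
  apply: mean_le => [u||].
  - by rewrite pos_ge0/=; apply: le_trans (pos_le _) (X1_le u).
  - exact: (m_pos (measurableT_comp (m_X1 ord_max) mext)).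
  - by apply: measurable_funM => //; exact: measurable_cst.
rewrite (meanZ _ C00 (fun u => S0 (ext u)) mS) lee_pmul2l//; last first.
  by rewrite lte_fin ltr_pwDl// divr_ge0 ?sqr_ge0// ltW.
rewrite (mean_exchange hZ (F := fun i t => e (tnth t i) ^+ 2))//; last 2 first.
- by move=> i t; exact: sqr_ge0.
- by move=> s i t; rewrite tnth_mktuple.
rewrite lee_pmul2l// ?lte_fin//; apply: le_trans mean_e2.
rewrite (_ : (fun u => _) = (fun u => e u.2 ^+ 2))//.
by apply/funext => u; rewrite extended_sample_max.
Qed.

(** The negative part of the cross term is moved to the left, so that both sides of [loo_noise_ineq]
    are sums of nonnegative functions to which exchangeability applies. The two parts have equal
    finite means and cancel. *)
Let mean_Phi_le : (mean (P \x Q)%E (fun u => Phi ord_max (ext u)) <=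
  mean (P \x Q)%E (fun u => Psi ord_max (ext u)))%E.
Proof.
pose F i t := Phi i t + pos (- X1 i t).
pose G i t := Psi i t + pos (X1 i t).
have F0 i t : 0 <= F i t by rewrite addr_ge0 ?pos_ge0.
have G0 i t : 0 <= G i t by rewrite addr_ge0 ?pos_ge0.
have mF i : measurable_fun setT (F i).
  by apply: measurable_funD => //; apply: m_pos; exact: measurable_funN.
have mG i : measurable_fun setT (G i) by apply: measurable_funD => //; exact: m_pos.
have le_FG : (mean (P \x Q)%E (fun u => F ord_max (ext u)) <=
    mean (P \x Q)%E (fun u => G ord_max (ext u)))%E.
  have n10 : (0 < n.+1%:R%:E :> \bar R)%E by rewrite lte_fin.
  rewrite -(@lee_pmul2l _ n.+1%:R%:E)//.
  rewrite -(mean_exchange hZ mF)//; last first.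
    by move=> s i t; rewrite /F /Phi /X1 h_perm dl_perm tnth_mktuple.
  rewrite -(mean_exchange hZ mG)//; last first.
    by move=> s i t; rewrite /G /Psi /X1 h_perm dl_perm tnth_mktuple.
  apply: mean_le => [u||]; last 2 first.
  - by apply: measurable_sum => i; exact: (measurableT_comp (mF i) mext).
  - by apply: measurable_sum => i; exact: (measurableT_comp (mG i) mext).
  rewrite sumr_ge0//= -subr_ge0 -sumrB.
  have := loo_noise_ineq hHK kappa_ge0 Kle mu_gt0 (x := pts (ext u))
    (y := fun k => e (tnth (ext u) k)) (h := fun i => h i (ext u))
    (dl := fun i => dl i (ext u)) (fun=> erefl) (fun=> erefl).
  rewrite -subr_ge0 -sumrB => /le_trans; apply; apply: ler_sum => i _.
  rewrite le_eqVlt; apply/orP; left; apply/eqP.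
  by rewrite /F /G /Phi /Psi -/(X1 i (ext u)) [X in _ + X - _]posB; ring.
move: le_FG; rewrite /F /G.
rewrite (meanD _ (fun u => Phi_ge0 _ (ext u)) (fun u => pos_ge0 _)); last 2 first.
- exact: (measurableT_comp (m_Phi ord_max) mext).
- exact: (m_pos (measurable_funN (measurableT_comp (m_X1 ord_max) mext))).
rewrite (meanD _ (fun u => Psi_ge0 _ (ext u)) (fun u => pos_ge0 _)); last 2 first.
- exact: (measurableT_comp (m_Psi ord_max) mext).
- exact: (m_pos (measurableT_comp (m_X1 ord_max) mext)).
by rewrite mean_X1 leeD2rE.
Qed.

Let mean_Psi_le : (mean (P \x Q)%E (fun u => Psi ord_max (ext u)) <=
  (sigma ^+ 2)%:E * mean (P \x Q)%E (fun u => h ord_max (ext u)))%E.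
Proof.
have mhu : measurable_fun setT (fun u => h ord_max (ext u)).
  exact: (measurableT_comp (m_h ord_max) mext).
have mPu : measurable_fun setT (fun u => Psi ord_max (ext u)).
  exact: (measurableT_comp (m_Psi ord_max) mext).
have h0 u : 0 <= h ord_max (ext u) by case/andP: (h_bounds ord_max (ext u)).
have he0 u : 0 <= h ord_max (ext u) * e u.2 ^+ 2 by rewrite mulr_ge0 ?sqr_ge0.
have mhe : measurable_fun setT (fun u => h ord_max (ext u) * e u.2 ^+ 2).
  apply: measurable_funM => //; apply: measurable_funX.
  exact: (measurableT_comp me measurable_snd).
apply: (@le_trans _ _ (mean (P \x Q)%E (fun u => h ord_max (ext u) * e u.2 ^+ 2))).
  apply: mean_le => // u; rewrite Psi_ge0/= /Psi extended_sample_max.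
  apply: ler_wpM2r; first exact: sqr_ge0.
  have /andP[h1 h2] := h_bounds ord_max (ext u).
  by apply: ler_piMl => //; lra.
have [-> m1] := mean_fubini P Q he0 mhe.
have [-> m2] := mean_fubini P Q h0 mhu.
rewrite -ge0_integralZl_EFin ?sqr_ge0//; last by move=> om _; exact: mean_ge0.
apply: ge0_le_integral => //.
- by move=> om _; exact: mean_ge0.
- by apply: measurable_funeM.
move=> om _.
pose phi (x : X) := h ord_max (ext (om, (x, 0))).
have mphi : measurable_fun setT phi by exact: (measurableT_comp (m_h ord_max) (m_embed om)).
have phi0 x : 0 <= phi x by exact: h0.
rewrite (_ : (fun z => h ord_max (ext (om, z)) * _) = (fun z => phi z.1 * e z ^+ 2)); last first.
  by apply/funext => z; rewrite h_ext.
rewrite (_ : (fun z => h ord_max (ext (om, z))) = (fun z => phi z.1)); last first.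
  by apply/funext => z; rewrite h_ext.
by rewrite mean_marginal//; exact: noise_var.
Qed.

Local Notation Tnu := (covop H K nu).
Local Notation res := (resolvent H Tnu lam).

(** The sum of the [n+1] leverage scores is a trace whose [j]-th basis term is at most [U j]. The
    mean of [U j] is at most [(n+1) / n] times the [j]-th term of the effective dimension, and this
    factor turns the [n+1] of exchangeability into [n]. *)
Let mean_h_le : (n%:R%:E * mean (P \x Q)%E (fun u => h ord_max (ext u)) <=
  effdim H Tnu lam)%E.
Proof.
have n0 : 0 < n%:R :> R by rewrite ltr0n.
have [E [b [onb bE ->]]] := effdim_nneseries nu hHK mK kappa_ge0 Kle lam_gt0 sepH.
have hb := onb_enum_fcar hH onb bE.
have hv j : fcar H (res (b j)) by exact: (resolvent_fcar nu hHK mK kappa_ge0 Kle lam_gt0).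
have hq j : fcar H (Tnu (res (b j))) by exact: (covop_fcar nu hHK mK kappa_ge0 Kle).
(* The bound of [gsol_quad_le] for the splitting [b j = T v + lam v] with [v = res (b j)]; its
   weight [lam^2 / mu] equals [lam / n]. *)
pose U j (t : n.+1.-tuple T) := ip (Tnu (res (b j))) (Tnu (res (b j))) +
  lam / n%:R * \sum_(i < n.+1) res (b j) (tnth t i).1 ^+ 2.
pose t0 j := l2 (res (b j)) (b j).
have t0_ge0 j : 0 <= t0 j by exact: (l2_resolvent_ge0 nu hHK mK kappa_ge0 Kle lam_gt0).
have ln0 : 0 <= lam / n%:R by rewrite divr_ge0 ?ltW.
have S0 j (t : n.+1.-tuple T) : 0 <= \sum_(i < n.+1) res (b j) (tnth t i).1 ^+ 2.
  by apply: sumr_ge0 => i _; exact: sqr_ge0.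
have U0 j t : 0 <= U j t by rewrite addr_ge0 ?(ip_ge0 hH)// mulr_ge0.
have mv j i : measurable_fun setT (fun t : n.+1.-tuple T => res (b j) (tnth t i).1 ^+ 2).
  apply: measurable_funX; exact: (measurableT_comp (measurable_rkhs hHK mK (hv j)) (m_pts i)).
have mU j : measurable_fun setT (U j).
  apply: measurable_funD; first exact: measurable_cst.
  by apply: measurable_funM; [exact: measurable_cst | exact: measurable_sum].
have meanU j : (mean (P \x Q)%E (fun u => U j (ext u)) <= (n.+1%:R / n%:R * t0 j)%:E)%E.
  rewrite /U (meanD _ (fun=> ip_ge0 hH (hq j)) (fun u => mulr_ge0 ln0 (S0 j (ext u)))); last 2 first.
  - exact: measurable_cst.
  - apply: measurable_funM; first exact: measurable_cst.
    by apply: measurable_sum => i; exact: (measurableT_comp (mv j i) mext).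
  rewrite mean_cst (meanZ _ ln0 (fun u => S0 j (ext u))); last first.
    by apply: measurable_sum => i; exact: (measurableT_comp (mv j i) mext).
  rewrite (mean_exchange hZ (F := fun i t => res (b j) (tnth t i).1 ^+ 2))//; last 2 first.
  - by move=> i t; exact: sqr_ge0.
  - by move=> s i t; rewrite tnth_mktuple.
  have -> : mean (P \x Q)%E (fun u => res (b j) (tnth (ext u) ord_max).1 ^+ 2) =
      (l2 (res (b j)) (res (b j)))%:E.
    have mvj := measurable_rkhs hHK mK (hv j).
    have [E1 _] := mean_ghost (f := fun _ x => res (b j) x ^+ 2) (fun _ _ => sqr_ge0 _)
      (measurable_funX 2 (measurableT_comp mvj
        (measurableT_comp measurable_fst measurable_snd)))
      (fun _ => measurable_funX 2 mvj).
    rewrite (_ : (fun u => _) = (fun u => res (b j) u.2.1 ^+ 2)); last first.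
      by apply/funext => u; rewrite extended_sample_max.
    rewrite -E1 -l2_mean//.
    exact: (mean_cst P (l2 (res (b j)) (res (b j)))).
  rewrite -!EFinM -EFinD lee_fin /t0 (l2_resolvent nu hHK mK kappa_ge0 Kle lam_gt0)//.
  have q0 := ip_ge0 hH (hq j); have v0 := l2_ge0 nu (res (b j)).
  rewrite mulrDr; apply: lerD.
    by rewrite ler_peMl// ler_pdivlMr// mul1r ler_nat.
  by rewrite le_eqVlt; apply/orP; left; apply/eqP; field; rewrite gt_eqF.
have hS t : ((\sum_(i < n.+1) h i t)%:E <= \sum_(0 <= j <oo) (U j t)%:E)%E.
  apply: (leverage_sum_le hHK mu_gt0 (x := pts t) onb bE) => // j.
  have -> : U j t = ip (Tnu (res (b j))) (Tnu (res (b j))) +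
      lam ^+ 2 / mu * \sum_(i < n.+1) res (b j) (tnth t i).1 ^+ 2.
    by rewrite /U; congr (_ + _ * _); field; rewrite !gt_eqF.
  apply: (gsol_quad_le hHK mu_gt0 (pts t) (w := b j) lam_gt0 (hq j) (hv j)) => y.
  have [_ bEq] := resolventP nu hHK mK kappa_ge0 Kle lam_gt0 (hb j).
  by rewrite -[LHS](congr1 (@^~ y) bEq).
have h0 i t : 0 <= h i t by case/andP: (h_bounds i t).
have : (n.+1%:R%:E * mean (P \x Q)%E (fun u => h ord_max (ext u)) <=
    (n.+1%:R / n%:R)%:E * \sum_(0 <= j <oo) (t0 j)%:E)%E.
  rewrite -(mean_exchange hZ m_h h0 h_perm) -nneseriesZl//; last by move=> j _; rewrite lee_fin.
  apply: (@le_trans _ _ (\int[(P \x Q)%E]_u \sum_(0 <= j <oo) (U j (ext u))%:E)%E).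
    apply: ge0_le_integral => //.
    - by move=> u _; rewrite lee_fin sumr_ge0.
    - apply/measurable_EFinP; apply: measurable_sum => i.
      exact: (measurableT_comp (m_h i) mext).
    - apply: ge0_emeasurable_sum => [j u _ _|j _]; first by rewrite lee_fin.
      apply/measurable_EFinP; exact: (measurableT_comp (mU j) mext).
  rewrite integral_nneseries//; last 2 first.
  - move=> j; apply/measurable_EFinP; exact: (measurableT_comp (mU j) mext).
  - by move=> j u _; rewrite lee_fin.
  apply: lee_nneseries => [*|j *]; last by rewrite -EFinM; exact: meanU.
  by apply: integral_ge0 => u _; rewrite lee_fin.
move=> hle.
have nn : 0 <= n%:R / n.+1%:R :> R by rewrite divr_ge0.
have := lee_wpmul2l (_ : (0 <= (n%:R / n.+1%:R)%:E)%E) hle.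
rewrite lee_fin => /(_ nn); rewrite !muleA -!EFinM.
rewrite (_ : n%:R / n.+1%:R * n.+1%:R = n%:R); last by field.
rewrite (_ : n%:R / n.+1%:R * (n.+1%:R / n%:R) = 1) ?mul1e//.
by rewrite mulrA divfK ?divff ?pnatr_eq0// -lt0n.
Qed.

Lemma noise_bound : (\int[P]_om mean nu (fun x => fitZ e om x ^+ 2)%R <=
  (c ^+ 2 * sigma ^+ 2 / n%:R)%:E * effdim H Tnu lam)%E.
Proof.
have n0 : 0 < n%:R :> R by rewrite ltr0n.
have c0 : 0 < c by rewrite (lt_le_trans ltr01).
have [-> _] := mean_ghost (f := fun om x => fitZ e om x ^+ 2) (fun _ _ => sqr_ge0 _)
  (measurable_funX 2 (m_fitZ me)) (fun om => measurable_funX 2 (m_fitZ1 om)).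
have mPu : measurable_fun setT (fun u => Phi ord_max (ext u)).
  exact: (measurableT_comp (m_Phi ord_max) mext).
(* [1 - h = mu C_ii] is at least [1 / c], so dropping the weight [(1 - h)^2] in [Phi] costs
   [c^2]. *)
apply: (@le_trans _ _ (mean (P \x Q)%E (fun u => c ^+ 2 * Phi ord_max (ext u)))).
  apply: mean_le => [u||]; last 2 first.
  - exact: measurable_funX 2 (m_fitZ me).
  - by apply: measurable_funM => //; exact: measurable_cst.
  rewrite sqr_ge0/= /Phi dl_max mulrA -[leLHS]mul1r; apply: ler_wpM2r; first exact: sqr_ge0.
  have /andP[h1 _] := inv_bounds ord_max (ext u).
  rewrite -exprMn exprn_ege1// /h opprB addrC subrK.
  by rewrite mulrC -ler_pdivrMr// mul1r.
rewrite (meanZ _ (sqr_ge0 c) (fun u => Phi_ge0 _ (ext u)) mPu).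
have -> : c ^+ 2 * sigma ^+ 2 / n%:R = c ^+ 2 * (sigma ^+ 2 * n%:R^-1) by rewrite mulrA.
rewrite (EFinM (c ^+ 2)) -muleA; apply: lee_wpmul2l; first by rewrite lee_fin sqr_ge0.
apply: le_trans mean_Phi_le _; apply: le_trans mean_Psi_le _.
rewrite (EFinM (sigma ^+ 2)) -muleA; apply: lee_wpmul2l; first by rewrite lee_fin sqr_ge0.
have ninv : (0 <= (n%:R^-1)%:E :> \bar R)%E by rewrite lee_fin invr_ge0 ltW.
apply: le_trans (lee_wpmul2l ninv mean_h_le).
by rewrite muleA -EFinM mulVf ?mul1e// gt_eqF.
Qed.

End Noise.

(** * Bias and variance together *)

Section Total.
Variables (w k : X -> R) (A1 A2 sigma : R).
Hypotheses (hw : fcar H w) (hk : fcar H k).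
Hypothesis wE : w = (fun x => covop H K nu k x + lam * k x).
Hypotheses (hA1 : l2 k k <= A1) (hA2 : ip k k <= A2).
Hypothesis sepH : is_separable H.
Let e (z : T) : R := (z.2 : R) - w z.1.
Hypothesis noise_centered : forall (phi : X -> R) (b : R), measurable_fun setT phi ->
  (forall x, `|phi x| <= b) ->
  mean Q (fun z => Num.max (phi z.1 * e z) 0) =
  mean Q (fun z => Num.max (- (phi z.1 * e z)) 0).
Hypothesis noise_var : forall phi : X -> R, measurable_fun setT phi ->
  (forall x, 0 <= phi x) ->
  (mean Q (fun z => phi z.1 * e z ^+ 2)%R <= (sigma ^+ 2)%:E * mean nu phi)%E.

Let est om : X -> R := krls K (fun i => Z i om) lam.

Let estE om x : est om x = fitZ (fun z => w z.1) om x + fitZ e om x.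
Proof.
rewrite /fitZ -(fitD hHK mu_gt0); congr (fit _ _ _ _ _).
by apply/funext => i; rewrite /e addrC subrK.
Qed.

Let mw1 : measurable_fun setT (fun z : T => w z.1).
Proof. exact: (measurableT_comp (measurable_rkhs hHK mK hw) measurable_fst). Qed.

Let me : measurable_fun setT e.
Proof. by apply: measurable_funB => //; exact: measurable_snd. Qed.

Let m_est : measurable_fun setT (fun u : Omega * T => est u.1 u.2.1).
Proof.
under eq_fun do rewrite estE.
by apply: measurable_funD; exact: m_fitZ.
Qed.

Let m_est1 om : measurable_fun setT (est om).
Proof. exact: (measurable_rkhs hHK mK (fit_fcar hHK mu _ _)). Qed.

Let mw0 : measurable_fun setT w := measurable_rkhs hHK mK hw.

Let mw2 : measurable_fun setT (fun u : Omega * T => w u.2.1).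
Proof. exact: (measurableT_comp mw1 measurable_snd). Qed.

Lemma local_risk_measurable :
  measurable_fun setT (fun om => mean nu (fun x => (est om x - w x) ^+ 2)).
Proof.
have [//] := mean_ghost (f := fun om x => (est om x - w x) ^+ 2) (fun _ _ => sqr_ge0 _)
  (measurable_funX 2 (measurable_funB m_est mw2))
  (fun om => measurable_funX 2 (measurable_funB (m_est1 om) mw0)).
Qed.

(** By linearity in the labels the error is the noiseless error plus the fit of the noise;
    [(a + b)^2 <= 2 a^2 + 2 b^2] separates them. *)
Lemma local_risk_bound :
  (\int[P]_om mean nu (fun x => (krls K (fun i => Z i om) lam x - w x) ^+ 2)%R <=
  (2 * (2 * c ^+ 2 * lam ^+ 2 * (c ^+ 2 * A1 + lam * A2)))%:E +
  2%:E * ((c ^+ 2 * sigma ^+ 2 / n%:R)%:E * effdim H (covop H K nu) lam))%E.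
Proof.
pose B om x := (fitZ (fun z => w z.1) om x - w x) ^+ 2.
pose V om x := fitZ e om x ^+ 2.
have mF1 f om : measurable_fun setT (fitZ f om).
  exact: (measurable_rkhs hHK mK (fit_fcar hHK mu _ _)).
have mB1 om : measurable_fun setT (B om).
  by apply: measurable_funX; apply: measurable_funB.
have mV1 om : measurable_fun setT (V om) by apply: measurable_funX.
have [_ mB] := mean_ghost (f := B) (fun _ _ => sqr_ge0 _)
  (measurable_funX 2 (measurable_funB (m_fitZ mw1) mw2)) mB1.
have [_ mV] := mean_ghost (f := V) (fun _ _ => sqr_ge0 _)
  (measurable_funX 2 (m_fitZ me)) mV1.
apply: (@le_trans _ _ (\int[P]_om (2%:E * mean nu (B om) + 2%:E * mean nu (V om)))%E).
  apply: ge0_le_integral; first exact: measurableT.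
  - by move=> om _; apply: mean_ge0 => x; exact: sqr_ge0.
  - exact: local_risk_measurable.
  - by apply: emeasurable_funD; exact: measurable_funeM.
  move=> om _.
  have B0 x : 0 <= B om x by exact: sqr_ge0.
  have V0 x : 0 <= V om x by exact: sqr_ge0.
  rewrite -(meanZ _ _ B0 (mB1 om))// -(meanZ _ _ V0 (mV1 om))// -meanD.
  - apply: mean_le => [x||]; last 2 first.
    + by apply: measurable_funX; apply: measurable_funB => //; exact: m_est1.
    + by apply: measurable_funD; apply: measurable_funM => //; exact: measurable_cst.
    rewrite sqr_ge0/= -/(est om x) estE /B /V.
    move: (fitZ _ om x) (fitZ e om x) (w x) => a b v.
    by rewrite -subr_ge0 (_ : _ - _ = (a - v - b) ^+ 2) ?sqr_ge0//; ring.
  - by move=> x; rewrite mulr_ge0.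
  - by move=> x; rewrite mulr_ge0.
  - by apply: measurable_funM => //; exact: measurable_cst.
  - by apply: measurable_funM => //; exact: measurable_cst.
have mB0 om : (0 <= mean nu (B om))%E by apply: mean_ge0 => x; exact: sqr_ge0.
have mV0 om : (0 <= mean nu (V om))%E by apply: mean_ge0 => x; exact: sqr_ge0.
rewrite ge0_integralD//; last 4 first.
- by move=> om _; rewrite mule_ge0// lee_fin.
- exact: measurable_funeM.
- by move=> om _; rewrite mule_ge0// lee_fin.
- exact: measurable_funeM.
rewrite !ge0_integralZl_EFin//; apply: leeD.
- rewrite EFinM; apply: lee_wpmul2l; first by rewrite lee_fin.
  exact: (bias_bound hw hk wE hA1 hA2).
- apply: lee_wpmul2l; first by rewrite lee_fin.
  exact: (noise_bound me sepH noise_centered noise_var).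
Qed.

End Total.

End LocalRisk.

(** * Extension by zero and conditioning *)

Section ExtendedSpace.
Variables (R : realType) (X : Type) (A : set X).
Variables (H : funspace R A) (K : A -> A -> R).

Local Notation val_ext := ('valL_ (0 : R)).

Lemma ext_patch (g : A -> R) : val_ext g = patch (fun=> 0) A (val_ext g).
Proof.
have := congr1 (@^~ (val_ext g)) (sigLK (A := A) (0 : R)).
by rewrite /= valLK.
Qed.

Lemma ext_out (g : A -> R) x : ~ A x -> val_ext g x = 0.
Proof. by move=> nAx; rewrite ext_patch patchN// notin_setE. Qed.

Lemma ext_in (g : A -> R) (u : A) : val_ext g (val u) = g u.
Proof. exact: (congr1 (@^~ u) (valLK (0 : R) g)). Qed.

Lemma in_setSubK x : A x -> exists u : A, val u = x.
Proof. by move=> Ax; exists (SigSub (mem_set Ax)). Qed.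

Lemma ext_fcar_out f x : fcar (ext_space H) f -> ~ A x -> f x = 0.
Proof. by move=> [g _ <-]; exact: ext_out. Qed.

Lemma ext_lin (a : R) (f g : A -> R) :
  (fun x => a * val_ext f x + val_ext g x) = val_ext (fun y => a * f y + g y).
Proof.
apply/funext => x; have [/in_setSubK[u <-]|Ax] := pselect (A x); first by rewrite !ext_in.
by rewrite !ext_out// mulr0 addr0.
Qed.

Lemma ext_sub (f g : A -> R) : val_ext f \- val_ext g = val_ext (f \- g).
Proof.
apply/funext => x; rewrite -[LHS]/(val_ext f x - val_ext g x).
have [/in_setSubK[u <-]|Ax] := pselect (A x); last first.
  by rewrite !ext_out// subr0.
by rewrite !ext_in.
Qed.

Lemma ext_0 : val_ext ((fun=> 0) : A -> R) = (fun=> 0).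
Proof.
apply/funext => x; have [/in_setSubK[u <-]|Ax] := pselect (A x); first by rewrite !ext_in.
by rewrite ext_out.
Qed.

Lemma fip_ext (f g : A -> R) : fip (ext_space H) (val_ext f) (val_ext g) = fip H f g.
Proof. by rewrite /= !valLK. Qed.

Lemma fnorm_ext (f : A -> R) : fnorm (ext_space H) (val_ext f) = fnorm H f.
Proof. by rewrite /fnorm fip_ext. Qed.

Lemma ext_hilbert : is_hilbert H -> is_hilbert (ext_space H).
Proof.
move=> [[H0 HD] ipL ipS ipP comp]; split.
- split; first by exists (fun=> 0) => //; exact: ext_0.
  move=> a _ _ [f Hf <-] [g Hg <-].
  by exists (fun y => a * f y + g y); [exact: HD | rewrite ext_lin].
- move=> a _ _ _ [f Hf <-] [g Hg <-] [h Hh <-].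
  by rewrite ext_lin !fip_ext ipL.
- by move=> _ _ [f Hf <-] [g Hg <-]; rewrite !fip_ext ipS.
- move=> _ [f Hf <-]; rewrite fip_ext; have [p q] := ipP _ Hf; split => // /q ->.
  exact: ext_0.
- move=> u Hu cu.
  pose v i := sigL A (u i).
  have uE i : u i = val_ext (v i) by have [g _ gE] := Hu i; rewrite /v -gE valLK.
  have Hv i : fcar H (v i) by have [g Hg gE] := Hu i; rewrite /v -gE valLK.
  have [|f Hf cf] := comp v Hv.
    move=> eps /cu[N hN]; exists N => i k Ni Nk.
    by rewrite -fnorm_ext -ext_sub -!uE; exact: hN.
  exists (val_ext f); first by exists f.
  rewrite (_ : (fun i => _) = (fun i => fnorm H (v i \- f)))//.
  by apply/funext => i; rewrite uE ext_sub fnorm_ext.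
Qed.

Lemma ext_kernel_in (u : A) : ext_kernel K (val u) = val_ext (K u).
Proof. by apply/funext => x; rewrite /ext_kernel ext_in. Qed.

Lemma ext_kernel_out x : ~ A x -> ext_kernel K x = (fun=> 0).
Proof. by move=> Ax; apply/funext => y; rewrite /ext_kernel ext_out. Qed.

Lemma ext_kernel_outr x y :
  ~ A y -> ext_kernel K x y = 0.
Proof.
move=> Ay; have [/in_setSubK[u <-]|Ax] := pselect (A x).
  by rewrite ext_kernel_in ext_out.
by rewrite ext_kernel_out.
Qed.

(** Off [A] the kernel section is zero and every extended function vanishes, so the reproducing
    property persists there. *)
Lemma ext_rkhs : is_rkhs H K -> is_rkhs (ext_space H) (ext_kernel K).
Proof.
move=> [hH hK]; have hE := ext_hilbert hH; split => // x.
have [/in_setSubK[u <-]|Ax] := pselect (A x).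
  have [Ku rep] := hK u; split; first by exists (K u) => //; rewrite ext_kernel_in.
  by move=> _ [f Hf <-]; rewrite ext_kernel_in fip_ext rep// ext_in.
rewrite ext_kernel_out//; split; first exact: fcar0 hE.
by move=> f Hf; rewrite (ip0r hE Hf) (ext_fcar_out Hf).
Qed.

Lemma ext_separable : is_separable H -> is_separable (ext_space H).
Proof.
move=> [u Hu du]; exists (fun i => val_ext (u i)); first by move=> i; exists (u i).
move=> _ eps [f Hf <-] eps0; have [i hi] := du _ _ Hf eps0.
by exists i; rewrite ext_sub fnorm_ext.
Qed.

Lemma ext_kernel_diag kappa x : (forall u : A, K u u <= kappa ^+ 2) ->
  ext_kernel K x x <= kappa ^+ 2.
Proof.
move=> Kle; have [/in_setSubK[u <-]|Ax] := pselect (A x).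
  by rewrite ext_kernel_in ext_in.
by rewrite ext_kernel_out// sqr_ge0.
Qed.

End ExtendedSpace.

(** * Integration through a disintegration *)

Section GraphKernel.
Variables (R : realType) (d d' d0 : measure_display) (X : measurableType d)
  (Y : measurableType d') (T : measurableType d0) (k : R.-pker X ~> Y).

(** Law of the pair [(x, Y)] with [Y] drawn from [k x]. The extra factor [T] of the source is the
    shape required by [kcomp]. *)
Definition graph_kernel (u : T * X) : {measure set (X * Y) -> \bar R}.
Proof.
refine (pushforward (k u.2) (fun y => (u.2, y))).
exact: pair1_measurable.
Defined.

Lemma graph_kernelE u A : graph_kernel u A = k u.2 (xsection A u.2).
Proof. by rewrite xsectionE. Qed.

Lemma measurable_graph_kernel A : measurable A ->
  measurable_fun setT (graph_kernel ^~ A).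
Proof.
move=> mA; under eq_fun do rewrite graph_kernelE.
apply: (measurableT_comp (f := fun x => k x (xsection A x))) measurable_snd.
by apply: measurable_fun_xsection_finite_kernel; rewrite inE.
Qed.

HB.instance Definition _ :=
  isKernel.Build _ _ (T * X)%type (X * Y)%type R graph_kernel measurable_graph_kernel.

Lemma graph_kernel_setT u : graph_kernel u setT = 1%E.
Proof. by rewrite graph_kernelE xsectionE/= preimage_setT prob_kernel. Qed.

HB.instance Definition _ :=
  Kernel_isProbability.Build _ _ _ _ R graph_kernel graph_kernel_setT.

End GraphKernel.

Section Disintegration.
Variables (R : realType) (d d' : measure_display) (X : measurableType d)
  (Y : measurableType d').
Variables (rho : probability (X * Y)%type R) (nu : probability X R)
  (k : R.-pker X ~> Y).
Hypothesis rhoE : forall A B, measurable A -> measurable B ->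
  rho (A `*` B) = (\int[nu]_(x in A) k x B)%E.

(** On rectangles the hypothesis identifies [rho] with the composition of [nu] and [graph_kernel];
    uniqueness of measures extends this, and integration against a composed kernel gives the
    iterated integral. *)
Lemma disintegration_integral (F : X * Y -> \bar R) : (forall z, (0 <= F z)%E) ->
  measurable_fun setT F ->
  (\int[rho]_z F z = \int[nu]_x \int[k x]_y F (x, y))%E.
Proof.
move=> F0 mF.
pose l : unit -> pprobability X R := fun=> nu.
have ml : measurable_fun setT l by exact: measurable_cst.
pose q : {measure set (X * Y) -> \bar R} :=
  kcomp (kprobability ml) (@graph_kernel R _ _ _ X Y unit k) tt.
have -> : (\int[rho]_z F z = \int[q]_z F z)%E.
  apply: eq_measure_integral => A mA _.
  pose C : set (set (X * Y)) :=
    [set C | exists A, measurable A /\ exists B, measurable B /\ C = A `*` B].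
  apply: (measure_unique C (fun=> setT)) => //.
  - rewrite measurable_prod_measurableType //; congr (<<s _ >>).
    rewrite predeqE; split => [[A1 mA1 [B mB <-]]|[A1 [mA1 [B [mB ->]]]]].
      by exists A1; split => //; exists B.
    by exists A1 => //; exists B.
  - move=> /= _ _ [X1 [mX1 [X2 [mX2 ->]]]] [Y1 [mY1 [Y2 [mY2 ->]]]].
    rewrite -setXI; exists (X1 `&` Y1); split; first exact: measurableI.
    by exists (X2 `&` Y2); split => //; exact: measurableI.
  - by move=> _; exists setT; split => //; exists setT; split => //; rewrite setXTT.
  - by rewrite bigcup_const//; exists 0%N.
  - move=> _ [A1 [mA1 [B [mB ->]]]]; apply: etrans (rhoE mA1 mB) _.
    rewrite /q/= /kcomp.
    rewrite [LHS]integral_mkcond -[RHS]/(\int[nu]_x graph_kernel k (tt, x) (A1 `*` B))%E.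
    apply: eq_integral => x _.
    rewrite graph_kernelE/= /patch; case: ifPn => xA.
      by rewrite in_xsectionX.
    by rewrite notin_xsectionX// measure0.
  - by move=> _; rewrite -ge0_fin_numE//; exact: fin_num_measure.
rewrite integral_kcomp//; apply: eq_integral => x _.
by rewrite /graph_kernel/= ge0_integral_pushforward//; [exact: pair1_measurable].
Qed.

End Disintegration.

(** * Conditional measures as probabilities *)

Section Conditioning.
Variables (R : realType) (d : measure_display) (T : measurableType d).
Implicit Types mu : {measure set T -> \bar R}.

(** The underlying set function is unchanged, so facts about [mu] transfer to the packed probability
    by conversion. *)
Definition to_probability mu (h : mu setT = 1%E) : probability T R.
Proof.
pose f : set T -> \bar R := mu.
pose m : isMeasure d T R f :=
  isMeasure.Build d T R f (measure0 mu) (measure_ge0 mu) (@measure_semi_sigma_additive _ _ _ mu).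
pose F : {measure set T -> \bar R} := HB.pack f m.
pose p : Measure_isProbability d T R F := Measure_isProbability.Build d T R F h.
exact: (HB.pack f m p).
Defined.

Lemma mean_to_probability mu (h : mu setT = 1%E) f :
  mean (to_probability h) f = mean mu f.
Proof. by apply: eq_measure_integral. Qed.

Variables (mu : {measure set T -> \bar R}) (A : set T) (mA : measurable A).
Lemma mean_condm (f : T -> R) : (forall x, 0 <= f x) -> measurable_fun setT f ->
  mean (condm mu mA) f = ((fine (mu A))^-1%:E * \int[mu]_(x in A) (f x)%:E)%E.
Proof.
move=> f0 mf; have mEf : measurable_fun setT (EFin \o f) by exact/measurable_EFinP.
rewrite /mean ge0_integral_mscale//; last by move=> x _; rewrite lee_fin.
congr (_ * _)%E.
rewrite -(setvU A) ge0_integral_setU//=; last 4 first.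
- exact: measurableC.
- by rewrite setvU.
- by move=> x _; rewrite lee_fin.
- by rewrite disj_set_sym; apply/disj_setPCl.
rewrite [X in (X + _)%E](eq_measure_integral mzero) => [|B mB BA]; last first.
  by rewrite /= /mrestr (_ : B `&` A = set0) ?measure0//; apply/seteqP; split => // x [/BA].
rewrite integral_measure_zero add0e; apply: eq_measure_integral => B mB BA.
by rewrite /= /mrestr; congr (mu _); exact: setIidl.
Qed.

Hypotheses (A_gt0 : (0 < mu A)%E) (A_fin : mu A \is a fin_num).

Lemma fine_condm_gt0 : 0 < fine (mu A).
Proof. by rewrite fine_gt0// A_gt0 ltey_eq A_fin. Qed.

Lemma condm_setT : condm mu mA setT = 1%E.
Proof.
rewrite /condm /= /mscale/= /mrestr setTI -{2}(fineK A_fin) -EFinM mulVf//.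
by rewrite gt_eqF// fine_condm_gt0.
Qed.

Lemma weight_mean_condm (f : T -> R) : (forall x, 0 <= f x) -> measurable_fun setT f ->
  ((fine (mu A))%:E * mean (condm mu mA) f = \int[mu]_(x in A) (f x)%:E)%E.
Proof.
move=> f0 mf; rewrite mean_condm// muleA -EFinM divff ?mul1e//.
by rewrite gt_eqF// fine_condm_gt0.
Qed.

End Conditioning.

(** * Regression function and noise *)

Section CenteredVariable.
Variables (R : realType) (m : {measure set (measurableTypeR R) -> \bar R}).
Hypothesis m1 : m setT = 1%E.
Let c : R := \int[m]_y (y : R).
Hypothesis var_fin : (\int[m]_y (`|(y : R) - c| ^+ 2)%:E < +oo)%E.

Let mid : measurable_fun setT (fun y : measurableTypeR R => (y : R)).
Proof. exact: measurable_id. Qed.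

Let integrable_cst (a : R) : m.-integrable setT (EFin \o cst a).
Proof.
apply/integrableP; split; first by apply/measurable_EFinP; exact: measurable_cst.
rewrite (eq_integral (cst `|a|%:E)); last by [].
by rewrite integral_cst// m1 mule1 ltry.
Qed.

Let integrable_sqr : m.-integrable setT (EFin \o (fun y => `|(y : R) - c| ^+ 2)).
Proof.
apply/integrableP; split.
  apply/measurable_EFinP; apply: measurable_funX; apply: measurableT_comp => //.
  exact: measurable_funB.
by under eq_integral do rewrite /= ger0_norm ?sqr_ge0//.
Qed.

(** A priori [c] could be a default value of the real integral. A finite second moment around any
    constant gives integrability through [a <= 1 + a^2], and only then is [c] a genuine mean. *)
Let integrable_centered : m.-integrable setT (EFin \o (fun y => (y : R) - c)).
Proof.
apply: (le_integrable measurableT _ _ (integrableD measurableT (integrable_cst 1) integrable_sqr)).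
  by apply/measurable_EFinP; exact: measurable_funB.
move=> y _.
rewrite -[leLHS]/(`|(y : R) - c|%:E) -[leRHS]/(`|1 + `|(y : R) - c| ^+ 2|%:E) lee_fin.
rewrite [leRHS]ger0_norm ?addr_ge0 ?sqr_ge0// -subr_ge0.
set a := `|_|; rewrite (_ : _ - _ = (a - 2^-1) ^+ 2 + 3/4); last by field.
by rewrite addr_ge0 ?sqr_ge0// divr_ge0.
Qed.

Let integral_centered : (\int[m]_y ((y : R) - c)%:E = 0)%E.
Proof.
have iy : m.-integrable setT (EFin \o (fun y : measurableTypeR R => (y : R))).
  have := integrableD measurableT integrable_centered (integrable_cst c).
  by apply: eq_integrable => // y _; rewrite /= -EFinD subrK.
under eq_integral do rewrite EFinB.
rewrite (integralB_EFin measurableT iy (integrable_cst c)).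
rewrite -[X in (X - _)%E](fineK (integrable_fin_num _ _))//.
rewrite -[X in (_ - X)%E]/(\int[m]_y cst c%:E y)%E integral_cst// m1 mule1.
exact: subee.
Qed.

Lemma centered_parts (a : R) :
  (\int[m]_y (Num.max (a * ((y : R) - c)) 0)%:E =
   \int[m]_y (Num.max (- (a * ((y : R) - c))) 0)%:E)%E.
Proof.
pose g y : \bar R := (a%:E * ((y : R) - c)%:E)%E.
have ig : m.-integrable setT g by exact: (integrableZl measurableT).
have pE : (\int[m]_x g^\+ x = \int[m]_y (Num.max (a * ((y : R) - c)) 0)%:E)%E.
  by apply: eq_integral => y _; rewrite funeposE /g -EFinM EFin_max.
have nE : (\int[m]_x g^\- x = \int[m]_y (Num.max (- (a * ((y : R) - c))) 0)%:E)%E.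
  by apply: eq_integral => y _; rewrite funenegE /g -EFinM EFin_max.
have : (\int[m]_y g y = 0)%E.
  by rewrite (integralZl measurableT integrable_centered) integral_centered mule0.
have fp := integrable_pos_fin_num measurableT ig.
have fn := integrable_neg_fin_num measurableT ig.
rewrite [LHS]integralE -pE -nE -(fineK fp) -(fineK fn) -EFinB => /eqP.
by rewrite eqe subr_eq0 => /eqP ->.
Qed.

Lemma variance_shift (a : R) :
  (\int[m]_y ((a - (y : R)) ^+ 2)%:E =
   ((a - c) ^+ 2)%:E + \int[m]_y ((c - (y : R)) ^+ 2)%:E)%E.
Proof.
have iD := integrableD measurableT (integrable_cst ((a - c) ^+ 2))
  (integrableZl measurableT (- (2 * (a - c))) integrable_centered).
rewrite (_ : (fun y : measurableTypeR R => ((a - y) ^+ 2)%:E) =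
  fun y => ((((a - c) ^+ 2)%:E + (- (2 * (a - c)))%:E * ((y : R) - c)%:E) +
    (`|(y : R) - c| ^+ 2)%:E)%E); last first.
  apply/funext => y; rewrite -EFinM -!EFinD; congr EFin.
  by rewrite real_normK ?num_real//; ring.
rewrite (integralD measurableT iD integrable_sqr).
rewrite (integralD measurableT (integrable_cst _) (integrableZl measurableT _ integrable_centered)).
rewrite (integralZl measurableT integrable_centered) integral_centered mule0 adde0.
rewrite -[X in (X + _)%E]/(\int[m]_y cst ((a - c) ^+ 2)%:E y)%E integral_cst// m1 mule1.
congr (_ + _)%E; apply: eq_integral => y _ /=.
by rewrite real_normK ?num_real//; congr EFin; ring.
Qed.

End CenteredVariable.

Section RegressionNoise.
Variables (R : realType) (d : measure_display) (X : measurableType d).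
Variables (rho : probability (X * measurableTypeR R)%type R) (nu : probability X R)
  (rhoc : R.-pker X ~> measurableTypeR R) (sigma M : R).
Hypotheses (hdis : disintegration rho nu rhoc) (hbern : bernstein nu rhoc sigma M).
Let f : X -> R := regression rhoc.
Hypothesis mf : measurable_fun setT f.

Let mf1 : measurable_fun setT (fun z : X * measurableTypeR R => f z.1).
Proof. exact: measurableT_comp. Qed.

Let snd_R : measurable_fun setT (fun z : X * measurableTypeR R => (z.2 : R)).
Proof. exact: measurable_snd. Qed.

(** The case [k = 2] of the Bernstein condition, where [2^-1 * 2! * M^0 = 1]. *)
Lemma cond_variance : {ae nu, forall x,
  (\int[rhoc x]_y (`|(y : R) - f x| ^+ 2)%:E <= (sigma ^+ 2)%:E)%E}.
Proof.
have := hbern (leqnn 2); apply: filterS => x.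
by rewrite subnn expr0 mulr1 (_ : 2`! = 2%N)// mulVf ?mul1r// pnatr_eq0.
Qed.

Let measurable_inner (F : X * measurableTypeR R -> R) : (forall z, 0 <= F z) ->
  measurable_fun setT F -> measurable_fun setT (fun x => mean (rhoc x) (fun y => F (x, y))).
Proof.
move=> F0 mF; apply: (measurable_kfcomp rhoc (f := EFin \o F)).
  exact/measurable_EFinP.
by move=> z; rewrite lee_fin.
Qed.

Let mean_rho (F : X * measurableTypeR R -> R) : (forall z, 0 <= F z) ->
  measurable_fun setT F ->
  mean rho F = (\int[nu]_x mean (rhoc x) (fun y => F (x, y)))%E.
Proof.
move=> F0 mF; apply: (disintegration_integral hdis (F := EFin \o F)).
  by move=> z; rewrite lee_fin.
exact/measurable_EFinP.
Qed.

Lemma noise_variance (phi : X -> R) : measurable_fun setT phi -> (forall x, 0 <= phi x) ->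
  (mean rho (fun z => phi z.1 * ((z.2 : R) - f z.1) ^+ 2)%R <=
   (sigma ^+ 2)%:E * mean nu phi)%E.
Proof.
move=> mphi phi0.
have F0 (z : X * measurableTypeR R) : 0 <= phi z.1 * ((z.2 : R) - f z.1) ^+ 2.
  by rewrite mulr_ge0// sqr_ge0.
have mF : measurable_fun setT
    (fun z : X * measurableTypeR R => phi z.1 * ((z.2 : R) - f z.1) ^+ 2).
  apply: measurable_funM; first exact: measurableT_comp.
  by apply: measurable_funX; exact: measurable_funB.
rewrite mean_rho// -meanZ ?sqr_ge0//; apply: ae_ge0_le_integral => //.
- by move=> x _; exact: mean_ge0.
- exact: (measurable_inner F0 mF).
- by move=> x _; rewrite lee_fin mulr_ge0// sqr_ge0.
- by apply/measurable_EFinP; exact: measurable_funM.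
apply: filterS cond_variance => x hx _.
have sqr_m : measurable_fun setT (fun y : measurableTypeR R => ((y : R) - f x) ^+ 2).
  by apply: measurable_funX; exact: measurable_funB.
rewrite -[leLHS]/(mean (rhoc x) (fun y => (phi x * ((y : R) - f x) ^+ 2)%R)).
rewrite meanZ//; last by move=> y; exact: sqr_ge0.
rewrite mulrC EFinM; apply: lee_wpmul2l; first by rewrite lee_fin.
apply: le_trans hx; rewrite le_eqVlt; apply/orP; left; apply/eqP.
by apply: eq_integral => y _; rewrite real_normK ?num_real.
Qed.

Lemma noise_symmetric (phi : X -> R) : measurable_fun setT phi ->
  mean rho (fun z => Num.max (phi z.1 * ((z.2 : R) - f z.1)) 0) =
  mean rho (fun z => Num.max (- (phi z.1 * ((z.2 : R) - f z.1))) 0).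
Proof.
move=> mphi.
have mg : measurable_fun setT
    (fun z : X * measurableTypeR R => phi z.1 * ((z.2 : R) - f z.1)).
  apply: measurable_funM; first exact: measurableT_comp.
  exact: measurable_funB.
have mF : measurable_fun setT
    (fun z : X * measurableTypeR R => Num.max (phi z.1 * ((z.2 : R) - f z.1)) 0).
  by apply: measurable_maxr.
have mG : measurable_fun setT
    (fun z : X * measurableTypeR R => Num.max (- (phi z.1 * ((z.2 : R) - f z.1))) 0).
  by apply: measurable_maxr => //; exact: measurableT_comp.
have max_ge0 (a : R) : 0 <= Num.max a 0 by rewrite le_max lexx orbT.
rewrite (mean_rho (fun=> max_ge0 _) mF) (mean_rho (fun=> max_ge0 _) mG).
apply: ge0_ae_eq_integral.
- exact: measurableT.
- exact: (measurable_inner (fun=> max_ge0 _) mF).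
- exact: (measurable_inner (fun=> max_ge0 _) mG).
- by move=> x _; exact: mean_ge0.
- by move=> x _; exact: mean_ge0.
apply: filterS cond_variance => x hx _.
exact: (centered_parts (prob_kernel (s := rhoc) x) (le_lt_trans hx (ltry _)) (phi x)).
Qed.

(** Given [x] this is the bias-variance identity [variance_shift]. The noise variance makes
    [risk rho f] finite, so the extended subtraction is sound even if [risk rho g] is infinite. *)
Lemma excess_risk (g : X -> R) : measurable_fun setT g ->
  (risk rho g - risk rho f = mean nu (fun x => (g x - f x) ^+ 2)%R)%E.
Proof.
move=> mg.
have sqr_rho (h : X -> R) : measurable_fun setT h ->
    measurable_fun setT (fun z : X * measurableTypeR R => (h z.1 - (z.2 : R)) ^+ 2).
  by move=> mh; apply: measurable_funX; apply: measurable_funB => //; exact: measurableT_comp.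
have riskE (h : X -> R) : measurable_fun setT h -> risk rho h =
    (\int[nu]_x mean (rhoc x) (fun y => (h x - (y : R)) ^+ 2)%R)%E.
  by move=> mh; apply: mean_rho => [z|]; [exact: sqr_ge0|exact: sqr_rho].
have risk_fin : risk rho f \is a fin_num.
  rewrite ge0_fin_numE; last by apply: integral_ge0 => z _; rewrite lee_fin sqr_ge0.
  apply: (@le_lt_trans _ _ (sigma ^+ 2)%:E); last exact: ltry.
  have := @noise_variance (fun=> 1) (measurable_cst _) (fun=> ler01).
  rewrite mean_cst mule1; apply: le_trans; rewrite le_eqVlt; apply/orP; left; apply/eqP.
  by apply: eq_integral => z _; rewrite mul1r -sqrrN opprB.
suff -> : risk rho g = (mean nu (fun x => (g x - f x) ^+ 2)%R + risk rho f)%E.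
  by rewrite addeK.
have m_gf : measurable_fun setT (fun x => (g x - f x) ^+ 2).
  by apply: measurable_funX; exact: measurable_funB.
have m_inner (h : X -> R) : measurable_fun setT h ->
    measurable_fun setT (fun x => mean (rhoc x) (fun y => (h x - (y : R)) ^+ 2)).
  move=> mh; apply: (measurable_inner (F := fun z => (h z.1 - (z.2 : R)) ^+ 2)).
    by move=> z; exact: sqr_ge0.
  exact: sqr_rho.
have inner_ge0 (h : X -> R) x : (0 <= mean (rhoc x) (fun y => (h x - (y : R)) ^+ 2)%R)%E.
  by apply: mean_ge0 => y; exact: sqr_ge0.
rewrite !riskE// -ge0_integralD//; last 3 first.
- by move=> x _; rewrite lee_fin sqr_ge0.
- exact/measurable_EFinP.
- exact: m_inner.
apply: ge0_ae_eq_integral => //.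
- exact: m_inner.
- by apply: emeasurable_funD; [exact/measurable_EFinP|exact: m_inner].
- by move=> x _; rewrite adde_ge0// lee_fin sqr_ge0.
apply: filterS cond_variance => x hx _.
exact: (variance_shift (prob_kernel (s := rhoc) x) (le_lt_trans hx (ltry _)) (g x)).
Qed.

End RegressionNoise.

Lemma local_samples_iid (R : realType) d d' (Omega : measurableType d)
    (P : {measure set Omega -> \bar R}) (X : measurableType d')
    (rho : {measure set (X * measurableTypeR R)%type -> \bar R})
    (S : local_model R X) (N : 'I_(ncell S) -> nat)
    (Z : {j : 'I_(ncell S) & 'I_(N j)} -> Omega -> X * measurableTypeR R)
    (j : 'I_(ncell S)) :
  local_samples P rho Z ->
  iid (condm rho (measurableX (mcell S j) measurableT)) P
    (fun i : 'I_(N j) => Z (Tagged (fun j => 'I_(N j)) i)).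
Proof.
move=> [mZ lawZ indep]; split=> [i|B mB]; first exact: mZ.
pose t (i : 'I_(N j)) := Tagged (fun j => 'I_(N j)) i.
have t_inj : injective t by move=> i k /eqP; rewrite eq_Tagged => /eqP.
(* Independence is applied to the subfamily of cell [j]; [B'] carries the sets [B i] over to its
   tagged indices and is full at all other indices. *)
pose B' u := if [pick i | t i == u] is Some i then B i else setT.
have B'E i : B' (t i) = B i.
  rewrite /B'; case: pickP => [k /eqP/t_inj -> //|/(_ i)]; by rewrite eqxx.
have mB' u : measurable (B' u) by rewrite /B'; case: pickP => [k _|].
have := indep [set t i | i in 'I_(N j)]%SET B' mB'.
rewrite big_imset/=; last by move=> i k _ _; exact: t_inj.
rewrite (_ : (\bigcap_(i in _) _)%classic = \bigcap_i Z (t i) @^-1` B i); last first.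
  apply/seteqP; split => w h.
    by move=> i _; rewrite /= -B'E; apply: h; rewrite /= imset_f.
  by move=> u /= /imsetP[i _ ->]; rewrite B'E; exact: h.
by move=> ->; apply: eq_bigr => i _; rewrite B'E lawZ.
Qed.

Lemma integral_indicM (R : realType) d (T : measurableType d)
    (mu : {measure set T -> \bar R}) (A : set T) (f : T -> R) :
  (\int[mu]_(x in A) (f x)%:E)%E = mean mu (fun x => \1_A x * f x).
Proof.
rewrite integral_mkcond; apply: eq_integral => x _; rewrite /patch indicE.
by case: (x \in A); rewrite ?mul1r ?mul0r.
Qed.

(** * The partition *)

Section Cells.
Variables (R : realType) (d : measure_display) (X : measurableType d).
Variables (nu : probability X R) (S : local_model R X).
Hypothesis cells : partition [set: 'I_(ncell S)] (cell S) [set: X].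

Lemma cell_cover x : exists j, cell S j x.
Proof.
have [h _ _] := cells; have : cover [set: 'I_(ncell S)] (cell S) x by rewrite h.
by move=> [j _ jx]; exists j.
Qed.

Lemma cell_inj j k x : cell S j x -> cell S k x -> j = k.
Proof. by move=> jx kx; have [_ + _] := cells; apply => //; exists x. Qed.

Lemma sum_cell (g : 'I_(ncell S) -> X -> R) j x :
  (forall k y, ~ cell S k y -> g k y = 0) -> cell S j x ->
  \sum_(k < ncell S) g k x = g j x.
Proof.
move=> g0 jx; rewrite (bigD1 j)//= big1 ?addr0// => k kj; apply: g0 => kx.
by rewrite (cell_inj jx kx) eqxx in kj.
Qed.

Lemma partitioned_krls_cell (N : 'I_(ncell S) -> nat)
    (z : {j : 'I_(ncell S) & 'I_(N j)} -> X * measurableTypeR R) lam j x :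
  cell S j x -> partitioned_krls z lam x =
    krls (hkernel S j) (fun i : 'I_(N j) => z (Tagged (fun j => 'I_(N j)) i)) lam x.
Proof.
move=> jx; rewrite /partitioned_krls.
rewrite (sum_cell (g := fun k => krls (hkernel S k)
  (fun i : 'I_(N k) => z (Tagged (fun j => 'I_(N j)) i)) lam) _ jx)//.
move=> k y ky; rewrite /krls big1// => i _.
by rewrite /hkernel ext_kernel_outr// mulr0.
Qed.

Hypothesis cell_gt0 : forall j, (0 < nu (cell S j))%E.

Let cell_fin j : nu (cell S j) \is a fin_num.
Proof. by apply: fin_num_measure; exact: mcell. Qed.

Lemma mean_cells (F : 'I_(ncell S) -> X -> R) (G : X -> R) :
  (forall j x, 0 <= F j x) -> (forall j, measurable_fun setT (F j)) ->
  (forall j x, cell S j x -> G x = F j x) ->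
  mean nu G = (\sum_(j < ncell S)
    ((weight nu j)%:E * mean (condm nu (mcell S j)) (F j)))%E.
Proof.
move=> F0 mF GF.
under eq_bigr do
  rewrite (weight_mean_condm _ (cell_gt0 _) (cell_fin _) (F0 _) (mF _)) integral_indicM.
rewrite -mean_sum//.
- apply: eq_integral => x _; congr EFin; have [j jx] := cell_cover x.
  rewrite (GF _ _ jx) (sum_cell (g := fun k y => \1_(cell S k) y * F k y) (j := j))//.
    by rewrite indicE mem_set// mul1r.
  by move=> k y ky; rewrite indicE memNset// mul0r.
- by move=> j x; rewrite mulr_ge0.
- by move=> j; apply: measurable_funM => //; apply: measurable_indic; exact: mcell.
Qed.

Lemma sum_weight : \sum_(j < ncell S) weight nu j = 1.
Proof.
have := @mean_cells (fun _ _ => 1) (fun=> 1) (fun _ _ => ler01) (fun _ => measurable_cst _)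
  (fun _ _ _ => erefl).
rewrite mean_cst => /esym.
under eq_bigr => j _.
  rewrite (_ : mean _ _ = 1%E); last first.
    by rewrite -(mean_to_probability (condm_setT _ (cell_gt0 j) (cell_fin j))) mean_cst.
  rewrite mule1; over.
by rewrite sumEFin => -[].
Qed.

Lemma ncell_gt0 : (0 < ncell S)%N.
Proof.
have : \sum_(j < ncell S) weight nu j != 0 by rewrite sum_weight oner_eq0.
case: posnP => // m0; rewrite big1 ?eqxx// => j _.
by have := ltn_ord j; rewrite [X in (_ < X)%N -> _]m0.
Qed.

End Cells.

(** * The local bound on a cell of the partition *)

Section CellRisk.
Variables (R : realType) (d : measure_display) (X : measurableType d).
Variables (rho : probability (X * measurableTypeR R)%type R) (nu : probability X R)
  (rhoc : R.-pker X ~> measurableTypeR R) (sigma M kappa Rad : R).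
Hypotheses (hmarg : marginal rho nu) (hdis : disintegration rho nu rhoc).
Hypothesis hbern : bernstein nu rhoc sigma M.
Variables (S : local_model R X) (rs : 'I_(ncell S) -> R).
Hypotheses (kappa_ge0 : 0 <= kappa) (hloc : local_setting nu S kappa).
Let f : X -> R := regression rhoc.
Hypothesis hreg : regularity nu f rs Rad.

Let cells : partition [set: 'I_(ncell S)] (cell S) [set: X].
Proof. by case: hloc. Qed.

Let cell_gt0 j : (0 < nu (cell S j))%E.
Proof. by case: hloc => _ /(_ j)[]. Qed.

Let cell_fin j : nu (cell S j) \is a fin_num.
Proof. by apply: fin_num_measure; exact: mcell. Qed.

Lemma cell_rkhs j : is_rkhs (hspace S j) (hkernel S j).
Proof. by case: hloc => _ /(_ j)[_ [hK _] _ _ _]; exact: ext_rkhs. Qed.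

Lemma cell_separable j : is_separable (hspace S j).
Proof. by case: hloc => _ /(_ j)[_ [_ hs] _ _ _]; exact: ext_separable. Qed.

Lemma cell_kernel_measurable j :
  measurable_fun setT (fun u : X * X => hkernel S j u.1 u.2).
Proof. by case: hloc => _ /(_ j)[]. Qed.

Lemma cell_kernel_diag j x : hkernel S j x x <= kappa ^+ 2.
Proof.
case: hloc => _ /(_ j)[_ _ _ _ [kj [kj0 kjk Kle]]].
apply: ext_kernel_diag => u; apply: le_trans (Kle u) _.
by rewrite ler_sqr.
Qed.

Lemma restr_fcar (j : 'I_(ncell S)) : fcar (hspace S j) (restr j f).
Proof.
have [[g Hg ->] _] := hreg.
suff -> : restr j (fun x => \sum_(k < ncell S) g k x) = g j by [].
apply/funext => x; rewrite /restr /patch; case: ifPn => [|/negP] jx.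
  rewrite (sum_cell cells (g := g) (j := j))//; last exact: set_mem.
  by move=> k y ky; exact: ext_fcar_out (Hg k) ky.
by rewrite (ext_fcar_out (Hg j))// => jx'; apply: jx; exact: mem_set.
Qed.

Lemma restr_measurable (j : 'I_(ncell S)) : measurable_fun setT (restr j f).
Proof. exact: (measurable_rkhs (cell_rkhs j) (cell_kernel_measurable j) (restr_fcar j)). Qed.

Lemma restr_cell (j : 'I_(ncell S)) x : cell S j x -> restr j f x = f x.
Proof. by move=> jx; rewrite /restr patchE mem_set. Qed.

Lemma regression_measurable : measurable_fun setT f.
Proof.
rewrite (_ : f = fun x => \sum_(j < ncell S) restr j f x).
  by apply: measurable_sum => j; exact: restr_measurable.
apply/funext => x; have [j jx] := cell_cover cells x.
rewrite (sum_cell cells (g := fun k => restr k f) (j := j))// ?restr_cell//.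
by move=> k y ky; rewrite /restr patchN// notin_setE.
Qed.

Variable (j : 'I_(ncell S)).
Let A := cell S j.
Let nuj := condm nu (mcell S j).
Let Qj := condm rho (measurableX (mcell S j) (@measurableT _ (measurableTypeR R))).
Let w := restr j f.

Let rhoA : rho (A `*` setT) = nu A.
Proof. by apply/esym/hmarg; exact: mcell. Qed.

Let Qj_setT : Qj setT = 1%E.
Proof.
have r0 : (0 < rho (A `*` setT))%E by rewrite rhoA; exact: cell_gt0.
have r1 : rho (A `*` setT) \is a fin_num by rewrite rhoA; exact: cell_fin.
exact: condm_setT r0 r1.
Qed.

Let nuj_setT : nuj setT = 1%E.
Proof. exact: condm_setT (cell_gt0 j) (cell_fin j). Qed.

Let margQ B : measurable B -> to_probability Qj_setT (B `*` setT) = to_probability nuj_setT B.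
Proof.
move=> mB; rewrite /= /mscale/= /mrestr -setXI setTI rhoA -hmarg//.
by apply: measurableI => //; exact: mcell.
Qed.

Let mean_Qj (F : X * measurableTypeR R -> R) : (forall z, 0 <= F z) ->
  measurable_fun setT F ->
  mean (to_probability Qj_setT) F =
    ((fine (nu A))^-1%:E * mean rho (fun z => (\1_A z.1 * F z)%R))%E.
Proof.
move=> F0 mF; rewrite mean_to_probability mean_condm// integral_indicM -rhoA.
congr (_ * mean _ _)%E; apply/funext => z; congr (_ * _); rewrite !indicE.
by congr (nat_of_bool _)%:R; apply/idP/idP => /set_mem h; apply/mem_set => //; case: h.
Qed.

Let mean_nuj (phi : X -> R) : (forall x, 0 <= phi x) -> measurable_fun setT phi ->
  mean (to_probability nuj_setT) phi =
    ((fine (nu A))^-1%:E * mean nu (fun x => (\1_A x * phi x)%R))%E.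
Proof. by move=> p0 mp; rewrite mean_to_probability mean_condm// integral_indicM. Qed.

Let wA x : A x -> w x = f x.
Proof. exact: restr_cell. Qed.

Let indic_in x : A x -> \1_A x = 1 :> R.
Proof. by move=> Ax; rewrite indicE mem_set. Qed.

Let indic_out x : ~ A x -> \1_A x = 0 :> R.
Proof. by move=> Ax; rewrite indicE memNset. Qed.

Let mindic : measurable_fun setT (\1_A : X -> R).
Proof. by apply: measurable_indic; exact: mcell. Qed.

Let mw : measurable_fun setT w := restr_measurable j.

Let mw1 : measurable_fun setT (fun z : X * measurableTypeR R => w z.1).
Proof. exact: measurableT_comp. Qed.

Let snd_R : measurable_fun setT (fun z : X * measurableTypeR R => (z.2 : R)).
Proof. exact: measurable_snd. Qed.

(** Conditioning on the cell amounts to multiplying the test function by the indicator of the cell,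
    on which [w] is the regression function; this reduces to [noise_symmetric]. *)
Lemma cell_noise_centered (phi : X -> R) (b : R) : measurable_fun setT phi ->
  (forall x, `|phi x| <= b) ->
  mean (to_probability Qj_setT) (fun z => Num.max (phi z.1 * ((z.2 : R) - w z.1)) 0) =
  mean (to_probability Qj_setT) (fun z => Num.max (- (phi z.1 * ((z.2 : R) - w z.1))) 0).
Proof.
move=> mphi _.
have max_ge0 (a : R) : 0 <= Num.max a 0 by rewrite le_max lexx orbT.
have mg : measurable_fun setT
    (fun z : X * measurableTypeR R => phi z.1 * ((z.2 : R) - w z.1)).
  apply: measurable_funM; first exact: measurableT_comp.
  exact: measurable_funB.
have mF : measurable_fun setT
    (fun z : X * measurableTypeR R => Num.max (phi z.1 * ((z.2 : R) - w z.1)) 0).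
  by apply: measurable_maxr.
have mG : measurable_fun setT
    (fun z : X * measurableTypeR R => Num.max (- (phi z.1 * ((z.2 : R) - w z.1))) 0).
  by apply: measurable_maxr => //; exact: measurableT_comp.
rewrite (mean_Qj (fun=> max_ge0 _) mF) (mean_Qj (fun=> max_ge0 _) mG).
congr (_ * _)%E.
have := noise_symmetric hdis hbern regression_measurable (measurable_funM mindic mphi).
rewrite -/f => h; apply: etrans (etrans _ h) _; apply: eq_integral => z _ /=; congr EFin.
- have [Az|Az] := pselect (A z.1); first by rewrite indic_in// wA// !mul1r.
  by rewrite indic_out// !mul0r maxxx.
- have [Az|Az] := pselect (A z.1); first by rewrite indic_in// wA// !mul1r.
  by rewrite indic_out// !mul0r oppr0 maxxx.
Qed.

Lemma cell_noise_variance (phi : X -> R) : measurable_fun setT phi ->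
  (forall x, 0 <= phi x) ->
  (mean (to_probability Qj_setT) (fun z => (phi z.1 * ((z.2 : R) - w z.1) ^+ 2)%R) <=
   (sigma ^+ 2)%:E * mean (to_probability nuj_setT) phi)%E.
Proof.
move=> mphi phi0; rewrite mean_nuj// mean_Qj; last 2 first.
- by move=> z; rewrite mulr_ge0// sqr_ge0.
- apply: measurable_funM; first exact: measurableT_comp.
  by apply: measurable_funX; exact: measurable_funB.
rewrite muleCA; apply: lee_wpmul2l.
  by rewrite lee_fin invr_ge0 fine_ge0.
have ip0 x : 0 <= (\1_A \* phi) x by rewrite mulr_ge0.
apply: le_trans (noise_variance hdis hbern regression_measurable (measurable_funM mindic mphi) ip0).
rewrite le_eqVlt; apply/orP; left; apply/eqP; apply: eq_integral => z _ /=; congr EFin.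
have [Az|Az] := pselect (A z.1); first by rewrite indic_in// wA// !mul1r.
by rewrite indic_out// !mul0r.
Qed.

Variables (d' : measure_display) (Omega : measurableType d') (P : probability Omega R).
Variables (n : nat) (Z : 'I_n -> Omega -> X * measurableTypeR R) (lam : R).
Hypotheses (hZ : iid Qj P Z) (n_gt0 : (0 < n)%N) (lam_gt0 : 0 < lam).
Let est om x : R := (krls (hkernel S j) (fun i => Z i om) lam x - w x) ^+ 2.

Let hZ' : iid (to_probability Qj_setT) P Z.
Proof. exact: hZ. Qed.

Lemma cell_risk_measurable : measurable_fun setT (fun om => mean nuj (est om)).
Proof.
have := local_risk_measurable margQ (cell_rkhs j) (cell_kernel_measurable j) hZ' n_gt0 lam_gt0
  (restr_fcar j).
by under eq_fun do rewrite mean_to_probability.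
Qed.

(** The source bounds [lam^(2 s - 1) Rad^2] and [lam^(2 s - 2) Rad^2] of [oppow_source], inserted
    for [A1] and [A2], both become [lam^(2 s + 1) Rad^2]. *)
Lemma cell_risk_bound c : c = (n%:R * lam + kappa ^+ 2) / (n%:R * lam) ->
  (\int[P]_om mean nuj (est om) <=
   (4 * c ^+ 2 * (c ^+ 2 + 1) * lam `^ (2 * rs j + 1) * Rad ^+ 2)%:E +
   (2 * c ^+ 2 * sigma ^+ 2 / n%:R)%:E * effdim (hspace S j) (lcov nu j) lam)%E.
Proof.
have [_ /(_ j)[hs [h [Hh hR wE]]]] := hreg.
have covE : lcov nu j = covop (hspace S j) (hkernel S j) (to_probability nuj_setT) by [].
have [k [Hk kE kA1 kA2]] := oppow_source (to_probability nuj_setT) (cell_rkhs j)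
  (cell_kernel_measurable j) kappa_ge0 (cell_kernel_diag j) lam_gt0 (cell_separable j) hs Hh hR.
rewrite -covE -wE in kE.
move=> cE.
have := local_risk_bound margQ (cell_rkhs j) (cell_kernel_measurable j) kappa_ge0
  (cell_kernel_diag j) hZ' n_gt0 lam_gt0 (restr_fcar j) Hk kE kA1 kA2 (cell_separable j)
  cell_noise_centered cell_noise_variance.
under eq_integral do rewrite mean_to_probability.
move=> /le_trans; apply; rewrite -cE -covE muleA -EFinM; apply: leeD.
  rewrite lee_fin le_eqVlt; apply/orP; left; apply/eqP.
  have l1 : lam `^ (2 * rs j + 1) = lam ^+ 2 * lam `^ (2 * rs j - 1).
    rewrite -powR_mulrn ?ltW// -powRD; last by rewrite (gt_eqF lam_gt0) implybT.
    by congr (_ `^ _); ring.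
  have l2 : lam `^ (2 * rs j - 1) = lam * lam `^ (2 * rs j - 2).
    rewrite -[X in _ = X * _]powRr1 ?ltW// -powRD; last by rewrite (gt_eqF lam_gt0) implybT.
    by congr (_ `^ _); ring.
  by rewrite l1 l2; ring.
by rewrite !mulrA.
Qed.

End CellRisk.

Lemma trace_ge0 (R : realType) (Y : Type) (H : funspace R Y) B : (0 <= trace H B)%E.
Proof.
apply: ereal_sup_ubound; exists set0; last by rewrite fsbig_set0.
by split; [exact: finite_set0|exact: sub0set].
Qed.

(** * Summation over the partition *)

Section TotalRisk.
Variables (R : realType) (d : measure_display) (X : measurableType d).
Variables (rho : probability (X * measurableTypeR R)%type R) (nu : probability X R)
  (rhoc : R.-pker X ~> measurableTypeR R) (sigma M kappa Rad : R).
Hypotheses (hmarg : marginal rho nu) (hdis : disintegration rho nu rhoc).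
Hypothesis hbern : bernstein nu rhoc sigma M.
Variables (S : local_model R X) (rs : 'I_(ncell S) -> R).
Hypotheses (kappa_ge0 : 0 <= kappa) (hloc : local_setting nu S kappa).
Let f : X -> R := regression rhoc.
Hypothesis hreg : regularity nu f rs Rad.
Local Notation m := (ncell S).

Let cells : partition [set: 'I_m] (cell S) [set: X].
Proof. by case: hloc. Qed.

Let cell_gt0 j : (0 < nu (cell S j))%E.
Proof. by case: hloc => _ /(_ j)[]. Qed.

Let weight_ge0 (j : 'I_m) : 0 <= weight nu j.
Proof. by rewrite fine_ge0. Qed.

Let fit_measurable (j : 'I_m) N (z : 'I_N -> X * measurableTypeR R) lam :
  measurable_fun setT (krls (hkernel S j) z lam).
Proof.
apply: measurable_sum => i; apply: measurable_funM => //.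
exact: (measurable_kernel_section (cell_kernel_measurable hloc j)).
Qed.

(** The cells are disjoint, so on cell [j] the estimator and the regression function reduce to their
    [j]-th components. *)
Lemma excess_cells (N : 'I_m -> nat)
    (z : {j : 'I_m & 'I_(N j)} -> X * measurableTypeR R) lam :
  (risk rho (partitioned_krls z lam) - risk rho f =
   \sum_(j < m) ((weight nu j)%:E * mean (condm nu (mcell S j)) (fun x =>
     (krls (hkernel S j) (fun i : 'I_(N j) => z (Tagged (fun j => 'I_(N j)) i)) lam x
      - restr j f x) ^+ 2)%R))%E.
Proof.
rewrite (excess_risk hdis hbern (regression_measurable hloc hreg)); last first.
  by apply: measurable_sum => j; exact: fit_measurable.
apply: (mean_cells cells cell_gt0).
- by move=> j x; exact: sqr_ge0.
- move=> j; apply: measurable_funX; apply: measurable_funB; first exact: fit_measurable.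
  exact: (restr_measurable hloc hreg).
- by move=> j x jx; rewrite (partitioned_krls_cell cells _ _ jx) restr_cell.
Qed.

(** [oppow_source] at [lam = 1] gives [w = (T + 1) k] with norm of [k] at most [Rad]. Pairing with
    [w] bounds its norm by [(kappa^2 + 1) Rad], and evaluation costs [kappa]. *)
Lemma restr_le (j : 'I_m) x : (restr j f x) ^+ 2 <= kappa ^+ 2 * (kappa ^+ 2 + 1) ^+ 2 * Rad ^+ 2.
Proof.
have [_ /(_ j)[hs [h [Hh hR wE]]]] := hreg.
have hcell : nu (cell S j) \is a fin_num by apply: fin_num_measure; exact: mcell.
pose nuj := to_probability (condm_setT (mcell S j) (cell_gt0 j) hcell).
have rk := cell_rkhs hloc j; have mk := cell_kernel_measurable hloc j.
have dk := cell_kernel_diag kappa_ge0 hloc j.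
have [k [Hk kE _ kA2]] :=
  oppow_source nuj rk mk kappa_ge0 dk ltr01 (cell_separable hloc j) hs Hh hR.
rewrite powR1 mul1r in kA2.
have Hw := restr_fcar hloc hreg j; set w := restr j f in Hw *.
have {}wE : w = fun x => 1 * k x + covop (hspace S j) (hkernel S j) nuj k x.
  by rewrite /w wE -/nuj; apply: etrans kE _; apply/funext => y; rewrite addrC.
have hH := rkhs_hilbert rk.
have HT := covop_fcar nuj rk mk kappa_ge0 dk Hk.
have kR : fnorm (hspace S j) k <= Rad.
  rewrite -(@ler_sqr _ _ Rad) ?nnegrE ?fnorm_ge0//; first by rewrite (sqr_fnorm hH).
  exact: le_trans (fnorm_ge0 _ _) hR.
have wR : fnorm (hspace S j) w <= (kappa ^+ 2 + 1) * Rad.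
  have [w0|w0] := leP (fnorm (hspace S j) w) 0.
    apply: le_trans w0 _; rewrite mulr_ge0 ?addr_ge0 ?sqr_ge0//.
    exact: le_trans (fnorm_ge0 _ _) hR.
  rewrite -(ler_pM2r w0) -expr2 (sqr_fnorm hH Hw) {1}wE (ipZDl hH)// mul1r.
  rewrite (ip_covop nuj rk mk kappa_ge0 dk Hk Hw).
  have h1 := le_trans (ler_norm _) (l2_abs_le nuj rk mk kappa_ge0 dk Hk Hw).
  have h2 := le_trans (ler_norm _) (ip_le_fnorm hH Hk Hw).
  apply: le_trans (lerD h2 h1) _.
  have -> : kappa * fnorm (hspace S j) k * (kappa * fnorm (hspace S j) w) =
    kappa ^+ 2 * (fnorm (hspace S j) k * fnorm (hspace S j) w) by ring.
  rewrite -[X in X + _]mul1r -mulrDl [1 + _]addrC -!mulrA ler_wpM2l ?addr_ge0 ?sqr_ge0//.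
  by rewrite ler_wpM2r// fnorm_ge0.
have := rkhs_eval_le rk kappa_ge0 (dk x) Hw.
move=> wx; rewrite -real_normK ?num_real// -!exprMn ler_sqr ?nnegrE ?normr_ge0//.
  by apply: le_trans wx _; rewrite -mulrA ler_wpM2l.
rewrite !mulr_ge0// ?addr_ge0 ?sqr_ge0//; exact: le_trans (fnorm_ge0 _ _) hR.
Qed.

Variables (d' : measure_display) (Omega : measurableType d') (P : probability Omega R).
Variables (N : nat) (Z : {j : 'I_m & 'I_N} -> Omega -> X * measurableTypeR R).

(** Without data the estimator is zero, so the excess risk is the mean square of the regression
    function. *)
Lemma total_risk_no_sample lam : N = 0%N ->
  (\int[P]_w (risk rho (partitioned_krls (fun i => Z i w) lam) - risk rho f) <=
   (kappa ^+ 2 * (kappa ^+ 2 + 1) ^+ 2 * Rad ^+ 2)%:E)%E.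
Proof.
move=> N0; set B := kappa ^+ 2 * (kappa ^+ 2 + 1) ^+ 2 * Rad ^+ 2.
have est0 (z : {j : 'I_m & 'I_N} -> X * measurableTypeR R) :
    partitioned_krls z lam = (fun=> 0).
  apply/funext => x; rewrite /partitioned_krls big1// => j _; rewrite /krls big1// => i.
  by have := ltn_ord i; rewrite [X in (_ < X)%N -> _]N0.
under eq_integral do rewrite est0.
rewrite (excess_risk hdis hbern (regression_measurable hloc hreg)); last exact: measurable_cst.
rewrite -[leLHS]/(\int[P]_w cst (mean nu (fun x => (0 - f x) ^+ 2)%R) w)%E integral_cst//.
rewrite [X in (_ * X)%E](probability_setT P) mule1 -(mean_cst nu B); apply: mean_le.
- move=> x; rewrite sqr_ge0 sub0r sqrrN.
  have [j jx] := cell_cover cells x; rewrite /f -(restr_cell _ jx); exact: restr_le.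
- apply: measurable_funX; apply: measurable_funB => //.
  exact: (regression_measurable hloc hreg).
- exact: measurable_cst.
Qed.

Variables (gamma C1 C2 lam c L : R).
Hypotheses (hcap : capacity nu S gamma C1 C2) (hZ : local_samples P rho Z).
Hypotheses (N_gt0 : (0 < N)%N) (lam_gt0 : 0 < lam).
Hypothesis hc : (N%:R * lam + kappa ^+ 2) / (N%:R * lam) <= c.
Hypothesis hL : forall j, lam `^ (2 * rs j + 1) <= L.

(** The comparison of local and global effective dimensions is used at [lam], the decay at [m lam].
    Absolute values appear because the signs of [C1] and [C2] are not prescribed. *)
Lemma weighted_effdim_le :
  (\sum_(j < m) ((weight nu j)%:E * effdim (hspace S j) (lcov nu j) lam) <=
   (`|C1| * `|C2| * (m%:R * lam) `^ (- gamma) / m%:R)%:E)%E.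
Proof.
have m_gt0 : 0 < m%:R :> R by rewrite ltr0n (ncell_gt0 cells cell_gt0).
have [h1 _] := hcap lam_gt0.
have [_ h2] := hcap (mulr_gt0 m_gt0 lam_gt0).
rewrite EFinM muleC lee_pdivlMl//.
apply: le_trans h1 _; have := @trace_ge0 _ _ (dspace nu S)
  (fun g => resolvent (dspace nu S) (gcov nu S) (m%:R * lam) (gcov nu S g)).
rewrite -/(effdim _ _ _) => eff_ge0.
apply: (@le_trans _ _ (`|C1|%:E * effdim (dspace nu S) (gcov nu S) (m%:R * lam))%E).
  by apply: lee_wpmul2r => //; rewrite lee_fin ler_norm.
rewrite -mulrA EFinM; apply: lee_wpmul2l; first by rewrite lee_fin.
apply: le_trans h2 _; by rewrite lee_fin ler_wpM2r ?powR_ge0// ler_norm.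
Qed.

Lemma total_risk_bound :
  (\int[P]_w (risk rho (partitioned_krls (fun i => Z i w) lam) - risk rho f) <=
   (4 * c ^+ 2 * (c ^+ 2 + 1) * L * Rad ^+ 2 +
    2 * c ^+ 2 * sigma ^+ 2 / N%:R * (`|C1| * `|C2| * (m%:R * lam) `^ (- gamma) / m%:R))%:E)%E.
Proof.
pose c1 := (N%:R * lam + kappa ^+ 2) / (N%:R * lam).
have c1_ge0 : 0 <= c1 by rewrite divr_ge0 ?addr_ge0 ?mulr_ge0 ?sqr_ge0// ltW.
have cc : c1 ^+ 2 <= c ^+ 2 by rewrite ler_sqr ?nnegrE// (le_trans c1_ge0).
pose V := 2 * c ^+ 2 * sigma ^+ 2 / N%:R.
pose B := 4 * c ^+ 2 * (c ^+ 2 + 1) * L * Rad ^+ 2.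
under eq_integral do rewrite excess_cells.
have iidj j := local_samples_iid j hZ.
rewrite ge0_integral_sum//; last 2 first.
- move=> j; apply: measurable_funeM.
  exact: (cell_risk_measurable hmarg hloc hreg (iidj j) N_gt0 lam_gt0).
- move=> j w _; apply: mule_ge0; first by rewrite lee_fin.
  by apply: mean_ge0 => x; exact: sqr_ge0.
apply: (@le_trans _ _ (\sum_(j < m) ((weight nu j)%:E *
    (B%:E + V%:E * effdim (hspace S j) (lcov nu j) lam)))%E).
  apply: lee_sum => j _; rewrite ge0_integralZl_EFin//; last 2 first.
  - by move=> w _; apply: mean_ge0 => x; exact: sqr_ge0.
  - exact: (cell_risk_measurable hmarg hloc hreg (iidj j) N_gt0 lam_gt0).
  apply: lee_wpmul2l; first by rewrite lee_fin.
  apply: le_trans (cell_risk_bound hmarg hdis hbern kappa_ge0 hloc hreg (iidj j) N_gt0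
    lam_gt0 (erefl c1)) _.
  apply: leeD.
    rewrite lee_fin ler_wpM2r ?sqr_ge0//; apply: ler_pM => //.
    - by move: (c1 ^+ 2) (sqr_ge0 c1) => a a0; nra.
    - exact: powR_ge0.
    - by move: (c1 ^+ 2) (c ^+ 2) (sqr_ge0 c1) cc => a b a0 ab; nra.
  apply: lee_wpmul2r; first exact: trace_ge0.
  by rewrite lee_fin !ler_wpM2r ?invr_ge0 ?sqr_ge0 ?ler_wpM2l.
have B_ge0 : (0 <= B%:E)%E.
  (* [L] is known to be nonnegative only through some cell, so a cell is exhibited. *)
  have [j] : exists j : 'I_m, true by exists (Ordinal (ncell_gt0 cells cell_gt0)).
  move=> _; rewrite lee_fin; apply: mulr_ge0; last exact: sqr_ge0.
  apply: mulr_ge0; last exact: le_trans (powR_ge0 _ _) (hL j).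
  by move: (c ^+ 2) (sqr_ge0 c) => a a0; nra.
have V_ge0 : 0 <= V.
  by rewrite /V; apply: divr_ge0 => //; apply: mulr_ge0; [apply: mulr_ge0|]; rewrite // sqr_ge0.
under eq_bigr => j _.
  rewrite ge0_muleDr//; last by rewrite mule_ge0 ?lee_fin//; exact: trace_ge0.
  rewrite muleCA; over.
rewrite big_split/= EFinD; apply: leeD.
  rewrite -ge0_sume_distrl => [|j _]; last by rewrite lee_fin.
  by rewrite sumEFin (sum_weight cells cell_gt0) mul1e.
rewrite -ge0_sume_distrr => [|j _]; last by rewrite mule_ge0 ?lee_fin//; exact: trace_ge0.
rewrite [leRHS]EFinM; apply: lee_wpmul2l; first by rewrite lee_fin.
exact: weighted_effdim_le.
Qed.

End TotalRisk.

(** * Rates *)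

Section Rates.
Variables (R : realType) (r gamma alpha : R) (n : nat).
Hypotheses (hr : 0 < r <= 2^-1) (hgamma : 0 < gamma <= 1).
Hypothesis halpha : alpha <= 2 * r / (2 * r + 1 + gamma).
Hypothesis n_gt0 : (0 < n)%N.
Let s := 2 * r + 1 + gamma.
Let x : R := n%:R.
Let u : R := x^-1 `^ (1 / s).
Let t : R := x^-1 `^ ((2 * r + 1) / s).

Let r_gt0 : 0 < r. Proof. by case/andP: hr. Qed.
Let r_le : r <= 2^-1. Proof. by case/andP: hr. Qed.
Let g_gt0 : 0 < gamma. Proof. by case/andP: hgamma. Qed.
Let s_gt0 : 0 < s. Proof. rewrite /s; move: r_gt0 g_gt0; lra. Qed.
Let x_ge1 : 1 <= x. Proof. by rewrite /x ler1n. Qed.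
Let x_gt0 : 0 < x. Proof. exact: lt_le_trans ltr01 x_ge1. Qed.

Let xD a b : x `^ (a + b) = x `^ a * x `^ b.
Proof. by rewrite powRD// (gt_eqF x_gt0) implybT. Qed.

Let invxE a : x^-1 `^ a = x `^ (- a).
Proof. by rewrite -powR_inv1 ?ltW// -powRrM mulN1r. Qed.

Let xr a b : a <= b -> x `^ a <= x `^ b.
Proof. exact: ler_powR. Qed.

(** As [2 a + 1 <= 2], the constant contributes at most [(max 1 cu)^2]; as [n >= 1], an exponent
    [a >= r] only improves the power of [1/n]. *)
Lemma rate_source (lam cu a : R) : 0 < lam -> lam <= cu * u -> r <= a -> a <= 2^-1 ->
  lam `^ (2 * a + 1) <= Num.max 1 cu ^+ 2 * t.
Proof.
move=> lam0 lamu ra a2; have u0 : 0 <= u by exact: powR_ge0.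
have K1 : 1 <= Num.max 1 cu by rewrite le_max lexx.
have K0 : 0 <= Num.max 1 cu := le_trans ler01 K1.
have p0 : 0 <= 2 * a + 1 by move: r_gt0 ra; lra.
apply: (@le_trans _ _ ((Num.max 1 cu * u) `^ (2 * a + 1))).
  apply: ge0_ler_powR; rewrite ?nnegrE ?mulr_ge0 ?(ltW lam0)//.
  by apply: le_trans lamu _; rewrite ler_wpM2r// le_max lexx orbT.
rewrite powRM//; apply: ler_pM; rewrite ?powR_ge0//.
  by rewrite -powR_mulrn//; apply: ler_powR => //; move: a2; lra.
rewrite /u /t !invxE -powRrM; apply: xr.
rewrite mulNr mul1r lerN2 [leRHS]mulrC; apply: ler_wpM2r; first by rewrite invr_ge0 ltW.
by move: ra; lra.
Qed.

(** The factor [m >= 1] is discarded, and [n^-1 u^(-gamma) = t] because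
    [1 - gamma / s = (2 r + 1) / s]. *)
Lemma rate_variance (lam cl : R) (m : nat) : 0 < cl -> cl * u <= lam -> (0 < m)%N ->
  x^-1 * (m%:R * lam) `^ (- gamma) <= cl `^ (- gamma) * t.
Proof.
move=> cl0 ul m0.
have u0 : 0 < u by rewrite /u powR_gt0// invr_gt0.
have lam0 : 0 <= lam by apply: le_trans ul; rewrite mulr_ge0 ?ltW.
have lmul : cl * u <= m%:R * lam by apply: le_trans ul _; rewrite ler_peMl ?ler1n.
have h : (m%:R * lam) `^ (- gamma) <= (cl * u) `^ (- gamma).
  by apply: le0_ger_powR; rewrite ?mulr_gt0 ?lmul//; move: g_gt0; lra.
apply: le_trans (ler_wpM2l _ h) _; first by rewrite invr_ge0 ltW.
rewrite (powRM _ (ltW cl0) (ltW u0)) mulrCA le_eqVlt; apply/orP; left; apply/eqP; congr (_ * _).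
rewrite -powR_inv1 ?(ltW x_gt0)// /u /t !invxE -powRrM -xD; congr (_ `^ _).
by rewrite /s; field; exact: lt0r_neq0.
Qed.

Variables (m : nat) (cm : R).
Hypothesis hm : m%:R <= cm * x `^ alpha.

Let cm' : R := `|cm| + 1.
Let cm'_gt0 : 0 < cm'. Proof. by rewrite /cm' ltr_wpDl. Qed.

Let hm' : m%:R <= cm' * x `^ (2 * r / s).
Proof.
apply: le_trans hm _; apply: (@le_trans _ _ (cm' * x `^ alpha)).
  by rewrite ler_wpM2r ?powR_ge0// /cm' (le_trans (ler_norm cm))// lerDl.
by rewrite ler_wpM2l ?(ltW cm'_gt0)//; exact: xr.
Qed.

(** [n < m] forces [n^((1 + gamma) / s) <= cm']. Squaring suffices since
    [2 r + 1 <= 2 (1 + gamma)]. *)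
Lemma rate_few_samples : (n < m)%N -> 1 <= cm' ^+ 2 * t.
Proof.
move=> nm; have xm : x <= cm' * x `^ (2 * r / s).
  by apply: le_trans hm'; rewrite ler_nat ltnW.
have h : x `^ ((1 + gamma) / s) <= cm'.
  rewrite -(ler_pM2r (powR_gt0 (2 * r / s) x_gt0)) -xD.
  rewrite (_ : (1 + gamma) / s + _ = 1) ?powRr1 ?(ltW x_gt0)//.
  by rewrite /s; field; exact: lt0r_neq0.
have h2 : x `^ ((2 * r + 1) / s) <= cm' ^+ 2.
  apply: (@le_trans _ _ ((x `^ ((1 + gamma) / s)) ^+ 2)); last first.
    by rewrite ler_sqr ?nnegrE ?powR_ge0// (ltW cm'_gt0).
  rewrite -powR_mulrn ?powR_ge0// -powRrM; apply: xr.
  rewrite mulrAC; apply: ler_wpM2r; first by rewrite invr_ge0 ltW.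
  by move: r_le g_gt0; lra.
have tE : t = (x `^ ((2 * r + 1) / s))^-1 by rewrite /t invxE powRN.
by rewrite tE ler_pdivlMr ?mul1r// powR_gt0.
Qed.

(** The remainder of [n] modulo [m] is below [m], itself at most [(n %/ m) * m]. *)
Lemma double_divn : (0 < m)%N -> (m <= n)%N -> x / 2 <= (n %/ m)%:R * m%:R.
Proof.
move=> m0 mn; rewrite ler_pdivrMr// -!natrM ler_nat muln2 -addnn.
rewrite [X in (X <= _)%N](divn_eq n m) leq_add2l.
by apply: ltnW; apply: leq_trans (ltn_pmod n m0) _; rewrite leq_pmull// divn_gt0.
Qed.

(** [n %/ m] is at least of order [n^(1 - 2 r / s)] and [lam] at least of order [n^(- 1 / s)]; the
    exponents add up to [gamma / s >= 0]. *)
Lemma rate_local (lam cl : R) : 0 < cl -> cl * u <= lam -> (0 < m)%N -> (m <= n)%N ->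
  cl / (2 * cm') <= (n %/ m)%:R * lam.
Proof.
move=> cl0 ul m0 mn.
have N0 : 0 <= (n %/ m)%:R :> R by [].
have hx := double_divn m0 mn.
apply: (@le_trans _ _ (cl * ((n %/ m)%:R * u))); last first.
  by rewrite mulrCA ler_wpM2l.
rewrite ler_wpM2l ?(ltW cl0)//.
have hN : x / 2 <= (n %/ m)%:R * (cm' * x `^ (2 * r / s)).
  by apply: le_trans hx _; rewrite ler_wpM2l.
have y0 := powR_gt0 (2 * r / s) x_gt0.
have hN' : x / x `^ (2 * r / s) / (2 * cm') <= (n %/ m)%:R.
  rewrite ler_pdivrMr ?mulr_gt0// ler_pdivrMr//.
  rewrite -(ler_pM2r (_ : 0 < 2^-1)) ?invr_gt0// (le_trans hN)// le_eqVlt.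
  by apply/orP; left; apply/eqP; field.
have u0 : 0 <= u by exact: powR_ge0.
apply: le_trans (ler_wpM2r u0 hN').
rewrite mulrAC -[leLHS]mul1r ler_wpM2r ?invr_ge0 ?mulr_ge0 ?(ltW cm'_gt0)//.
rewrite -{1}[x]powRr1 ?(ltW x_gt0)// -powRN /u invxE -!xD -[leLHS](powRr0 x).
apply: xr; rewrite (_ : _ + _ = gamma / s); first by rewrite divr_ge0 ?ltW.
by rewrite /s; field; exact: lt0r_neq0.
Qed.

End Rates.

(** * A constant uniform in the model, the partition and the sample size *)

Theorem theorem1 (R : realType)
    (r gamma alpha kappa sigma M Rad : R) (C1 C2 cm cl cu : R)
    (hr : 0 < r <= 2^-1) (hgamma : 0 < gamma <= 1)
    (halpha : alpha <= 2 * r / (2 * r + 1 + gamma))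
    (hkappa : 0 <= kappa) (hsigma : 0 < sigma) (hM : 0 < M) (hRad : 0 < Rad)
    (hcl : 0 < cl) :
  exists2 C : R, 0 < C &
  forall (d : measure_display) (X : measurableType d)
    (rho : probability (X * measurableTypeR R)%type R)
    (nu : probability X R) (rhoc : R.-pker X ~> measurableTypeR R),
  standard_borel R X ->
  marginal rho nu ->
  disintegration rho nu rhoc ->
  bernstein nu rhoc sigma M ->
  forall (S : nat -> local_model R X)
    (rs : forall n, 'I_(ncell (S n)) -> R) (lam : nat -> R),
  (forall n, (0 < n)%N ->
    [/\ local_setting nu (S n) kappa,
        regularity nu (regression rhoc) (rs n) Rad,
        (forall j, r <= rs n j) /\ (exists j, rs n j = r) &
        capacity nu (S n) gamma C1 C2]) ->
  (forall n, (0 < n)%N ->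
    cl * n%:R^-1 `^ (1 / (2 * r + 1 + gamma)) <= lam n
      <= cu * n%:R^-1 `^ (1 / (2 * r + 1 + gamma))) ->
  (forall n, (0 < n)%N -> (ncell (S n))%:R <= cm * n%:R `^ alpha) ->
  forall n, (0 < n)%N ->
  forall (d' : measure_display) (Omega : measurableType d')
    (P : probability Omega R)
    (Z : {j : 'I_(ncell (S n)) & 'I_(n %/ ncell (S n))} ->
         Omega -> X * measurableTypeR R),
  local_samples P rho Z ->
  (\int[P]_w (risk rho
                (partitioned_krls (fun i => Z i w) (lam n))
              - risk rho (regression rhoc))
    <= (C * (Rad ^+ 2 *
          n%:R^-1 `^ ((2 * r + 1) / (2 * r + 1 + gamma))))%:E)%E.
Proof.
pose s := 2 * r + 1 + gamma.
pose cm' := `|cm| + 1.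
(* Upper bound for [1 + kappa^2 / (N lam)], since [rate_local] gives [N lam >= cl / (2 cm')]. *)
pose c0 := 1 + kappa ^+ 2 * (2 * cm' / cl).
pose D := kappa ^+ 2 * (kappa ^+ 2 + 1) ^+ 2.
pose K := Num.max 1 cu ^+ 2.
pose B := 4 * c0 ^+ 2 * (c0 ^+ 2 + 1) * K.
(* The 4 is the 2 of [total_risk_bound] times the 2 in [1 / (N m) <= 2 / n]. *)
pose V := 4 * c0 ^+ 2 * sigma ^+ 2 * (`|C1| * `|C2|) * cl `^ (- gamma).
have D0 : 0 <= D by rewrite /D mulr_ge0 ?sqr_ge0.
have K0 : 0 <= K by exact: sqr_ge0.
have c00 : 0 <= c0 ^+ 2 by exact: sqr_ge0.
have B0 : 0 <= B by rewrite /B; move: (c0 ^+ 2) c00 => c c00; rewrite mulr_ge0//; nra.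
have V0 : 0 <= V.
  rewrite /V; apply: mulr_ge0; last exact: powR_ge0.
  apply: mulr_ge0; last exact: mulr_ge0.
  by apply: mulr_ge0; [apply: mulr_ge0|exact: sqr_ge0].
have Rad2 : 0 < Rad ^+ 2 by rewrite exprn_gt0.
have Dcm : 0 <= D * cm' ^+ 2 by apply: mulr_ge0 => //; exact: sqr_ge0.
have VR : 0 <= V / Rad ^+ 2 by rewrite divr_ge0// ltW.
(* The variance carries no factor [Rad^2], so [V] is divided by it. [D * cm'^2] covers the case of
   empty samples, and the 1 makes the constant positive. *)
exists (B + V / Rad ^+ 2 + D * cm' ^+ 2 + 1).
  by rewrite ltr_wpDl// !addr_ge0.
move=> d X rho nu rhoc _ hmarg hdis hbern S rs lam hS hlam hncell n n0 d' Omega P Z hZ.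
have [hloc hreg [hrs _] hcap] := hS _ n0.
have /andP[lam_ge lam_le] := hlam _ n0.
have x0 : 0 < n%:R :> R by rewrite ltr0n.
have lam0 : 0 < lam n.
  by apply: lt_le_trans lam_ge; rewrite mulr_gt0// powR_gt0// invr_gt0.
have m0 : (0 < ncell (S n))%N.
  by have [cells hcell] := hloc; apply: (ncell_gt0 (nu := nu) cells) => j; case: (hcell j).
set T := n%:R^-1 `^ _.
have T0 : 0 <= T by exact: powR_ge0.
(* If [n < m] the local samples are empty, and the rate itself is bounded below by a constant. *)
have [nm|mn] := ltnP n (ncell (S n)).
  apply: le_trans (total_risk_no_sample hdis hbern hkappa hloc hreg P Z (lam n) _) _.
    exact: divn_small.
  rewrite lee_fin -/D; have h := rate_few_samples hr hgamma halpha n0 (hncell _ n0) nm.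
  rewrite -/T -/cm' in h.
  apply: (@le_trans _ _ (D * cm' ^+ 2 * (Rad ^+ 2 * T))).
    rewrite (_ : _ * (_ * T) = D * Rad ^+ 2 * (cm' ^+ 2 * T)); last by ring.
    by rewrite ler_peMr// mulr_ge0// ltW.
  apply: ler_wpM2r; first by apply: mulr_ge0 => //; exact: ltW.
  by rewrite -addrA addrCA lerDl !addr_ge0.
have hL j : lam n `^ (2 * rs n j + 1) <= K * T.
  have [_ /(_ j)[/andP[_ rs2] _]] := hreg.
  exact: (rate_source hr hgamma n0 lam0 lam_le (hrs j) rs2).
have N0 : (0 < n %/ ncell (S n))%N by rewrite divn_gt0.
set N := (n %/ ncell (S n))%N in Z hZ N0 *.
have Nlam : 0 < N%:R * lam n by rewrite mulr_gt0// ltr0n.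
have hc : (N%:R * lam n + kappa ^+ 2) / (N%:R * lam n) <= c0.
  rewrite mulrDl divff ?gt_eqF// lerD2l ler_wpM2l ?sqr_ge0//.
  have h := rate_local hr hgamma halpha n0 (hncell _ n0) hcl lam_ge m0 mn.
  rewrite -[leRHS]invf_div lef_pV2 ?posrE//.
  by rewrite divr_gt0// mulr_gt0// ltr_wpDl.
apply: le_trans (total_risk_bound hmarg hdis hbern hkappa hloc hreg hcap hZ N0 lam0 hc hL) _.
rewrite lee_fin.
have hv := rate_variance hr hgamma n0 hcl lam_ge m0.
have hd := double_divn R m0 mn.
rewrite -/T in hv; rewrite -/N in hd; set E := (_ * lam n) `^ _ in hv *.
have E0 : 0 <= E by exact: powR_ge0.
pose W := 2 * c0 ^+ 2 * sigma ^+ 2 * (`|C1| * `|C2|).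
have W0 : 0 <= W.
  rewrite /W; apply: mulr_ge0; last exact: mulr_ge0.
  by apply: mulr_ge0; [apply: mulr_ge0|exact: sqr_ge0].
have hNm : (N%:R * (ncell (S n))%:R)^-1 <= 2 * n%:R^-1 :> R.
  rewrite -[leRHS]invf_div lef_pV2 ?posrE ?divr_gt0//.
  by apply: lt_le_trans hd; rewrite divr_gt0.
have noise_le : W * (E * (N%:R * (ncell (S n))%:R)^-1) <= V * T.
  rewrite (_ : V * T = W * (2 * (cl `^ (- gamma) * T))); last by rewrite /V /W; ring.
  apply: ler_wpM2l => //; apply: (@le_trans _ _ (2 * (n%:R^-1 * E))).
    by rewrite mulrA [leRHS]mulrC; exact: ler_wpM2l.
  by rewrite ler_wpM2l.
have -> : 4 * c0 ^+ 2 * (c0 ^+ 2 + 1) * (K * T) * Rad ^+ 2 = B * (Rad ^+ 2 * T).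
  by rewrite /B; ring.
have -> : 2 * c0 ^+ 2 * sigma ^+ 2 / N%:R * (`|C1| * `|C2| * E / (ncell (S n))%:R) =
    W * (E * (N%:R * (ncell (S n))%:R)^-1).
  by rewrite /W invfM; ring.
have -> : (B + V / Rad ^+ 2 + D * cm' ^+ 2 + 1) * (Rad ^+ 2 * T) =
    B * (Rad ^+ 2 * T) + V * T + (D * cm' ^+ 2 + 1) * (Rad ^+ 2 * T).
  by field; exact: lt0r_neq0.
rewrite -addrA lerD2l; apply: le_trans noise_le _; rewrite lerDl.
by apply: mulr_ge0; [apply: addr_ge0|apply: mulr_ge0 => //; exact: ltW].
Qed.
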